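(* Let $\beta\in\mathbb{R}\setminus\{0\}$ and let $$\overline U_{1,\beta}(\xi_1,\xi_2,\xi_3)=\beta\left(\frac{\sqrt\pi}{2}e^{-\xi_2^2/4}\,\mathrm{erfi}\!\left(\frac{\xi_2}{2}\right),0,0\right).$$ Let $L_\phi$ be the linearization of the three-dimensional incompressible Euler equations around $\overline U_{1,\beta}$. Then there exists $\lambda\in\sigma_{ap}(L_\phi,L^2(\mathbb{R}^3))$ with $\operatorname{Re}(\lambda)>0$.
   Context: $\mathrm{erfi}(z)=\frac{2}{\sqrt\pi}\int_0^z e^{t^2}dt$. The linearized Euler operator around a background $\overline U$ is $L_\phi V=-\mathbb{P}(\overline U\cdot\nabla V+V\cdot\nabla\overline U)$, where $\mathbb{P}$ is the Leray projection (i.e. $-\overline U\cdot\nabla V-V\cdot\nabla\overline U$ plus the pressure gradient making the result divergence-free), considered on divergence-free fields in $L^2(\mathbb{R}^3)$ with its maximal domain. $\sigma_{ap}(L,X)$ denotes the approximate point spectrum of the operator $L$ on $X$: those $\lambda\in\mathbb{C}$ for which there are $V_n\in D(L)$ with $\|V_n\|_X=1$ and $\|(L-\lambda)V_n\|_X\to0$. *)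

(* Defs.v *)
From HB Require Import structures.
From mathcomp Require Import all_boot all_order all_algebra.
From mathcomp Require Import complex.
From mathcomp Require Import all_classical all_reals all_analysis.

Set Implicit Arguments.
Unset Strict Implicit.
Unset Printing Implicit Defensive.

Import Order.TTheory GRing.Theory Num.Theory.
Import numFieldNormedType.Exports.

Local Open Scope classical_set_scope.
Local Open Scope ring_scope.
Local Open Scope complex_scope.

Section LinearizedEuler.
Variable R : realType.

(* A point (x1, x2, x3) of R^3 is encoded as ((x1, x2), x3), so that both the
   normed-module structure and the product of Lebesgue measures apply; the
   indices 1, 2, 3 become the elements 0, 1, 2 of 'I_3. *)
Local Notation R3 := (R * R * R)%type.

Definition leb3 :=
  ((@lebesgue_measure R \x @lebesgue_measure R) \x @lebesgue_measure R)%E.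

Definition basis3 (i : 'I_3) : R3 :=
  ((val i == 0%N)%:R, (val i == 1%N)%:R, (val i == 2%N)%:R).

Definition partial (i : 'I_3) (f : R3 -> R) : R3 -> R :=
  fun x => 'D_(basis3 i) f x.

Fixpoint Ck (k : nat) (f : R3 -> R) : Prop :=
  continuous f /\
  if k is k'.+1 then
    forall i, (forall x, derivable f x (basis3 i)) /\ Ck k' (partial i f)
  else True.

Definition smooth (f : R3 -> R) : Prop := forall k, Ck k f.

(* Real-valued test functions suffice for complex-valued distributions: these
   extend to complex-valued test functions by linearity. *)
Definition test_function (phi : R3 -> R) : Prop :=
  smooth phi /\ compact (closure [set x | phi x != 0]).

Definition cintegral (f : R3 -> R[i]) : R[i] :=
  (\int[leb3]_x complex.Re (f x)) +i* (\int[leb3]_x complex.Im (f x)).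

(* Square integrability of a representative (Borel measurable, finite norm). *)
Definition L2fun (f : R3 -> R[i]) : Prop :=
  (fun x => complex.Re (f x)) \in Lfun leb3 2%:E /\
  (fun x => complex.Im (f x)) \in Lfun leb3 2%:E.

(* Functionals on test functions; those occurring below, obtained from locally
   integrable functions by differentiation and by multiplication with smooth
   functions, are genuine distributions. *)
Definition distr3 := (R3 -> R) -> R[i].

Definition dfun (f : R3 -> R[i]) : distr3 :=
  fun phi => cintegral (fun x => f x * (phi x)%:C).

Definition dpartial (i : 'I_3) (F : distr3) : distr3 :=
  fun phi => - F (partial i phi).

Definition dmul (a : R3 -> R) (F : distr3) : distr3 :=
  fun phi => F (fun x => a x * phi x).

Definition cvfield := 'I_3 -> R3 -> R[i].

Definition L2_divfree (V : cvfield) : Prop :=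
  (forall i, L2fun (V i)) /\
  (forall phi, test_function phi ->
     \sum_(i < 3) dpartial i (dfun (V i)) phi = 0).

Definition L2norm (V : cvfield) : \bar R :=
  Lnorm leb3 2%:E (fun x => (Num.sqrt (\sum_(i < 3)
    (complex.Re (V i x) ^+ 2 + complex.Im (V i x) ^+ 2)))%:E).

(* The j-th component of (U . grad) V + (V . grad) U. *)
Definition lin_advection (U : 'I_3 -> R3 -> R) (V : cvfield) (j : 'I_3) :
    distr3 :=
  fun phi => \sum_(i < 3) dmul (U i) (dpartial i (dfun (V j))) phi
           + \sum_(i < 3) dmul (partial i (U j)) (dfun (V i)) phi.

(* The graph of the Leray projection, W = P F, on distributions F = div M with
   M a matrix field in L^2: W is F plus the gradient of the pressure that makes
   W divergence-free.  For such F this pressure is the sum of the Riesz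
   transforms R_i R_j M_ij, hence in L^2, and no other pressure in L^2 yields a
   divergence-free W. *)
Definition leray (F : 'I_3 -> distr3) (W : cvfield) : Prop :=
  L2_divfree W /\
  exists2 p : R3 -> R[i], L2fun p &
    forall (j : 'I_3) phi, test_function phi ->
      dfun (W j) phi = F j phi + dpartial j (dfun p) phi.

(* The graph of L_phi around a smooth, bounded, divergence-free U:
   W = - P ((U . grad) V + (V . grad) U), with its maximal domain, i.e. all V
   for which the right-hand side, a distribution, is in L^2.  For V in L^2 and
   such a U, the argument of P is div (U (x) V + V (x) U). *)
Definition linearized_euler (U : 'I_3 -> R3 -> R) (V W : cvfield) : Prop :=
  L2_divfree V /\ leray (fun j phi => - lin_advection U V j phi) W.

(* An unbounded operator on L^2 is given by its graph: V is in the domain and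
   W = L V exactly when L V W. *)
Definition sigma_ap (L : cvfield -> cvfield -> Prop) : set R[i] :=
  [set lambda | exists V W : nat -> cvfield,
    [/\ forall n, L (V n) (W n),
        forall n, L2norm (V n) = 1%E &
        L2norm (fun i x => W n i x - lambda * V n i x) @[n --> \oo] --> 0%E]].

Definition erfi (z : R) : R :=
  2 / Num.sqrt pi *
  (if 0 <= z then \int[lebesgue_measure]_(t in `[0, z]) expR (t ^+ 2)
   else - \int[lebesgue_measure]_(t in `[z, 0]) expR (t ^+ 2)).

Definition Ubar (beta : R) (i : 'I_3) (x : R3) : R :=
  let x2 := x.1.2 in
  if val i == 0%N then
    beta * (Num.sqrt pi / 2 * expR (- (x2 ^+ 2 / 4)) * erfi (x2 / 2))
  else 0.

End LinearizedEuler.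

(* Main.v *)
(* Write D for Dawson's function, so that the shear is U(y) = beta D(y/2) with
   D' = 1 - 2 s D, s = y/2.  Since D''/D is regular, the Rayleigh equation
   psi'' = (1 + D''/(D - i gamma)) psi in s makes sense for every gamma >= 0.  Let
   psi be its Jost solution, psi ~ e^s at -oo.  By the parity of D, psi extends to
   a solution decaying at both ends iff Re(psi' conj psi)(0) = 0.  This quantity
   is negative at gamma = 0 (Wronskians with D and exp(-s^2)) and positive for
   large gamma, hence vanishes for some gamma > 0: the shear has the
   two-dimensional mode exp(i al x) psi(y/2), al = sgn(beta)/2, with real growth
   rate al beta gamma > 0.  Modulating it by slowly varying cutoffs in x and z of
   width 1/e, with correctors making both divergence constraints exact, yields
   fields V with |(L - lambda) V| = O(e) pointwise on the region where V lives,
   so that |(L - lambda) V| / |V| = O(e) in L^2. *)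
From HB Require Import structures.
Require Import Defs.
From mathcomp Require Import all_boot all_order all_algebra.
From mathcomp Require Import complex.
From mathcomp Require Import all_classical all_reals all_analysis.
From mathcomp Require Import measurable_realfun.
From mathcomp Require Import ring lra.

Set Implicit Arguments.
Unset Strict Implicit.
Unset Printing Implicit Defensive.

Import Order.TTheory GRing.Theory Num.Theory.
Import numFieldNormedType.Exports.

Local Open Scope classical_set_scope.
Local Open Scope ring_scope.

(** The modulus of the mode is constant in x and z, so it is not in L^2 and only the approximate
    point spectrum is reached. A truncated mode must still lie in the domain: the graph of the
    operator asks that V and its image be exactly divergence-free, with a pressure in L^2. The
    nonlocal projection is never estimated; the pressure is written down explicitly and the stream
    function is corrected until the Poisson equation for this pressure holds identically. The
    obstacle is that solving for the correctors means dividing by U', which vanishes where D' does,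
    so the corrector of the pressure has to be chosen for the quotients to stay regular. The cutoff
    is 1 / (1 + t^2) rather than a compactly supported bump because each of its derivatives is at
    most a constant times the cutoff itself: the errors are O(e) times the envelope of the packet.
    The same function dominates the potential D'' / D, and its primitive [atan] makes the Volterra
    estimates for the Jost solutions explicit and uniform in gamma down to the neutral limit, which
    is what allows the intermediate value theorem in gamma. *)

Section Calculus.
Variable R : realType.
Implicit Types (f df : R -> R) (a b t : R).

Lemma is_derive_continuous f df : (forall t, is_derive t (1 : R) f (df t)) -> continuous f.
Proof.
move=> H t; apply: differentiable_continuous; apply/derivable1_diffP.
exact: ex_derive.
Qed.

Lemma is_derive_le f df a b : a <= b -> (forall t, is_derive t (1 : R) f (df t)) ->
  (forall t, a < t < b -> 0 <= df t) -> f a <= f b.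
Proof.
rewrite le_eqVlt => /predU1P[->//|ab] H H0.
have [c /[!in_itv]/= cab e] := MVT ab (fun x _ => H x)
  (continuous_subspaceT (is_derive_continuous H)).
by rewrite -subr_ge0 e mulr_ge0 ?H0// subr_ge0 ltW.
Qed.

Lemma is_derive_lt f df a b : a < b -> (forall t, is_derive t (1 : R) f (df t)) ->
  (forall t, a < t < b -> 0 < df t) -> f a < f b.
Proof.
move=> ab H H0.
have [c /[!in_itv]/= cab e] := MVT ab (fun x _ => H x)
  (continuous_subspaceT (is_derive_continuous H)).
by rewrite -subr_gt0 e mulr_gt0 ?H0// subr_gt0.
Qed.

Notation mu := (@lebesgue_measure R).

Lemma continuous_itv_integrable f a b : continuous f -> mu.-integrable `[a, b] (EFin \o f).
Proof.
move=> fc; apply: continuous_compact_integrable; first exact: segment_compact.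
exact: continuous_subspaceT.
Qed.

Lemma is_derive_integral_itvcc f a t : continuous f -> a < t ->
  is_derive t (1 : R) (fun x => \int[mu]_(u in `[a, x]) f u) (f t).
Proof.
move=> fc at_; have [|d1 d2] := continuous_FTC1_closed (ltr_pwDr ltr01 (lexx t))
  (continuous_itv_integrable _ _ fc) at_.
  exact: fc.
by apply: DeriveDef; [exact: d1|rewrite -derive1E; exact: d2].
Qed.

Definition signed_integral f t :=
  if 0 <= t then \int[mu]_(u in `[0, t]) f u else - \int[mu]_(u in `[t, 0]) f u.

(** Near [t] both branches of the definition equal one difference of integrals started at a point
    left of [t] and of 0, so the fundamental theorem applies across the change of sign. *)
Lemma is_derive_signed_integral f t : continuous f ->
  is_derive t (1 : R) (signed_integral f) (f t).
Proof.
move=> fc; set N := `|t| + 1.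
have Nt : - N < t by rewrite /N ltrNl; have := ler_norm (- t); rewrite normrN; lra.
have tN : t < N by rewrite /N; have := ler_norm t; lra.
have N0 : 0 < N by rewrite ltr_wpDl.
have ic a b : mu.-integrable `[a, b] (EFin \o f) by exact: continuous_itv_integrable.
apply: (near_eq_is_derive (f := fun x => \int[mu]_(u in `[- N, x]) f u - \int[mu]_(u in `[- N, 0]) f u)).
  near=> x.
  have xN : - N < x by near: x; exact: lt_nbhsr.
  rewrite /signed_integral; case: ifPn => x0.
    rewrite (Rintegral_itvB (ic _ _)) ?bnd_simp//; last lra.
    rewrite Rintegral_itv_obnd_cbnd//.
    by apply: integrableS (ic 0 x) => //; apply: subset_itvr; rewrite bnd_simp.
  rewrite -ltNge in x0.
  rewrite -opprB (Rintegral_itvB (ic _ _)) ?bnd_simp//; [|lra|lra].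
  rewrite Rintegral_itv_obnd_cbnd//.
  by apply: integrableS (ic x 0) => //; apply: subset_itvr; rewrite bnd_simp.
have := is_derive_integral_itvcc fc Nt => H.
by apply: is_derive_eq; rewrite subr0.
Unshelve. all: by end_near. Qed.

End Calculus.

(** * The Dawson function *)

Section Dawson.
Variable R : realType.
Implicit Types (a b t : R) (f g : R -> R).

Definition dawson t : R := Num.sqrt pi / 2 * expR (- t ^+ 2) * erfi t.

Lemma dawsonE t : dawson t = expR (- t ^+ 2) * signed_integral (fun u => expR (u ^+ 2)) t.
Proof.
rewrite /dawson /erfi /signed_integral; set I := if _ then _ else _.
have p0 : Num.sqrt (pi : R) != 0 by rewrite gt_eqF// sqrtr_gt0 pi_gt0.
by field.
Qed.

Lemma dawson0 : dawson 0 = 0.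
Proof.
by rewrite dawsonE /signed_integral lexx set_itv1 Rintegral_set1 mulr0.
Qed.

Lemma is_derive_dawson t : is_derive t (1 : R) dawson (1 - 2 * t * dawson t).
Proof.
have -> : dawson = fun t => expR (- t ^+ 2) * signed_integral (fun u => expR (u ^+ 2)) t.
  by apply/funext => u; exact: dawsonE.
have c : continuous (fun u : R => expR (u ^+ 2)).
  by apply: (@is_derive_continuous _ _ (fun u => expR (u ^+ 2) * (2 * u))) => u;
     apply: is_derive_eq; rewrite /GRing.scale /=; ring.
have H := is_derive_signed_integral t c.
apply: is_derive_eq.
have := expRxMexpNx_1 (t ^+ 2).
rewrite /GRing.scale /= => e1; ring: e1.
Qed.

Lemma dawson_continuous : continuous dawson.
Proof. exact: is_derive_continuous is_derive_dawson. Qed.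

(** With the integrating factor e^(t^2), the equation D' = 1 - 2 t D turns the residual of any
    candidate [g] into a derivative. The oddness of D and the comparison lemmas all come down to the
    sign of this derivative. *)
Lemma is_derive_expsq_dawsonB g d t : is_derive t (1 : R) g d ->
  is_derive t (1 : R) (fun t => expR (t ^+ 2) * (dawson t - g t))
    (expR (t ^+ 2) * (1 - (2 * t * g t + d))).
Proof.
move=> H; have H2 := is_derive_dawson t; apply: is_derive_eq.
rewrite /GRing.scale /=; ring.
Qed.

Lemma dawsonN t : dawson (- t) = - dawson t.
Proof.
(* The function - D(- u) satisfies the same linear equation as D, with the same value at 0. *)
have Hg (u : R) : is_derive u (1 : R) (fun u : R => - dawson (- u)) (1 - 2 * u * (- dawson (- u))).
  have H := is_derive_dawson (- u).
  have H' : is_derive u (1 : R) (dawson \o -%R) ((1 - 2 * - u * dawson (- u)) * -1).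
    exact: is_derive1_comp.
  apply: is_derive_eq; ring.
have H (u : R) : is_derive u (1 : R) (fun t => expR (t ^+ 2) * (dawson t - - dawson (- t))) 0.
  have K := is_derive_expsq_dawsonB (Hg u); apply: (is_derive_eq K); ring.
have := is_derive_0_is_cst t 0 H.
rewrite oppr0 dawson0 oppr0 subr0 mulr0 => /eqP.
by rewrite mulf_eq0 expR_eq0/= opprK addrC addr_eq0 => /eqP.
Qed.

Lemma is_derive_le_in f (df : R -> R) a b : a <= b ->
  (forall t : R, a <= t <= b -> is_derive t (1 : R) f (df t)) ->
  (forall t, a < t < b -> 0 <= df t) -> f a <= f b.
Proof.
rewrite le_eqVlt => /predU1P[->//|ab] H H0.
have [||c /[!in_itv]/= cab e] := @MVT _ f df _ _ ab.
- by move=> x /[!in_itv]/= /andP[ax xb]; apply: H; rewrite !ltW.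
- apply: derivable_within_continuous => x /[!in_itv]/= ax.
  by case: (H x ax).
by rewrite -subr_ge0 e mulr_ge0 ?H0// subr_ge0 ltW.
Qed.

(* [g] below is a lower (resp. upper) solution of D' = 1 - 2 t D. *)
Lemma le_dawson g (dg : R -> R) a t : a <= t ->
  (forall u : R, a <= u -> is_derive u (1 : R) g (dg u)) ->
  (forall u, a <= u -> 2 * u * g u + dg u <= 1) -> g a <= dawson a -> g t <= dawson t.
Proof.
move=> at_ Hg H ga.
have K (u : R) : a <= u <= t -> _ := fun au => is_derive_expsq_dawsonB (Hg u (proj1 (andP au))).
have E u : 0 < expR (u ^+ 2) :> R by exact: expR_gt0.
rewrite -(subr_ge0 (g t)) -(pmulr_rge0 _ (E t)).
apply: le_trans (is_derive_le_in at_ K _).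
  by rewrite mulr_ge0 ?(ltW (E _))// subr_ge0.
by move=> u /andP[au _]; rewrite mulr_ge0 ?(ltW (E _))// subr_ge0 H// ltW.
Qed.

Lemma ge_dawson g (dg : R -> R) a t : a <= t ->
  (forall u : R, a <= u -> is_derive u (1 : R) g (dg u)) ->
  (forall u, a <= u -> 1 <= 2 * u * g u + dg u) -> dawson a <= g a -> dawson t <= g t.
Proof.
move=> at_ Hg H ga.
have K (u : R) : a <= u <= t -> is_derive u (1 : R) (fun t => - (expR (t ^+ 2) * (dawson t - g t))) _ :=
  fun au => is_deriveN (is_derive_expsq_dawsonB (Hg u (proj1 (andP au)))).
have E u : 0 < expR (u ^+ 2) :> R by exact: expR_gt0.
rewrite -(subr_ge0 (dawson t)) -(pmulr_rge0 _ (E t)) -(opprB (dawson t)) mulrN.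
apply: le_trans (is_derive_le_in at_ K _).
  by rewrite -mulrN opprB mulr_ge0 ?(ltW (E _))// subr_ge0.
move=> u /andP[au _].
by rewrite -mulrN opprB mulr_ge0 ?(ltW (E _))// subr_ge0 H// ltW.
Qed.

Lemma dawson_le_id t : 0 <= t -> dawson t <= t.
Proof.
move=> t0; apply: (@ge_dawson id (cst 1) 0) => //.
  by move=> u u0; rewrite lerDr -mulrA mulr_ge0// mulr_ge0.
by rewrite dawson0.
Qed.

Lemma is_derive_div f g (df dg : R) t : g t != 0 -> is_derive t (1 : R) f df ->
  is_derive t (1 : R) g dg ->
  is_derive t (1 : R) (fun t => f t / g t) ((df * g t - f t * dg) / g t ^+ 2).
Proof.
move=> g0 Hf Hg; apply: (is_derive_eq (is_deriveM Hf (is_deriveV g0 Hg))).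
by rewrite /GRing.scale /=; field.
Qed.

(* A convergent of the continued fraction of D. *)
Lemma dawson_ge_convergent t : 0 <= t ->
  t * (3 + 2 * t ^+ 2) / (3 + 4 * t ^+ 2 + 4 * t ^+ 4) <= dawson t.
Proof.
pose M (u : R) := 3 + 4 * u ^+ 2 + 4 * u ^+ 4.
pose N (u : R) := u * (3 + 2 * u ^+ 2).
have M0 (u : R) : M u != 0 by rewrite gt_eqF// /M; nra.
have HM (u : R) : is_derive u (1 : R) M (8 * u + 16 * u ^+ 3).
  by apply: is_derive_eq; rewrite /GRing.scale /=; ring.
have HN (u : R) : is_derive u (1 : R) N (3 + 6 * u ^+ 2).
  by apply: is_derive_eq; rewrite /GRing.scale /=; ring.
move=> t0; apply: (le_dawson t0 (fun u _ => is_derive_div (M0 u) (HN u) (HM u))).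
- move=> u u0; rewrite -subr_ge0.
  have -> : 1 - (2 * u * (N u / M u) +
      ((3 + 6 * u ^+ 2) * M u - N u * (8 * u + 16 * u ^+ 3)) / M u ^+ 2) =
      32 * u ^+ 4 / M u ^+ 2.
    by have := M0 u; rewrite /M /N => m0; field.
  by rewrite mulr_ge0 ?invr_ge0 ?sqr_ge0// mulr_ge0// exprn_even_ge0.
- by rewrite dawson0 /N !mul0r.
Qed.

Lemma dawson_le_inv t : 1 <= t -> dawson t <= t^-1.
Proof.
move=> t1; apply: (ge_dawson (g := fun t => t^-1) t1).
- by move=> u u1; apply: is_deriveV; rewrite gt_eqF//; lra.
- move=> u u1; have u0 : u != 0 by rewrite gt_eqF//; lra.
  rewrite /GRing.scale /= mulr1 -mulrA divff// mulr1.
  suff : u ^- 2 <= 1 by lra.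
  by rewrite invf_le1 ?exprn_gt0//; [nra|lra].
- by rewrite invr1; exact: dawson_le_id.
Qed.

(** The first two terms are those of the expansion D ~ 1/(2t) + 1/(4t^3) + 3/(8t^5). The third
    coefficient is raised to 10, which makes the right-hand side an upper solution from 2 on and
    puts it above the crude bound 1/2 at the starting point. *)
Lemma dawson_le_asymptotic t : 2 <= t ->
  dawson t <= (t^-1 + t^-1 ^+ 3 / 2 + 20 * t^-1 ^+ 5) / 2.
Proof.
move=> t2; apply: (ge_dawson (g := fun t => (t^-1 + t^-1 ^+ 3 / 2 + 20 * t^-1 ^+ 5) / 2) t2).
- move=> u u2; have u0 : u != 0 by rewrite gt_eqF//; lra.
  have K := is_deriveV u0 (is_derive_id u 1).
  by apply: is_derive_eq.
- move=> u u2; have u0 : u != 0 by rewrite gt_eqF//; lra.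
  rewrite -subr_ge0.
  suff : 0 <= u^-1 ^+ 6 * (77 / 4 * u ^+ 2 - 50).
    by congr (0 <= _); rewrite /GRing.scale /=; field.
  by rewrite mulr_ge0 ?exprn_ge0 ?invr_ge0//; nra.
- have := @dawson_le_inv 2; lra.
Qed.

Definition om t : R := (1 + t ^+ 2)^-1.

Lemma om_gt0 t : 0 < om t.
Proof. by rewrite invr_gt0; nra. Qed.

Lemma om_le1 t : om t <= 1.
Proof. by rewrite invf_le1; nra. Qed.

Lemma omN t : om (- t) = om t. Proof. by rewrite /om sqrrN. Qed.

Lemma is_derive_om t : is_derive t (1 : R) om (- (2 * t * om t ^+ 2)).
Proof.
have n0 : 1 + t ^+ 2 != 0 by rewrite gt_eqF//; nra.
have H : is_derive t (1 : R) (fun t => 1 + t ^+ 2) (2 * t).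
  by apply: is_derive_eq; rewrite /GRing.scale /=; ring.
apply: (is_derive_eq (is_deriveV (f := fun t => 1 + t ^+ 2) n0 H)); rewrite /om /GRing.scale /=; field; exact: n0.
Qed.

Lemma om_continuous : continuous om.
Proof. exact: is_derive_continuous is_derive_om. Qed.

(* The continuous extension of t / D(t), and of D'' / D. *)
Definition dratio t : R := if t == 0 then 1 else t / dawson t.

Definition qz t : R := 4 * t ^+ 2 - 2 - 2 * dratio t.

Lemma dawson_gt0 t : 0 < t -> 0 < dawson t.
Proof.
move=> t0; apply: lt_le_trans (dawson_ge_convergent (ltW t0)).
by rewrite divr_gt0// ?mulr_gt0//; nra.
Qed.

Lemma dawson_neq0 t : t != 0 -> dawson t != 0.
Proof.
move=> t0; have [tgt|tlt|/eqP] := ltgtP 0 t; last by rewrite eq_sym (negbTE t0).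
  by rewrite gt_eqF// dawson_gt0.
by rewrite -oppr_eq0 -dawsonN gt_eqF// dawson_gt0 ?oppr_gt0.
Qed.

Lemma dratioM t : dratio t * dawson t = t.
Proof.
rewrite /dratio; case: eqP => [->|/eqP t0]; first by rewrite dawson0 mulr0.
by rewrite divfK// dawson_neq0.
Qed.

Lemma dratioN t : dratio (- t) = dratio t.
Proof. by rewrite /dratio oppr_eq0 dawsonN invrN mulrNN. Qed.

Lemma dratio_ge1 t : 1 <= dratio t.
Proof.
wlog t0 : t / 0 <= t => [H|].
  by have [/H//|t0] := leP 0 t; rewrite -dratioN H// oppr_ge0 ltW.
rewrite /dratio; case: eqP => // /eqP tn0.
have tp : 0 < t by rewrite lt_def tn0.
by rewrite ler_pdivlMr ?dawson_gt0// mul1r dawson_le_id.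
Qed.

Lemma dratio_le t : dratio t <= (3 + 4 * t ^+ 2 + 4 * t ^+ 4) / (3 + 2 * t ^+ 2).
Proof.
wlog t0 : t / 0 <= t => [H|].
  have [/H//|t0] := leP 0 t; rewrite -dratioN.
  have -> : t ^+ 2 = (- t) ^+ 2 by rewrite sqrrN.
  have -> : t ^+ 4 = (- t) ^+ 4 by ring.
  by rewrite H// oppr_ge0 ltW.
rewrite /dratio; case: eqP => [->|/eqP tn0].
  by rewrite !expr0n/= !mulr0 !addr0 divff// pnatr_eq0.
have tp : 0 < t by rewrite lt_def tn0.
rewrite ler_pdivrMr ?dawson_gt0// mulrC -ler_pdivrMr; last by rewrite divr_gt0//; nra.
apply: le_trans (dawson_ge_convergent t0).
by rewrite le_eqVlt; apply/orP; left; apply/eqP; field; apply/andP; split; rewrite gt_eqF//; nra.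
Qed.

Lemma dratio_continuous : continuous dratio.
Proof.
move=> t; have [->|t0] := eqVneq t 0.
  have d0 : dratio 0 = 1 by rewrite /dratio eqxx.
  rewrite /continuous_at d0.
  apply: (@squeeze_cvgr _ _ _ _ (cst 1) (fun t : R => 1 + 2 * t ^+ 2)).
  - near=> u; rewrite /cst dratio_ge1/=; apply: le_trans (dratio_le u) _.
    by rewrite ler_pdivrMr; nra.
  - exact: cvg_cst.
  - have : (1 + 2 * t ^+ 2 : R) @[t --> (0 : R)] --> (1 + 2 * 0 ^+ 2 : R).
      apply: cvgD; first exact: cvg_cst.
      by apply: cvgM; [exact: cvg_cst|exact: exprn_continuous].
    by rewrite expr0n/= mulr0 addr0.
rewrite /continuous_at; have -> : dratio t = t / dawson t by rewrite /dratio (negbTE t0).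
have K : (u / dawson u : R) @[u --> t] --> (t / dawson t : R).
  apply: cvgM; first exact: cvg_id.
  by apply: cvgV; [exact: dawson_neq0|exact: dawson_continuous].
apply: cvg_trans K; apply: near_eq_cvg; near=> u.
have u0 : u != 0 by near: u; apply: (cvgr_neq0 t) => //; exact: cvg_id.
by rewrite /dratio (negbTE u0).
Unshelve. all: by end_near. Qed.

Lemma qz_continuous : continuous qz.
Proof.
move=> t; apply: cvgB; last by apply: cvgM; [exact: cvg_cst|exact: dratio_continuous].
apply: cvgB; last exact: cvg_cst.
by apply: cvgM; [exact: cvg_cst|exact: exprn_continuous].
Qed.

Lemma qzN t : qz (- t) = qz t.
Proof. by rewrite /qz sqrrN dratioN. Qed.

(** An integrable potential is what yields a solution asymptotic to e^s. Since t / D(t) = 2 t^2 - 1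
    + O(t^-2), the growing parts of [qz] cancel at infinity. The convergent of D gives the lower
    bound, [dawson_le_asymptotic] the upper bound beyond 2; the factor 100 is generous. *)
Lemma qz_bound t : `|qz t| <= 100 * om t.
Proof.
wlog t0 : t / 0 <= t => [H|].
  by have [/H//|t0] := leP 0 t; rewrite -qzN -omN H// oppr_ge0 ltW.
have p1 : 0 < 1 + t ^+ 2 by nra.
have p3 : 0 < 3 + 2 * t ^+ 2 by nra.
rewrite ler_norml; apply/andP; split.
  rewrite /qz -subr_ge0.
  have := dratio_le t; set r := dratio t => rle.
  have -> : 4 * t ^+ 2 - 2 - 2 * r - - (100 * om t) =
    2 * ((3 + 4 * t ^+ 2 + 4 * t ^+ 4) / (3 + 2 * t ^+ 2) - r) +
    (288 + 188 * t ^+ 2) / ((1 + t ^+ 2) * (3 + 2 * t ^+ 2)).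
    by rewrite /om; field; apply/andP; split; rewrite gt_eqF.
  have t22 : 0 <= t ^+ 2 by exact: sqr_ge0.
  apply: addr_ge0; first by apply: mulr_ge0 => //; rewrite subr_ge0.
  by apply: divr_ge0; [lra|exact: mulr_ge0 (ltW p1) (ltW p3)].
have [t2|t2] := leP t 2.
  have r1 := dratio_ge1 t.
  apply: (@le_trans _ _ 12); first by rewrite /qz; nra.
  by rewrite /om ler_pdivlMr//; nra.
rewrite /qz.
have t2' := ltW t2.
have tn0 : t != 0 by rewrite gt_eqF//; lra.
have := dratioM t; set r := dratio t => rE.
have dle := dawson_le_asymptotic t2'.
have r1 : 1 <= r := dratio_ge1 t.
have tle : t <= r * ((t^-1 + t^-1 ^+ 3 / 2 + 20 * t^-1 ^+ 5) / 2).
  by rewrite -[leLHS]rE ler_wpM2l//; lra.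
set x := t^-1 ^+ 2 / 2 + 20 * t^-1 ^+ 4.
have i0 : 0 < t^-1 by rewrite invr_gt0; lra.
have x0 : 0 < x by rewrite addr_gt0// mulr_gt0// exprn_gt0.
have tle' : 2 * t ^+ 2 <= r * (1 + x).
  have -> : r * (1 + x) = 2 * t * (r * ((t^-1 + t^-1 ^+ 3 / 2 + 20 * t^-1 ^+ 5) / 2)).
    by rewrite /x; field.
  by rewrite expr2 mulrA ler_wpM2l//; lra.
(* Instead of dividing by 1 + x, one multiplies by 1 - x, as (1 + x)(1 - x) <= 1. If 1 - x is
   negative, so is the left-hand side. *)
have rge : 2 * t ^+ 2 - 1 - 40 * t^-1 ^+ 2 <= r.
  have -> : 2 * t ^+ 2 - 1 - 40 * t^-1 ^+ 2 = 2 * t ^+ 2 * (1 - x).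
    by rewrite /x; field.
  have [x1|x1] := leP 0 (1 - x).
    apply: (@le_trans _ _ (r * (1 + x) * (1 - x))); first by rewrite ler_wpM2r.
    by rewrite -mulrA; have := sqr_ge0 x; nra.
  by apply: le_trans (le_trans ler01 r1); rewrite mulr_ge0_le0 ?(ltW x1)//; nra.
apply: (@le_trans _ _ (80 * t^-1 ^+ 2)); first by lra.
have tt : 0 < t ^+ 2 by rewrite exprn_gt0//; lra.
by rewrite exprVn /om ler_pdivlMr// mulrAC ler_pdivrMr//; nra.
Qed.
End Dawson.

(** * The Jost solution of the Rayleigh equation *)

Section LeftIntegral.
Variable R : realType.
Implicit Types (f g F : R -> R) (s t c : R).
Notation mu := (@lebesgue_measure R).

Definition left_integral f t := \int[mu]_(s in `]-oo, t]) f s.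
Local Notation J := left_integral.

Definition left_bounded g := forall t, exists c, forall s, s <= t -> `|g s| <= c.

(** The constant may depend on [t], so that the class is preserved by multiplication with e^(2s),
    which is bounded on left half-lines only. *)
Definition left_dom f := continuous f /\
  forall t, exists c, forall s, s <= t -> `|f s| <= c * om s.

(** The reflection s -> - s reduces this to the improper fundamental theorem on a right
    half-line. *)
Lemma integral_left_derive f F t l : (forall s, 0 <= f s) -> continuous f ->
  (forall s, is_derive s (1 : R) F (f s)) -> F s @[s --> -oo] --> l ->
  (\int[mu]_(s in `]-oo, t]) (f s)%:E = (F t - l)%:E)%E.
Proof.
move=> f0 cf HF Fl.
rewrite -(opprK t) ge0_integration_by_substitutionNy//; last exact: continuous_subspaceT.
have HG (s : R) : is_derive s (1 : R) (fun s => - F (- s)) (f (- s)).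
  have H := HF (- s).
  have H' : is_derive s (1 : R) (F \o -%R) (f (- s) * -1) by exact: is_derive1_comp.
  by apply: is_derive_eq; rewrite mulrN1 opprK.
rewrite (@ge0_continuous_FTC2y _ (f \o -%R) (fun s => - F (- s)) _ (- l)).
- by rewrite -EFinB !opprK addrC.
- by move=> x _; exact: f0.
- by apply: continuous_subspaceT => x; apply: continuous_comp; [exact: opp_continuous|exact: cf].
- by apply: cvgN; move/cvgNy_compNP : Fl.
- by move=> x _; case: (HG x).
- by apply: cvg_at_right_filter; exact: (is_derive_continuous HG).
- by move=> x _; rewrite derive1E; case: (HG x).
Qed.

Lemma is_derive_atan_om t : is_derive t (1 : R) atan (om t).
Proof. exact: is_derive1_atan. Qed.

Lemma cvgNy_atan : atan s @[s --> -oo] --> - (pi / 2 : R).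
Proof.
apply/cvgNy_compNP; rewrite (_ : atan \o -%R = fun s : R => - atan s).
  by apply: cvgN; exact: cvgy_atan.
by apply/funext => s /=; rewrite atanN.
Qed.

Lemma atan_bounds t : - (pi / 2) < atan t < pi / 2.
Proof. by rewrite atan_gtNpi2 atan_ltpi2. Qed.

Lemma integral_left_om t : (\int[mu]_(s in `]-oo, t]) (om s)%:E = (atan t + pi / 2)%:E)%E.
Proof.
rewrite (integral_left_derive _ _ _ is_derive_atan_om cvgNy_atan) ?opprK//.
- by move=> s; exact/ltW/om_gt0.
- exact: om_continuous.
Qed.

Lemma integralT_om : (\int[mu]_s (om s)%:E = pi%:E)%E.
Proof.
rewrite ge0_symfun_integralT.
- rewrite -(_ : `[0, +oo[%classic = [set x : R | 0 <= x]); last first.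
    by apply/seteqP; split => x /=; rewrite in_itv/= andbT.
  rewrite (@ge0_continuous_FTC2y _ (@om R) atan 0 (pi / 2)).
  + by rewrite atan0 -EFinB subr0 -EFinM mulrCA divff ?mulr1// pnatr_eq0.
  + by move=> x _; exact/ltW/om_gt0.
  + exact: continuous_subspaceT (@om_continuous R).
  + exact: cvgy_atan.
  + by move=> x _; case: (is_derive_atan_om x).
  + by apply: cvg_at_right_filter; exact: (is_derive_continuous is_derive_atan_om).
  + by move=> x _; rewrite derive1E; case: (is_derive_atan_om x).
- by move=> s; exact/ltW/om_gt0.
- exact: om_continuous.
- by move=> s /=; rewrite omN.
Qed.

Lemma integrable_om : mu.-integrable setT (EFin \o @om R).
Proof.
apply/integrableP; split.
  by apply/measurable_EFinP; exact: continuous_measurable_fun (@om_continuous R).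
under eq_integral do rewrite /= ger0_norm ?(ltW (om_gt0 _))//.
by rewrite integralT_om ltry.
Qed.

Lemma left_dom_integrable f t : left_dom f -> mu.-integrable `]-oo, t] (EFin \o f).
Proof.
move=> [cf /(_ t)[c Hc]].
have ig : mu.-integrable `]-oo, t] (EFin \o (fun s => c * om s)).
  apply: integrableS measurableT _ _ _ => //.
  rewrite (_ : EFin \o _ = (fun s => c%:E * (EFin \o @om R) s)%E); last first.
    by apply/funext => s /=; rewrite EFinM.
  by apply: integrableZl => //; exact: integrable_om.
apply: le_integrable ig => //.
- apply/measurable_EFinP; apply: measurable_funS measurableT _ _ => //.
  exact: continuous_measurable_fun.
- move=> s /=; rewrite in_itv/= => st; rewrite lee_fin.
  by apply: le_trans (Hc _ st) _; exact: ler_norm.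
Qed.

Lemma left_domP f t : left_dom f -> is_derive t (1 : R) (J f) (f t).
Proof.
move=> df; have tt : t < t + 1 by rewrite ltrDl.
have [||d1 d2] := continuous_FTC1 tt (a := -oo%O) (left_dom_integrable _ df).
- by rewrite ltNyr.
- exact: df.1.
by apply: DeriveDef; [exact: d1|rewrite -derive1E; exact: d2].
Qed.

Lemma left_integral_le f g t : left_dom f -> left_dom g ->
  (forall s, s <= t -> f s <= g s) -> J f t <= J g t.
Proof.
by move=> df dg fg; apply: le_Rintegral => //; exact: left_dom_integrable.
Qed.

Lemma left_integralD f g t : left_dom f -> left_dom g ->
  J (fun s => f s + g s) t = J f t + J g t.
Proof. by move=> df dg; apply: RintegralD => //; exact: left_dom_integrable. Qed.

Lemma left_integralB f g t : left_dom f -> left_dom g ->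
  J (fun s => f s - g s) t = J f t - J g t.
Proof. by move=> df dg; apply: RintegralB => //; exact: left_dom_integrable. Qed.

Lemma left_integralZ c f t : left_dom f -> J (fun s => c * f s) t = c * J f t.
Proof. by move=> df; apply: RintegralZl => //; exact: left_dom_integrable. Qed.

Lemma left_integral_norm f t : left_dom f -> `|J f t| <= J (fun s => `|f s|) t.
Proof. by move=> df; apply: le_normr_Rintegral => //; exact: left_dom_integrable. Qed.

Lemma left_domD f g : left_dom f -> left_dom g -> left_dom (fun s => f s + g s).
Proof.
move=> [cf bf] [cg bg]; split; first by move=> s; apply: cvgD; [exact: cf|exact: cg].
move=> t; have [c Hc] := bf t; have [d Hd] := bg t; exists (c + d) => s st.
by rewrite mulrDl (le_trans (ler_normD _ _))// lerD ?Hc ?Hd.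
Qed.

Lemma left_domM f g : continuous g -> left_bounded g -> left_dom f ->
  left_dom (fun s => g s * f s).
Proof.
move=> cg bg [cf bf]; split; first by move=> s; apply: cvgM; [exact: cg|exact: cf].
move=> t; have [c Hc] := bf t; have [d Hd] := bg t; exists (d * c) => s st.
by rewrite normrM -mulrA ler_pM ?Hc ?Hd.
Qed.

Lemma left_domZ c f : left_dom f -> left_dom (fun s => c * f s).
Proof. by apply: (@left_domM _ (cst c)) => [s|t]; [exact: cvg_cst|exists `|c|]. Qed.

Lemma left_domB f g : left_dom f -> left_dom g -> left_dom (fun s => f s - g s).
Proof.
move=> df dg; have := left_domD df (left_domZ (-1) dg).
by congr left_dom; apply/funext => s; rewrite mulN1r.
Qed.

Lemma left_dom_norm f : left_dom f -> left_dom (fun s => `|f s|).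
Proof.
move=> [cf bf]; split; first by move=> s; apply: cvg_norm; exact: cf.
by move=> t; have [c Hc] := bf t; exists c => s st; rewrite normr_id Hc.
Qed.

Lemma left_dom_om : left_dom (@om R).
Proof.
split; first exact: om_continuous.
by move=> t; exists 1 => s _; rewrite mul1r ger0_norm// (ltW (om_gt0 _)).
Qed.

Lemma expR_linear_continuous c : continuous (fun s : R => expR (c * s)).
Proof.
apply: (@is_derive_continuous _ _ (fun s => c * expR (c * s))) => s.
by apply: is_derive_eq; rewrite /GRing.scale /=; ring.
Qed.

Lemma expR_left_bounded : left_bounded (fun s => expR (2 * s)).
Proof.
move=> t; exists (expR (2 * t)) => s st.
by rewrite ger0_norm ?expR_ge0// ler_expR; lra.
Qed.

Lemma left_domE f : left_dom f -> left_dom (fun s => expR (2 * s) * f s).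
Proof. by apply: left_domM; [exact: expR_linear_continuous|exact: expR_left_bounded]. Qed.

(** Variation of constants from -oo for the equation y' + 2 y = f. *)
Definition left_resolvent f t := expR (- 2 * t) * J (fun s => expR (2 * s) * f s) t.
Local Notation J2 := left_resolvent.

Lemma left_resolventP f t : left_dom f -> is_derive t (1 : R) (J2 f) (f t - 2 * J2 f t).
Proof.
move=> df; have H := left_domP t (left_domE df).
apply: is_derive_eq; rewrite /GRing.scale /= /left_resolvent.
have := expRxMexpNx_1 (2 * t); rewrite -mulNr => e; ring: e.
Qed.

Lemma left_resolventD f g t : left_dom f -> left_dom g ->
  J2 (fun s => f s + g s) t = J2 f t + J2 g t.
Proof.
move=> df dg; rewrite /left_resolvent -mulrDr -left_integralD; [|exact: left_domE..].
by congr (_ * J _ _); apply/funext => s; rewrite mulrDr.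
Qed.

Lemma left_resolventB f g t : left_dom f -> left_dom g ->
  J2 (fun s => f s - g s) t = J2 f t - J2 g t.
Proof.
move=> df dg; rewrite /left_resolvent -mulrBr -left_integralB; [|exact: left_domE..].
by congr (_ * J _ _); apply/funext => s; rewrite mulrBr.
Qed.

(** The kernel e^(2(s - t)) is at most 1 for s <= t. *)
Lemma left_resolvent_norm f t : left_dom f -> `|J2 f t| <= J (fun s => `|f s|) t.
Proof.
move=> df; rewrite /left_resolvent.
rewrite normrM (ger0_norm (expR_ge0 _)).
have dE := left_domE df; have dn := left_dom_norm dE.
apply: (@le_trans _ _ (expR (- 2 * t) * J (fun s => `|expR (2 * s) * f s|) t)).
  by rewrite ler_wpM2l ?expR_ge0//; exact: left_integral_norm.
rewrite -left_integralZ//; apply: left_integral_le.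
- exact: left_domZ.
- exact: left_dom_norm.
- move=> s st; rewrite normrM (ger0_norm (expR_ge0 _)) mulrA -expRD.
  by rewrite ler_piMl// -[leRHS]expR0 ler_expR; lra.
Qed.

End LeftIntegral.

(** * Uniform limits of geometrically convergent sequences *)

Section UniformLimit.
Variable R : realType.

Lemma half_pow_small (K e : R) : 0 < e -> exists n, K / 2 ^+ n < e.
Proof.
move=> e0; have [K0|K0] := leP K 0.
  by exists 0%N; rewrite expr0 divr1 (le_lt_trans K0).
pose n := Num.truncn (K / e); exists n.+1.
have lt_pow k : k%:R <= 2 ^+ k :> R.
  elim: k => [|k IH]; first by rewrite ler01.
  have : 1 <= 2 ^+ k :> R by rewrite exprn_ege1// ler1n.
  rewrite exprS -natr1; lra.
rewrite ltr_pdivrMr ?exprn_gt0// mulrC -ltr_pdivrMr//.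
by apply: lt_le_trans (truncnS_gt _) (lt_pow _).
Qed.

Lemma le_half_pow (x y K : R) : (forall n, x <= y + K / 2 ^+ n) -> x <= y.
Proof.
move=> H; apply/ler_addgt0Pr => e e0; have [n /ltW Hn] := half_pow_small K e0.
by apply: le_trans (H n) _; rewrite lerD2l.
Qed.

(** Subtracting or adding the remaining tail 2 K / 2^n of the geometric series gives increasing
    lower and decreasing upper bounds; the supremum of the lower ones lies in all these nested
    intervals. *)
Lemma geometric_uniform_limit (f : nat -> R -> R) (K : R) :
  (forall n, continuous (f n)) ->
  (forall n t, `|f n.+1 t - f n t| <= K / 2 ^+ n) ->
  exists g : R -> R, continuous g /\ forall n t, `|g t - f n t| <= 2 * K / 2 ^+ n.
Proof.
move=> cf df.
have pow0 n : 0 < 2 ^+ n :> R by rewrite exprn_gt0.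
pose a t n := f n t - 2 * K / 2 ^+ n.
pose b t n := f n t + 2 * K / 2 ^+ n.
have pS n : K / 2 ^+ n = 2 * K / 2 ^+ n - 2 * K / 2 ^+ n.+1.
  by rewrite exprS; field; rewrite gt_eqF.
have K0 : 0 <= K.
  by have := le_trans (normr_ge0 _) (df 0%N 0); rewrite expr0 divr1.
have KK n : 0 <= 2 * K / 2 ^+ n by rewrite divr_ge0 ?mulr_ge0// ltW.
have incra t n m : (n <= m)%N -> a t n <= a t m.
  move=> /subnK <-; elim: (m - n)%N => // k; move/le_trans; apply.
  rewrite addSn /a; have := df (k + n)%N t; rewrite pS ler_norml => /andP[]; lra.
have decrb t n m : (n <= m)%N -> b t m <= b t n.
  move=> /subnK <-; elim: (m - n)%N => // k; apply: le_trans.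
  rewrite addSn /b; have := df (k + n)%N t; rewrite pS ler_norml => /andP[]; lra.
have ab t n m : a t n <= b t m.
  apply: le_trans (incra t _ _ (leq_maxl n m)) (le_trans _ (decrb t _ _ (leq_maxr n m))).
  by rewrite /a /b; have := KK (maxn n m); lra.
pose g t := sup (range (a t)).
have ubg t m : ubound (range (a t)) (b t m) by move=> _ [n _ <-]; exact: ab.
have ga t n : a t n <= g t.
  by apply: ub_le_sup; [exists (b t 0%N); exact: ubg|exists n].
have gb t n : g t <= b t n.
  by apply: ge_sup; [exists (a t 0%N); exists 0%N|exact: ubg].
have H n t : `|g t - f n t| <= 2 * K / 2 ^+ n.
  by rewrite ler_norml; have := ga t n; have := gb t n; rewrite /a /b => ? ?; apply/andP; split; lra.
exists g; split => // t; apply/cvgrPdist_le => e e0.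
have [n Hn] := half_pow_small (2 * K) (divr_gt0 e0 (ltr0Sn R 2)).
have /cvgrPdist_le /(_ _ (divr_gt0 e0 (ltr0Sn R 2))) := cf n t.
apply: filterS => u Hu.
rewrite (_ : g t - g u = (g t - f n t) + (f n t - f n u) - (g u - f n u)); last by ring.
rewrite (le_trans (ler_normB _ _))// (le_trans (lerD (ler_normD _ _) (lexx _)))//.
have := H n t; have := H n u; lra.
Qed.

End UniformLimit.

(** * The Volterra equation of the Jost solution: existence, asymptotics, stability *)

Section Volterra.
Variable R : realType.
Implicit Types (a b q r f g : R -> R) (s t c d : R).
Local Notation J := (@left_integral R).
Local Notation J2 := (@left_resolvent R).

(* Real part of (q + i r)(a + i b); the imaginary part is [cmul_re q (- r) b a]. *)
Definition cmul_re q r a b := fun s => q s * a s - r s * b s.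

Lemma cmul_re_norm q r a b t :
  `|cmul_re q r a b t| + `|cmul_re q (fun s => - r s) b a t| <=
  (`|q t| + `|r t|) * (`|a t| + `|b t|).
Proof.
rewrite mulrDl !mulrDr -!normrM /cmul_re mulNr opprK.
have := ler_normB (q t * a t) (r t * b t).
have := ler_normD (q t * b t) (r t * a t); lra.
Qed.

Lemma is_derive_addl f c d t : is_derive t (1 : R) f d ->
  is_derive t (1 : R) (fun t => c + f t) d.
Proof. by move=> Hf; apply: is_derive_eq; rewrite add0r mul1r. Qed.

Definition om_dominated q := continuous q /\ exists M, forall s, `|q s| <= M * om s.
Definition bounded_continuous a := continuous a /\ exists c, forall s, `|a s| <= c.

Lemma left_dom_cmul_re q r a b : om_dominated q -> om_dominated r ->
  bounded_continuous a -> bounded_continuous b -> left_dom (cmul_re q r a b).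
Proof.
have H p f : om_dominated p -> bounded_continuous f -> left_dom (fun s => p s * f s).
  move=> [cp [M HM]] [cc [d Hd]]; rewrite (_ : (fun _ => _) = fun s => f s * p s).
    by apply: left_domM => //; [move=> t; exists d|split=> // t; exists M].
  by apply/funext => s; rewrite mulrC.
by move=> *; apply: left_domB; exact: H.
Qed.

(* With psi = e^t w, Rayleigh's equation psi'' = (1 + q + i r) psi reads
   w'' + 2 w' = (q + i r) w, that is w = 1 + volterra w. *)
Definition volterra q r a b t := (J (cmul_re q r a b) t - J2 (cmul_re q r a b) t) / 2.

Lemma volterraB q r a b a' b' t : om_dominated q -> om_dominated r ->
  bounded_continuous a -> bounded_continuous b ->
  bounded_continuous a' -> bounded_continuous b' ->
  volterra q r a b t - volterra q r a' b' t =
  volterra q r (fun s => a s - a' s) (fun s => b s - b' s) t.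
Proof.
move=> Hq Hr Ha Hb Ha' Hb'; rewrite /volterra.
have -> : cmul_re q r (fun s => a s - a' s) (fun s => b s - b' s) =
          fun s => cmul_re q r a b s - cmul_re q r a' b' s.
  by apply/funext => s; rewrite /cmul_re; ring.
have D1 := left_dom_cmul_re Hq Hr Ha Hb.
have D2 := left_dom_cmul_re Hq Hr Ha' Hb'.
by rewrite (left_integralB t D1 D2) (left_resolventB t D1 D2); field.
Qed.

Lemma volterra_coefB q r q' r' a b t : om_dominated q -> om_dominated r ->
  om_dominated q' -> om_dominated r' ->
  bounded_continuous a -> bounded_continuous b ->
  volterra q r a b t - volterra q' r' a b t =
  volterra (fun s => q s - q' s) (fun s => r s - r' s) a b t.
Proof.
move=> Hq Hr Hq' Hr' Ha Hb; rewrite /volterra.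
have -> : cmul_re (fun s => q s - q' s) (fun s => r s - r' s) a b =
          fun s => cmul_re q r a b s - cmul_re q' r' a b s.
  by apply/funext => s; rewrite /cmul_re; ring.
have D1 := left_dom_cmul_re Hq Hr Ha Hb.
have D2 := left_dom_cmul_re Hq' Hr' Ha Hb.
by rewrite (left_integralB t D1 D2) (left_resolventB t D1 D2); field.
Qed.

Lemma volterra_norm q r a b t : left_dom (cmul_re q r a b) ->
  `|volterra q r a b t| <= J (fun s => `|cmul_re q r a b s|) t.
Proof.
move=> H; rewrite /volterra normrM (ger0_norm (_ : 0 <= 2^-1)) ?invr_ge0//.
have := left_integral_norm t H; have := left_resolvent_norm t H.
have := ler_normB (J (cmul_re q r a b) t) (J2 (cmul_re q r a b) t); lra.
Qed.

(** As y = [J2] F satisfies y' = F - 2 y, the combination ([J] F - y) / 2 is a primitive of y; a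
    double integral is thus avoided. *)
Lemma is_derive_volterra q r a b t : left_dom (cmul_re q r a b) ->
  is_derive t (1 : R) (volterra q r a b) (J2 (cmul_re q r a b) t).
Proof.
move=> H; have H1 := left_domP t H; have H2 := left_resolventP t H.
by apply: is_derive_eq; rewrite /GRing.scale /=; field.
Qed.

Variable M : R.
Hypothesis M_gt0 : 0 < M.

(** Unlike in [om_dominated], the constant is fixed, so that the estimates below are uniform in the
    coefficients and hence in gamma. *)
Definition om_bounded q := continuous q /\ forall s, `|q s| <= M * om s.

Lemma om_bounded_dominated q : om_bounded q -> om_dominated q.
Proof. by case=> cq bq; split => //; exists M. Qed.

Lemma om_boundedN q : om_bounded q -> om_bounded (fun s => - q s).
Proof.
case=> cq bq; split; first by move=> s; apply: cvgN; exact: cq.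
by move=> s; rewrite normrN.
Qed.

Local Notation K := (expR (4 * M * pi) : R).

(* The weight making the Volterra operator a contraction. *)
Definition weight t : R := expR (4 * M * (atan t + pi / 2)).

Lemma weight_ge1 t : 1 <= weight t.
Proof.
rewrite /weight -[leLHS]expR0 ler_expR; apply: mulr_ge0; first by rewrite mulr_ge0// ltW.
by have /andP[] := atan_bounds t; lra.
Qed.

Lemma weight_le t : weight t <= K.
Proof.
rewrite ler_expR; apply: ler_wpM2l; first by rewrite mulr_ge0// ltW.
by have /andP[] := atan_bounds t; lra.
Qed.

Lemma is_derive_weight t : is_derive t (1 : R) weight (4 * M * (weight t * om t)).
Proof.
have H := is_derive_atan_om t.
by apply: is_derive_eq; rewrite /GRing.scale /= /weight addr0; ring.
Qed.

Lemma weight_continuous : continuous weight.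
Proof. exact: is_derive_continuous is_derive_weight. Qed.

Lemma weight_dominated : left_dom (fun s => weight s * om s).
Proof.
apply: left_domM; [exact: weight_continuous| |exact: left_dom_om].
by move=> t; exists K => s _; rewrite ger0_norm ?expR_ge0// weight_le.
Qed.

(** [weight] is the exponential of 4 M times the primitive of [om] that vanishes at -oo, so the
    integral is ([weight] - 1) / (4 M). *)
Lemma left_integral_weight t : J (fun s => weight s * om s) t <= weight t / (4 * M).
Proof.
have H (s : R) : is_derive s (1 : R) (fun s => weight s / (4 * M)) (weight s * om s).
  have := is_derive_weight s => Hw.
  by apply: is_derive_eq; rewrite /GRing.scale /=; field; rewrite gt_eqF.
rewrite /left_integral /Rintegral (integral_left_derive (l := 1 / (4 * M)) _ _ _ H).
- by rewrite /= gerBl divr_ge0// mulr_ge0// ltW.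
- by move=> s; rewrite mulr_ge0 ?expR_ge0// (ltW (om_gt0 _)).
- by case: weight_dominated.
- apply: cvgM; last exact: cvg_cst.
  rewrite -[X in _ --> X]expR0.
  have -> : 0 = 4 * M * (- (pi / 2) + pi / 2) :> R by rewrite addNr mulr0.
  apply: (cvg_comp _ expR); last exact: continuous_expR.
  apply: cvgM; first exact: cvg_cst.
  by apply: cvgD; [exact: cvgNy_atan|exact: cvg_cst].
Qed.

Lemma cmul_re_weight q r a b c : om_bounded q -> om_bounded r -> 0 <= c ->
  (forall t, `|a t| + `|b t| <= c * weight t) ->
  forall t, `|cmul_re q r a b t| + `|cmul_re q (fun s => - r s) b a t| <=
    2 * M * c * (weight t * om t).
Proof.
move=> [_ Hq] [_ Hr] c0 Hab t; apply: le_trans (cmul_re_norm _ _ _ _ _) _.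
rewrite (_ : 2 * M * c * _ = (M * om t + M * om t) * (c * weight t)); last by ring.
by rewrite ler_pM ?addr_ge0// lerD.
Qed.

(** The two components of the product are together at most 2 M c [weight] [om], and integration
    costs 1 / (4 M): the rate 4 M in [weight] is chosen to give the factor 1/2. *)
Lemma volterra_contraction q r a b c : om_bounded q -> om_bounded r -> 0 <= c ->
  bounded_continuous a -> bounded_continuous b ->
  (forall t, `|a t| + `|b t| <= c * weight t) ->
  forall t, `|volterra q r a b t| + `|volterra q (fun s => - r s) b a t| <=
    c / 2 * weight t.
Proof.
move=> Hq Hr c0 Ha Hb Hab t.
have D1 : left_dom (cmul_re q r a b) by apply: left_dom_cmul_re => //; exact: om_bounded_dominated.
have D2 : left_dom (cmul_re q (fun s => - r s) b a).
  by apply: left_dom_cmul_re => //; apply: om_bounded_dominated => //; exact: om_boundedN.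
apply: le_trans (lerD (volterra_norm t D1) (volterra_norm t D2)) _.
rewrite -left_integralD; [|exact: left_dom_norm..].
apply: (@le_trans _ _ (J (fun s => 2 * M * c * (weight s * om s)) t)).
  apply: left_integral_le.
  - by apply: left_domD; exact: left_dom_norm.
  - by apply: left_domZ; exact: weight_dominated.
  - by move=> s _; exact: cmul_re_weight.
rewrite left_integralZ; last exact: weight_dominated.
apply: (@le_trans _ _ (2 * M * c * (weight t / (4 * M)))).
  by rewrite ler_wpM2l ?left_integral_weight// !mulr_ge0// ltW.
by rewrite le_eqVlt; apply/orP; left; apply/eqP; field; rewrite gt_eqF.
Qed.

(* [(a, b)] is the Jost solution at -oo of Rayleigh's equation. *)
Definition jost q r a b :=
  [/\ continuous a, continuous b, forall t, `|a t| + `|b t| <= 1 + 4 * K &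
      forall t, a t = 1 + volterra q r a b t /\ b t = volterra q (fun s => - r s) b a t].

Lemma bounded_continuousB a b : bounded_continuous a -> bounded_continuous b ->
  bounded_continuous (fun s => a s - b s).
Proof.
move=> [ca [c Hc]] [cb [d Hd]]; split; first by move=> s; apply: cvgB; [exact: ca|exact: cb].
by exists (c + d) => s; rewrite (le_trans (ler_normB _ _))// lerD.
Qed.

Lemma pair_bounded_continuous a b c : continuous a -> continuous b ->
  (forall t, `|a t| + `|b t| <= c) -> bounded_continuous a /\ bounded_continuous b.
Proof.
move=> ca cb H; split; split=> //; exists c => s.
  by have := H s; have := normr_ge0 (b s); lra.
by have := H s; have := normr_ge0 (a s); lra.
Qed.

(** Picard iteration from (1, 0). In the weighted norm the increments halve at each step, and since
    1 <= [weight] <= K this is uniform convergence at rate K / 2^n. *)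
Lemma jost_exists q r : om_bounded q -> om_bounded r -> exists a b, jost q r a b.
Proof.
move=> Hq Hr; have HrN := om_boundedN Hr.
pose T (x : (R -> R) * (R -> R)) : (R -> R) * (R -> R) :=
  (fun t => 1 + volterra q r x.1 x.2 t, volterra q (fun s => - r s) x.2 x.1).
pose P n := iter n T (cst 1, cst 0).
have K1 : 1 <= K by apply: le_trans (weight_ge1 0) (weight_le 0).
have HP n : [/\ continuous (P n).1, continuous (P n).2 &
    forall t, `|(P n).1 t| + `|(P n).2 t| <= 2 * weight t].
  elim: n => [|n [c1 c2 IH]].
    split; [exact: cst_continuous..|].
    by move=> t; rewrite /= normr0 normr1 addr0; have := weight_ge1 t; lra.
  have [b1 b2] : bounded_continuous (P n).1 /\ bounded_continuous (P n).2.
    apply: (@pair_bounded_continuous _ _ (2 * K)) => // t.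
    by apply: le_trans (IH t) _; rewrite ler_pM2l// weight_le.
  have D1 : left_dom (cmul_re q r (P n).1 (P n).2).
    by apply: left_dom_cmul_re => //; exact: om_bounded_dominated.
  have D2 : left_dom (cmul_re q (fun s => - r s) (P n).2 (P n).1).
    by apply: left_dom_cmul_re => //; exact: om_bounded_dominated.
  split.
  - move=> t; apply: cvgD; first exact: cvg_cst.
    exact: is_derive_continuous (fun t => is_derive_volterra t D1) _.
  - exact: is_derive_continuous (fun t => is_derive_volterra t D2).
  - move=> t; have := volterra_contraction Hq Hr (ler0n R 2) b1 b2 IH t.
    have := weight_ge1 t.
    have := ler_normD 1 (volterra q r (P n).1 (P n).2 t); rewrite normr1 /=; lra.
have HB n : bounded_continuous (P n).1 /\ bounded_continuous (P n).2.
  have [c1 c2 H] := HP n.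
  apply: (@pair_bounded_continuous _ _ (2 * K)) => // t.
  by apply: le_trans (H t) _; rewrite ler_pM2l// weight_le.
have dP n t : `|(P n.+1).1 t - (P n).1 t| + `|(P n.+1).2 t - (P n).2 t| <=
    1 / 2 ^+ n * weight t.
  elim: n t => [|n IH] t.
    have B1 : bounded_continuous (cst 1 : R -> R).
      by split; [exact: cst_continuous|exists 1 => s; rewrite normr1].
    have B0 : bounded_continuous (cst 0 : R -> R).
      by split; [exact: cst_continuous|exists 0 => s; rewrite normr0].
    have := volterra_contraction Hq Hr ler01 B1 B0.
    rewrite /= subr0 addrAC subrr add0r expr0 divr1 => /(_ _ t) H.
    apply: le_trans (H _) _; last by have := weight_ge1 t; lra.
    by move=> s; rewrite /= normr0 normr1 addr0 mul1r weight_ge1.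
  have [b1 b2] := HB n; have [b1' b2'] := HB n.+1.
  have E1 k : (P k.+1).1 t = 1 + volterra q r (P k).1 (P k).2 t by [].
  have E2 k : (P k.+1).2 t = volterra q (fun s => - r s) (P k).2 (P k).1 t by [].
  rewrite (E1 n.+1) (E2 n.+1) (E1 n) (E2 n) opprD addrACA subrr add0r.
  rewrite volterraB ?volterraB//; try exact: om_bounded_dominated.
  have := volterra_contraction Hq Hr _ (bounded_continuousB b1' b1) (bounded_continuousB b2' b2) IH t.
  rewrite (_ : 1 / 2 ^+ n / 2 = 1 / 2 ^+ n.+1); last by rewrite exprS; field; rewrite expf_neq0.
  apply.
  by rewrite divr_ge0 ?exprn_ge0.
have dPK n t : 1 / 2 ^+ n * weight t <= K / 2 ^+ n.
  by rewrite mul1r mulrC ler_wpM2r ?invr_ge0 ?exprn_ge0// weight_le.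
have [||a [ca Ha]] := @geometric_uniform_limit R (fun n => (P n).1) K.
- by move=> n; case: (HP n).
- move=> n t; apply: le_trans (le_trans (dP n t) (dPK n t)).
  by rewrite lerDl.
have [||b [cb Hb]] := @geometric_uniform_limit R (fun n => (P n).2) K.
- by move=> n; case: (HP n).
- move=> n t; apply: le_trans (le_trans (dP n t) (dPK n t)).
  by rewrite lerDr.
(* Each component lies within 2 K of the zeroth iterate (1, 0); this is the origin of the bound in
   [jost]. *)
have Hab t : `|a t| + `|b t| <= 1 + 4 * K.
  have := Ha 0%N t; have := Hb 0%N t; rewrite /= expr0 divr1 subr0.
  have := ler_normD (a t - 1) 1; rewrite subrK normr1; lra.
have [ba bb] := pair_bounded_continuous ca cb Hab.
have dV n t : `|volterra q r (P n).1 (P n).2 t - volterra q r a b t| +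
    `|volterra q (fun s => - r s) (P n).2 (P n).1 t - volterra q (fun s => - r s) b a t|
    <= 2 * K / 2 ^+ n * weight t.
  have [b1 b2] := HB n.
  rewrite !volterraB//; try exact: om_bounded_dominated.
  have := @volterra_contraction q r (fun s => (P n).1 s - a s) (fun s => (P n).2 s - b s)
    (4 * K / 2 ^+ n) Hq Hr.
  rewrite (_ : 4 * K / 2 ^+ n / 2 = 2 * K / 2 ^+ n); last by field; rewrite expf_neq0.
  apply.
  - by rewrite divr_ge0 ?exprn_ge0// mulr_ge0// expR_ge0.
  - exact: bounded_continuousB.
  - exact: bounded_continuousB.
  - move=> s; apply: (@le_trans _ _ (4 * K / 2 ^+ n)).
      have := Ha n s; have := Hb n s.
      by rewrite (distrC (b s)) (distrC (a s)); lra.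
    by rewrite ler_peMr ?weight_ge1// divr_ge0 ?exprn_ge0// mulr_ge0// expR_ge0.
have dV' n t : 2 * K / 2 ^+ n * weight t <= 2 * K * K / 2 ^+ n.
  rewrite mulrAC; rewrite ler_wpM2r ?invr_ge0 ?exprn_ge0//.
  by rewrite ler_wpM2l ?weight_le// mulr_ge0// expR_ge0.
exists a, b; split=> // t; split.
  apply/eqP; rewrite -subr_eq0 -normr_le0.
  apply: (@le_half_pow _ _ _ (K + 2 * K * K)) => n; rewrite add0r.
  rewrite (_ : a t - _ = (a t - (P n.+1).1 t) +
    (volterra q r (P n).1 (P n).2 t - volterra q r a b t)); last by rewrite /=; ring.
  rewrite mulrDl (le_trans (ler_normD _ _))// lerD//.
    apply: le_trans (Ha n.+1 t) _.
    by rewrite exprS le_eqVlt; apply/orP; left; apply/eqP; field; rewrite expf_neq0.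
  by apply: le_trans (le_trans (dV n t) (dV' n t)); rewrite lerDl.
apply/eqP; rewrite -subr_eq0 -normr_le0.
apply: (@le_half_pow _ _ _ (K + 2 * K * K)) => n; rewrite add0r.
rewrite (_ : b t - _ = (b t - (P n.+1).2 t) +
  (volterra q (fun s => - r s) (P n).2 (P n).1 t - volterra q (fun s => - r s) b a t)); last by rewrite /=; ring.
rewrite mulrDl (le_trans (ler_normD _ _))// lerD//.
  apply: le_trans (Hb n.+1 t) _.
  by rewrite exprS le_eqVlt; apply/orP; left; apply/eqP; field; rewrite expf_neq0.
by apply: le_trans (le_trans (dV n t) (dV' n t)); rewrite lerDr.
Qed.

Local Notation B := (1 + 4 * K).

Lemma jost_bounded q r a b : jost q r a b -> bounded_continuous a /\ bounded_continuous b.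
Proof. by case=> ca cb H _; exact: pair_bounded_continuous H. Qed.

Lemma jost_dom q r a b : om_bounded q -> om_bounded r -> jost q r a b ->
  left_dom (cmul_re q r a b) /\ left_dom (cmul_re q (fun s => - r s) b a).
Proof.
move=> Hq Hr /jost_bounded[Ha Hb]; have HrN := om_boundedN Hr.
by split; apply: left_dom_cmul_re => //; exact: om_bounded_dominated.
Qed.

Lemma is_derive_jost q r a b t : om_bounded q -> om_bounded r -> jost q r a b ->
  is_derive t (1 : R) a (J2 (cmul_re q r a b) t) /\
  is_derive t (1 : R) b (J2 (cmul_re q (fun s => - r s) b a) t).
Proof.
move=> Hq Hr Hj; have [D1 D2] := jost_dom Hq Hr Hj; case: Hj => _ _ _ Hj.
have H1 := is_derive_volterra t D1; have H2 := is_derive_volterra t D2.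
have {}H1 : is_derive t (1 : R) (fun t => 1 + volterra q r a b t) (J2 (cmul_re q r a b) t).
  exact: is_derive_addl.
have e1 : (fun t => 1 + volterra q r a b t) = a by apply/funext => u; case: (Hj u).
have e2 : volterra q (fun s => - r s) b a = b by apply/funext => u; case: (Hj u).
by rewrite e1 in H1; rewrite e2 in H2.
Qed.

Lemma jost_norm q r a b t : jost q r a b -> `|a t| + `|b t| <= B.
Proof. by case=> _ _ H _. Qed.

Lemma bound_ge0 : 0 <= B.
Proof. by rewrite addr_ge0// mulr_ge0// expR_ge0. Qed.

(** All four quantities are controlled by the integral of 2 M B [om] up to [t]. It tends to 0 at
    -oo, which normalises the solution, and never exceeds 2 M B pi, which bounds it globally. *)
Lemma jost_asymptotic q r a b t : om_bounded q -> om_bounded r -> jost q r a b ->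
  [/\ `|a t - 1| <= 2 * M * B * (atan t + pi / 2), `|b t| <= 2 * M * B * (atan t + pi / 2),
      `|J2 (cmul_re q r a b) t| <= 2 * M * B * (atan t + pi / 2) &
      `|J2 (cmul_re q (fun s => - r s) b a) t| <= 2 * M * B * (atan t + pi / 2)].
Proof.
move=> Hq Hr Hj; have [D1 D2] := jost_dom Hq Hr Hj.
have F s : `|cmul_re q r a b s| + `|cmul_re q (fun s => - r s) b a s| <= 2 * M * B * om s.
  apply: le_trans (cmul_re_norm _ _ _ _ _) _.
  rewrite (_ : 2 * M * B * _ = (M * om s + M * om s) * B); last by ring.
  by rewrite ler_pM ?addr_ge0 ?(jost_norm _ Hj)// lerD ?Hq.2 ?Hr.2.
have om_int : J (@om R) t = atan t + pi / 2 by rewrite /left_integral /Rintegral integral_left_om.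
have I f : left_dom f -> (forall s, `|f s| <= 2 * M * B * om s) ->
    J (fun s => `|f s|) t <= 2 * M * B * (atan t + pi / 2).
  move=> Df Hf; rewrite -om_int -left_integralZ; last exact: left_dom_om.
  apply: left_integral_le => //; first exact: left_dom_norm.
  by apply: left_domZ; exact: left_dom_om.
have {}I1 : J (fun s => `|cmul_re q r a b s|) t <= 2 * M * B * (atan t + pi / 2).
  by apply: I => // s; apply: le_trans (F s); rewrite lerDl.
have {}I2 : J (fun s => `|cmul_re q (fun s => - r s) b a s|) t <= 2 * M * B * (atan t + pi / 2).
  by apply: I => // s; apply: le_trans (F s); rewrite lerDr.
case: (Hj) => _ _ _ /(_ t)[e1 e2]; split.
- by rewrite e1 addrAC subrr add0r (le_trans (volterra_norm _ D1)).
- by rewrite e2 (le_trans (volterra_norm _ D2)).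
- by rewrite (le_trans (left_resolvent_norm _ D1)).
- by rewrite (le_trans (left_resolvent_norm _ D2)).
Qed.

(** Large enough for both bounds obtained below: 2 B K eta for the values and 4 M B K pi eta + B eta
    for the derivatives. *)
Definition stability_constant := B * (1 + 8 * M * K * pi) + 4 * B * K.

(** The difference of the two solutions is the Volterra operator of the second pair of coefficients
    applied to that difference, plus a source of size B eta. The contraction absorbs the former; the
    bounds on the derivatives follow by inserting the result. *)
Lemma jost_stability q r a b q' r' a' b' eta : om_bounded q -> om_bounded r ->
  jost q r a b -> om_bounded q' -> om_bounded r' -> jost q' r' a' b' ->
  (forall t, J (fun s => `|q s - q' s| + `|r s - r' s|) t <= eta) ->
  forall t, [/\ `|a t - a' t| <= stability_constant * eta,
    `|b t - b' t| <= stability_constant * eta,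
    `|J2 (cmul_re q r a b) t - J2 (cmul_re q' r' a' b') t| <= stability_constant * eta &
    `|J2 (cmul_re q (fun s => - r s) b a) t - J2 (cmul_re q' (fun s => - r' s) b' a') t|
       <= stability_constant * eta].
Proof.
move=> Hq Hr Hj Hq' Hr' Hj' Heta.
have [qd rd] : om_dominated q /\ om_dominated r by split; exact: om_bounded_dominated.
have [qd' rd'] : om_dominated q' /\ om_dominated r' by split; exact: om_bounded_dominated.
have domB f g : om_dominated f -> om_dominated g -> om_dominated (fun s => f s - g s).
  move=> [cf [m Hm]] [cg [m' Hm']]; split; first by move=> s; apply: cvgB; [exact: cf|exact: cg].
  by exists (m + m') => s; rewrite mulrDl (le_trans (ler_normB _ _))// lerD.
have domN f : om_dominated f -> om_dominated (fun s => - f s).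
  move=> [cf [m Hm]]; split; first by move=> s; apply: cvgN; exact: cf.
  by exists m => s; rewrite normrN.
have ldom f : om_dominated f -> left_dom f by move=> [cf [m Hm]]; split => // t; exists m.
have [Ha Hb] := jost_bounded Hj; have [Ha' Hb'] := jost_bounded Hj'.
pose dq s := q s - q' s; pose dr s := r s - r' s.
pose da s := a s - a' s; pose db s := b s - b' s.
have Hdq : om_dominated dq by exact: domB.
have Hdr : om_dominated dr by exact: domB.
have Hda : bounded_continuous da by exact: bounded_continuousB.
have Hdb : bounded_continuous db by exact: bounded_continuousB.
have HD1 : left_dom (cmul_re dq dr a b) by exact: left_dom_cmul_re.
have HD2 : left_dom (cmul_re dq (fun s => - dr s) b a).
  by apply: left_dom_cmul_re => //; exact: domN.
have HE1 : left_dom (cmul_re q' r' da db) by exact: left_dom_cmul_re.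
have HE2 : left_dom (cmul_re q' (fun s => - r' s) db da).
  by apply: left_dom_cmul_re => //; exact: domN.
have eta0 : 0 <= eta by apply: le_trans (Heta 0); apply: Rintegral_ge0 => s _; rewrite addr_ge0.
have IDs t : J (fun s => `|cmul_re dq dr a b s|) t +
    J (fun s => `|cmul_re dq (fun s => - dr s) b a s|) t <= B * eta.
  have HS : left_dom (fun s => `|dq s| + `|dr s|).
    by apply: left_domD; apply: left_dom_norm; exact: ldom.
  rewrite -left_integralD; [|exact: left_dom_norm..].
  apply: (@le_trans _ _ (J (fun s => B * (`|dq s| + `|dr s|)) t)).
    apply: left_integral_le; first by apply: left_domD; exact: left_dom_norm.
      exact: left_domZ.
    move=> s _; apply: le_trans (cmul_re_norm _ _ _ _ _) _.
    by rewrite mulrC ler_wpM2r ?addr_ge0 ?(jost_norm _ Hj).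
  by rewrite left_integralZ// ler_wpM2l ?bound_ge0.
have eqa t : da t = volterra q' r' da db t + volterra dq dr a b t.
  case: (Hj) => _ _ _ /(_ t)[e1 _]; case: (Hj') => _ _ _ /(_ t)[e1' _].
  have := volterraB t qd' rd' Ha Hb Ha' Hb'; have := volterra_coefB t qd rd qd' rd' Ha Hb.
  by rewrite /da e1 e1' -/da -/db -/dq -/dr => <- <-; ring.
have eqb t : db t = volterra q' (fun s => - r' s) db da t + volterra dq (fun s => - dr s) b a t.
  case: (Hj) => _ _ _ /(_ t)[_ e1]; case: (Hj') => _ _ _ /(_ t)[_ e1'].
  have := volterraB t qd' (domN _ rd') Hb Ha Hb' Ha'.
  have := volterra_coefB t qd (domN _ rd) qd' (domN _ rd') Hb Ha.
  have -> : (fun s => - r s - - r' s) = fun s => - dr s.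
    by apply/funext => s; rewrite /dr; ring.
  by rewrite /db e1 e1' -/da -/db -/dq => <- <-; ring.
have step c : 0 <= c -> (forall t, `|da t| + `|db t| <= c * weight t) ->
    forall t, `|da t| + `|db t| <= (c / 2 + B * eta) * weight t.
  move=> c0 Hc t.
  have H1 := volterra_contraction Hq' Hr' c0 Hda Hdb Hc t.
  have H2 := volterra_norm t HD1; have H3 := volterra_norm t HD2; have H4 := IDs t.
  have H5 : B * eta <= B * eta * weight t.
    by rewrite ler_peMr ?weight_ge1// mulr_ge0// bound_ge0.
  rewrite eqa eqb mulrDl.
  have := ler_normD (volterra q' r' da db t) (volterra dq dr a b t).
  have := ler_normD (volterra q' (fun s => - r' s) db da t)
                    (volterra dq (fun s => - dr s) b a t); lra.
(* Iterating c -> c / 2 + B eta from the trivial bound 2 B leads to its fixed point 2 B eta. *)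
have it n : forall t, `|da t| + `|db t| <= (2 * B / 2 ^+ n + 2 * (B * eta)) * weight t.
  elim: n => [|n IH] t.
    rewrite expr0 divr1; apply: (@le_trans _ _ (2 * B)).
      have := jost_norm t Hj; have := jost_norm t Hj'.
      have := ler_normB (a t) (a' t); have := ler_normB (b t) (b' t).
      by rewrite /da /db; lra.
    apply: (@le_trans _ _ (2 * B * weight t)).
      by rewrite ler_peMr ?weight_ge1// mulr_ge0// bound_ge0.
    by rewrite ler_wpM2r ?expR_ge0// lerDl !mulr_ge0// bound_ge0.
  have := step _ _ IH t; rewrite exprS.
  rewrite (_ : (2 * B / 2 ^+ n + 2 * (B * eta)) / 2 + B * eta =
    2 * B / (2 * 2 ^+ n) + 2 * (B * eta)); last by field; rewrite expf_neq0.
  apply; rewrite addr_ge0// ?divr_ge0 ?exprn_ge0 ?mulr_ge0// ?bound_ge0//.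
have d_le t : `|da t| + `|db t| <= 2 * B * K * eta.
  apply: (@le_half_pow _ _ _ (2 * B * K)) => n; apply: le_trans (it n t) _.
  rewrite (_ : 2 * B * K * eta + _ = (2 * B / 2 ^+ n + 2 * (B * eta)) * K).
    rewrite ler_wpM2l ?weight_le// addr_ge0 ?divr_ge0 ?exprn_ge0 ?mulr_ge0//; exact: bound_ge0.
  by field; rewrite expf_neq0.
have C1 : 2 * B * K * eta <= stability_constant * eta.
  rewrite ler_wpM2r// /stability_constant.
  have : 0 <= B * (1 + 8 * M * K * pi).
    by rewrite mulr_ge0 ?bound_ge0// addr_ge0// !mulr_ge0 ?expR_ge0 ?pi_ge0// ltW.
  have : 0 <= B * K by rewrite mulr_ge0 ?bound_ge0// expR_ge0.
  lra.
have IE t : J (fun s => `|cmul_re q' r' da db s|) t +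
    J (fun s => `|cmul_re q' (fun s => - r' s) db da s|) t <= 2 * M * (2 * B * K * eta) * pi.
  rewrite -left_integralD; [|exact: left_dom_norm..].
  apply: (@le_trans _ _ (J (fun s => 2 * M * (2 * B * K * eta) * om s) t)).
    apply: left_integral_le; first by apply: left_domD; exact: left_dom_norm.
      by apply: left_domZ; exact: left_dom_om.
    move=> s _; apply: le_trans (cmul_re_norm _ _ _ _ _) _.
    rewrite (_ : 2 * M * _ * _ = (M * om s + M * om s) * (2 * B * K * eta)); last by ring.
    by rewrite ler_pM ?addr_ge0// lerD ?Hq'.2 ?Hr'.2.
  rewrite left_integralZ; last exact: left_dom_om.
  rewrite ler_wpM2l//; first by rewrite !mulr_ge0 ?bound_ge0 ?expR_ge0// ltW.
  rewrite /left_integral /Rintegral integral_left_om /=.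
  by have /andP[_] := atan_bounds t; lra.
have tot (t : R) : 2 * M * (2 * B * K * eta) * pi + B * eta <= stability_constant * eta.
  have : 0 <= B * K * eta by rewrite !mulr_ge0 ?bound_ge0 ?expR_ge0.
  have : 0 <= M * pi * (B * K * eta).
    by rewrite !mulr_ge0 ?bound_ge0 ?expR_ge0 ?pi_ge0// ltW.
  rewrite /stability_constant; lra.
have [HJ1 HJ2] := jost_dom Hq' Hr' Hj'.
move=> t; split.
- by apply: le_trans C1; apply: le_trans (d_le t); rewrite lerDl.
- by apply: le_trans C1; apply: le_trans (d_le t); rewrite lerDr.
- have -> : cmul_re q r a b = fun s => cmul_re q' r' da db s + cmul_re dq dr a b s + cmul_re q' r' a' b' s.
    by apply/funext => s; rewrite /cmul_re /dq /dr /da /db; ring.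
  rewrite (left_resolventD t (left_domD HE1 HD1) HJ1) (left_resolventD t HE1 HD1).
  rewrite addrK (le_trans (ler_normD _ _))// (le_trans _ (tot t))//.
  apply: lerD; [apply: le_trans (left_resolvent_norm t HE1) _|apply: le_trans (left_resolvent_norm t HD1) _].
    by apply: le_trans (IE t); rewrite lerDl Rintegral_ge0.
  by apply: le_trans (IDs t); rewrite lerDl Rintegral_ge0.
- have -> : cmul_re q (fun s => - r s) b a = fun s => cmul_re q' (fun s => - r' s) db da s +
     cmul_re dq (fun s => - dr s) b a s + cmul_re q' (fun s => - r' s) b' a' s.
    by apply/funext => s; rewrite /cmul_re /dq /dr /da /db; ring.
  rewrite (left_resolventD t (left_domD HE2 HD2) HJ2) (left_resolventD t HE2 HD2).
  rewrite addrK (le_trans (ler_normD _ _))// (le_trans _ (tot t))//.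
  apply: lerD; [apply: le_trans (left_resolvent_norm t HE2) _|apply: le_trans (left_resolvent_norm t HD2) _].
    by apply: le_trans (IE t); rewrite lerDr Rintegral_ge0.
  by apply: le_trans (IDs t); rewrite lerDr Rintegral_ge0.
Qed.

End Volterra.

(** * Unstable eigenvalue of the Rayleigh equation *)

Section RayleighCoefficients.
Variable R : realType.
Implicit Types (t g : R).
Local Notation D := (@dawson R).
Local Notation J := (@left_integral R).

(* Real and imaginary part of D'' / (D - i g). *)
Definition rayleigh_re g t := qz t * D t ^+ 2 / (D t ^+ 2 + g ^+ 2).
Definition rayleigh_im g t := qz t * D t * g / (D t ^+ 2 + g ^+ 2).

Lemma dawson_norm_le1 t : `|D t| <= 1.
Proof.
wlog t0 : t / 0 <= t => [H|].
  by have [/H//|t0] := leP 0 t; rewrite -normrN -dawsonN H// oppr_ge0 ltW.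
have D0 : 0 <= D t.
  by move: t0; rewrite le_eqVlt => /predU1P[<-|/dawson_gt0/ltW//]; rewrite dawson0.
rewrite ger0_norm//; have [t1|/ltW t1] := leP t 1.
  exact: le_trans (dawson_le_id t0) t1.
by apply: le_trans (dawson_le_inv t1) _; rewrite invf_le1// (lt_le_trans _ t1).
Qed.

Lemma dawson_der_norm t : `|1 - 2 * t * D t| <= 3.
Proof.
wlog t0 : t / 0 <= t => [H|].
  have [/H//|t0] := leP 0 t.
  have -> : 1 - 2 * t * D t = 1 - 2 * - t * D (- t) by rewrite dawsonN; ring.
  by rewrite H// oppr_ge0 ltW.
have D0 : 0 <= D t.
  by move: t0; rewrite le_eqVlt => /predU1P[<-|/dawson_gt0/ltW//]; rewrite dawson0.
have tD : t * D t <= 1.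
  have [t1|/ltW t1] := leP t 1.
    by have := dawson_le_id t0; nra.
  by rewrite mulrC -ler_pdivlMr ?div1r ?dawson_le_inv// (lt_le_trans _ t1).
by rewrite ler_norml; apply/andP; split; nra.
Qed.

Section PositiveGamma.
Variable g : R.
Hypothesis g0 : 0 < g.

Lemma rayleigh_den_gt0 t : 0 < D t ^+ 2 + g ^+ 2.
Proof. by rewrite ltr_wpDl ?sqr_ge0 ?exprn_gt0. Qed.

Lemma rayleigh_den_continuous : continuous (fun t => (D t ^+ 2 + g ^+ 2)^-1).
Proof.
move=> t; apply: cvgV; first by rewrite gt_eqF ?rayleigh_den_gt0.
apply: cvgD; last exact: cvg_cst.
by apply: cvgM; exact: dawson_continuous.
Qed.

(** The potential is [qz] times D (D + i gamma) / (D^2 + gamma^2), and the real and imaginary parts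
    of the second factor are at most 1 for every gamma. This is how the regularity of D'' / D makes
    the bound survive gamma -> 0. *)
Lemma rayleigh_re_bounded : om_bounded 100 (rayleigh_re g).
Proof.
split.
  move=> t; apply: cvgM; last exact: rayleigh_den_continuous.
  by apply: cvgM; [exact: qz_continuous|apply: cvgM; exact: dawson_continuous].
move=> t; apply: le_trans (qz_bound t).
rewrite /rayleigh_re -mulrA normrM ler_piMr// ger0_norm ?divr_ge0 ?sqr_ge0 ?(ltW (rayleigh_den_gt0 t))//.
by rewrite ler_pdivrMr ?rayleigh_den_gt0// mul1r lerDl sqr_ge0.
Qed.

Lemma rayleigh_im_bounded : om_bounded 100 (rayleigh_im g).
Proof.
split.
  move=> t; apply: cvgM; last exact: rayleigh_den_continuous.
  apply: cvgM; last exact: cvg_cst.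
  by apply: cvgM; [exact: qz_continuous|exact: dawson_continuous].
move=> t; apply: le_trans (qz_bound t).
rewrite /rayleigh_im -(mulrA (qz t)) -(mulrA (qz t)) normrM ler_piMr//.
rewrite normrM [X in _ * X]ger0_norm ?invr_ge0 ?(ltW (rayleigh_den_gt0 t))//.
rewrite ler_pdivrMr ?rayleigh_den_gt0// mul1r ler_norml.
by have := sqr_ge0 (D t + g); have := sqr_ge0 (D t - g); move=> ? ?; apply/andP; split; nra.
Qed.

End PositiveGamma.

Lemma om_bounded_qz : om_bounded 100 (@qz R).
Proof. by split; [exact: qz_continuous|exact: qz_bound]. Qed.

Lemma om_bounded0 : om_bounded 100 (cst 0 : R -> R).
Proof.
split; first exact: cst_continuous.
by move=> t; rewrite normr0 mulr_ge0// (ltW (om_gt0 _)).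
Qed.

Lemma rayleigh_reN g t : rayleigh_re g (- t) = rayleigh_re g t.
Proof. by rewrite /rayleigh_re qzN dawsonN sqrrN. Qed.

Lemma rayleigh_imN g t : rayleigh_im g (- t) = - rayleigh_im g t.
Proof. by rewrite /rayleigh_im qzN dawsonN sqrrN mulrN !mulNr. Qed.

End RayleighCoefficients.

(** * The discriminant deciding whether the Jost solution can decay at both ends *)

Section Discriminant.
Variable R : realType.
Implicit Types (t g : R) (q r a b : R -> R).
Local Notation D := (@dawson R).
Local Notation J := (@left_integral R).
Local Notation J2 := (@left_resolvent R).
Variable M : R.
Hypothesis M_gt0 : 0 < M.

(* Re (psi' conj psi)(0) for psi = e^t (a + i b). *)
Definition disc q r a b : R :=
  a 0 * (a 0 + J2 (cmul_re q r a b) 0) +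
  b 0 * (b 0 + J2 (cmul_re q (fun s => - r s) b a) 0).

(** One constant serves all coefficients bounded by M [om]: the discriminant is quadratic in
    quantities that are bounded and, by [jost_stability], Lipschitz. It will give the sign at both
    ends of the range of gamma and the continuity in between. *)
Lemma disc_stability : exists2 L : R, 0 <= L & forall q r a b q' r' a' b' eta,
  om_bounded M q -> om_bounded M r -> jost M q r a b ->
  om_bounded M q' -> om_bounded M r' -> jost M q' r' a' b' ->
  (forall t, J (fun s => `|q s - q' s| + `|r s - r' s|) t <= eta) ->
  `|disc q r a b - disc q' r' a' b'| <= L * eta.
Proof.
set B := 1 + 4 * expR (4 * M * pi).
set C := stability_constant M.
pose L := B * (1 + 2 * M * pi).
have B0 : 0 <= B := bound_ge0 M.
have p0 : 0 <= pi :> R by exact: pi_ge0.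
have Mp0 : 0 <= M * pi by rewrite mulr_ge0// ltW.
have C0 : 0 <= C.
  rewrite /C /stability_constant -/B addr_ge0 ?mulr_ge0 ?expR_ge0//.
  rewrite (_ : 8 * M * _ * pi = 8 * (M * pi) * expR (4 * M * pi)); last by ring.
  by rewrite addr_ge0//; apply: mulr_ge0; rewrite ?expR_ge0//; lra.
have L0 : 0 <= L by rewrite /L mulr_ge0//; lra.
have BL : B <= L by rewrite /L ler_peMr//; lra.
have BL2 : 2 * M * B * (atan 0 + pi / 2) <= L.
  rewrite atan0 add0r (_ : _ * (pi / 2) = B * (M * pi)); last by field.
  by rewrite /L ler_wpM2l//; lra.
exists (8 * L * C); first exact: mulr_ge0 (mulr_ge0 (ler0n R 8) L0) C0.
move=> q r a b q' r' a' b' eta Hq Hr Hj Hq' Hr' Hj' Heta.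
have [s1 s2 s3 s4] := jost_stability M_gt0 Hq Hr Hj Hq' Hr' Hj' Heta 0.
have [_ _ a1 b1] := jost_asymptotic 0 Hq Hr Hj.
have [_ _ a1' b1'] := jost_asymptotic 0 Hq' Hr' Hj'.
have n1 := jost_norm 0 Hj; have n1' := jost_norm 0 Hj'.
move: s1 s2 s3 s4 a1 b1 a1' b1' n1 n1'; rewrite -/B -/C /disc.
set x1 := J2 _ 0; set x1' := J2 _ 0; set y1 := J2 _ 0; set y1' := J2 _ 0.
move: (a 0) (b 0) (a' 0) (b' 0) x1 x1' y1 y1' => x y x' y' x1 x1' y1 y1'.
move=> s1 s2 s3 s4 hx1 hy1 hx1' hy1' n1 n1'.
have hx : `|x| <= L by have := normr_ge0 y; lra.
have hy : `|y| <= L by have := normr_ge0 x; lra.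
have hx' : `|x'| <= L by have := normr_ge0 y'; lra.
have hy' : `|y'| <= L by have := normr_ge0 x'; lra.
have prod u v u' v' : `|u| <= L -> `|v'| <= L -> `|u - u'| <= C * eta -> `|v - v'| <= C * eta ->
    `|u * v - u' * v'| <= 2 * L * (C * eta).
  move=> h1 h2 h3 h4; rewrite (_ : u * v - u' * v' = u * (v - v') + (u - u') * v'); last by ring.
  rewrite (le_trans (ler_normD _ _))// !normrM.
  have := ler_pM (normr_ge0 _) (normr_ge0 _) h1 h4.
  have := ler_pM (normr_ge0 _) (normr_ge0 _) h3 h2; lra.
rewrite (_ : _ - _ = (x * x - x' * x') + (x * x1 - x' * x1') +
  ((y * y - y' * y') + (y * y1 - y' * y1'))); last by ring.
have P1 := prod x x x' x' hx hx' s1 s1.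
have P2 := prod x x1 x' x1' hx (le_trans hx1' BL2) s1 s3.
have P3 := prod y y y' y' hy hy' s2 s2.
have P4 := prod y y1 y' y1' hy (le_trans hy1' BL2) s2 s4.
rewrite (_ : 8 * L * C * eta = 2 * L * (C * eta) + 2 * L * (C * eta) +
  (2 * L * (C * eta) + 2 * L * (C * eta))); last by ring.
rewrite (le_trans (ler_normD _ _))// lerD// (le_trans (ler_normD _ _))// lerD//.
Qed.

End Discriminant.

(** * Sign of the discriminant in the neutral limit *)

Section NeutralLimit.
Variable R : realType.
Implicit Types (s t : R) (a b f : R -> R).
Local Notation D := (@dawson R).
Local Notation J := (@left_integral R).
Local Notation J2 := (@left_resolvent R).
Local Notation M := (100 : R).
Local Notation B := (1 + 4 * expR (4 * M * pi)).

(** The function tends to 0 at -oo without ever lying below its value at [T]. It is applied to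
    Wronskians that decrease from 0. *)
Lemma decay_nonpos f (C T : R) : (forall s, s <= T -> `|f s| <= C * expR s) ->
  (forall s, s <= T -> f T <= f s) -> f T <= 0.
Proof.
move=> Hf Hm; rewrite leNgt; apply/negP => fT.
have C0 : 0 <= C.
  by have := le_trans (normr_ge0 _) (Hf T (lexx _)); rewrite pmulr_lge0// expR_gt0.
pose s := Num.min T (ln (f T / (C + 1))).
have sT : s <= T by rewrite ge_min lexx.
have es : expR s <= f T / (C + 1).
  rewrite -[leRHS]lnK; last by rewrite posrE divr_gt0// ltr_wpDl.
  by rewrite ler_expR ge_min lexx orbT.
have := le_trans (Hm s sT) (le_trans (ler_norm _) (Hf s sT)).
apply/negP; rewrite -ltNge; apply: (@le_lt_trans _ _ (C * (f T / (C + 1)))).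
  by rewrite ler_wpM2l.
rewrite mulrA ltr_pdivrMr ?ltr_wpDl// mulrDr mulr1 mulrC; lra.
Qed.

Lemma om_int_small (C e : R) : 0 < e -> exists T : R, forall s, s <= T -> C * (atan s + pi / 2) <= e.
Proof.
move=> e0.
have : C * (atan s + pi / 2) @[s --> -oo] --> C * (- (pi / 2) + pi / 2).
  apply: cvgM; first exact: cvg_cst.
  by apply: cvgD; [exact: cvgNy_atan|exact: cvg_cst].
rewrite addNr mulr0 => /cvgrPdist_le /(_ _ e0) [T [_ HT]].
exists (T - 1) => s sT; have := HT s; rewrite sub0r normrN => /(_ _)/(le_trans (ler_norm _)); apply.
by rewrite (le_lt_trans sT)// gtrBl.
Qed.

Section RealJost.
Variables a b : R -> R.
Hypothesis Hj : jost M (@qz R) (cst 0) a b.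
Let a1 := J2 (cmul_re (@qz R) (cst 0) a b).
Let phi t := expR t * a t.
Let phi1 t := expR t * (a t + a1 t).

Let is_derive_a t : is_derive t (1 : R) a (a1 t).
Proof. by case: (is_derive_jost t (om_bounded_qz R) (om_bounded0 R) Hj). Qed.

Let is_derive_a1 t : is_derive t (1 : R) a1 (qz t * a t - 2 * a1 t).
Proof.
have [H _] := jost_dom (om_bounded_qz R) (om_bounded0 R) Hj.
by apply: (is_derive_eq (left_resolventP t H)); rewrite /cmul_re mul0r subr0.
Qed.

Let is_derive_phi t : is_derive t (1 : R) phi (phi1 t).
Proof.
have H := is_derive_a t.
by apply: is_derive_eq; rewrite /GRing.scale /= /phi1; ring.
Qed.

Let is_derive_phi1 t : is_derive t (1 : R) phi1 ((1 + qz t) * phi t).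
Proof.
have H := is_derive_a t; have H1 := is_derive_a1 t.
by apply: is_derive_eq; rewrite /GRing.scale /= /phi; ring.
Qed.

Lemma real_jost_bound : exists2 C, 0 <= C & forall t, `|phi t| <= C * expR t /\ `|phi1 t| <= C * expR t.
Proof.
have B0 : 0 <= B := bound_ge0 M.
have p0 := pi_ge0 R.
exists (B + 2 * M * B * pi) => [|t].
  by apply: addr_ge0 => //; apply: mulr_ge0 => //; apply: mulr_ge0 => //; lra.
have [_ _ H _] := jost_asymptotic t (om_bounded_qz R) (om_bounded0 R) Hj.
have Ha := jost_norm t Hj; have nb := normr_ge0 (b t).
have H2 : 2 * M * B * (atan t + pi / 2) <= 2 * M * B * pi.
  apply: ler_wpM2l; last by have /andP[_] := atan_bounds t; lra.
  by apply: mulr_ge0 => //; lra.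
have H3 : 0 <= 2 * M * B * pi by apply: mulr_ge0 => //; apply: mulr_ge0 => //; lra.
split; rewrite normrM (ger0_norm (expR_ge0 _)) mulrC ler_wpM2r ?expR_ge0//; first lra.
apply: le_trans (ler_normD _ _) _; move: H; rewrite -/a1; lra.
Qed.

Let D_lt0 t : t < 0 -> D t < 0.
Proof. by move=> t0; rewrite -oppr_gt0 -dawsonN dawson_gt0 ?oppr_gt0. Qed.

(** Here phi'' = (1 + [qz]) phi while D'' = [qz] D, so only phi D survives. *)
Let is_derive_wronskian t :
  is_derive t (1 : R) (fun t => phi1 t * D t - phi t * (1 - 2 * t * D t)) (phi t * D t).
Proof.
have H := is_derive_dawson t.
have H1 := is_derive_phi t; have H2 := is_derive_phi1 t.
apply: is_derive_eq; rewrite /GRing.scale /=.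
have := dratioM t; rewrite /qz; move: (phi t) (phi1 t) (D t) (dratio t) => p p1 d r e.
by ring: e.
Qed.

(** Sturm comparison with D, which is negative on the left half-line. Up to the first point [t1]
    where phi fails to be positive, the Wronskian E decreases from its limit 0 at -oo, hence is
    negative. So phi / D decreases, although it is negative before [t1] and nonnegative at [t1]. *)
Lemma real_jost_gt0 t : t <= 0 -> 0 < phi t.
Proof.
move=> t0; rewrite ltNge; apply/negP => pt.
have cphi : continuous phi by exact: is_derive_continuous is_derive_phi.
have [Y HY] : exists Y, forall s, s <= Y -> 0 < phi s.
  have h0 : 0 < 1 / 2 :> R by lra.
  have [Y HY] := om_int_small (2 * M * B) h0.
  exists Y => s sY; have [H _ _ _] := jost_asymptotic s (om_bounded_qz R) (om_bounded0 R) Hj.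
  have := le_trans H (HY s sY); rewrite ler_norml => /andP[H1 _].
  by rewrite mulr_gt0 ?expR_gt0//; lra.
pose S := [set s | s <= 0 /\ phi s <= 0].
have S0 : S !=set0 by exists t.
have SY : lbound S Y by move=> s [_ ps]; rewrite leNgt; apply/negP => /ltW/HY; lra.
have hS : has_inf S by split => //; exists Y.
pose t1 := inf S.
have t1lb s : S s -> t1 <= s by move=> Ss; apply: ge_inf => //; exists Y.
have t1le : t1 <= 0 by exact: le_trans (t1lb t (conj t0 pt)) t0.
have pos s : s < t1 -> 0 < phi s.
  move=> st; rewrite ltNge; apply/negP => ps.
  have : t1 <= s by apply: t1lb; split=> //; lra.
  lra.
have pt1 : phi t1 <= 0.
  rewrite leNgt; apply/negP => p1.
  have [e /= e0 He] := cvgr_gt (phi t1) (cphi t1) 0 p1.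
  have [s [s0 ps] st] := inf_adherent e0 hS.
  have t1s : t1 <= s by exact: t1lb.
  suff : 0 < phi s by lra.
  by apply: He; rewrite /ball_ /= distrC ger0_norm ?subr_ge0// ltrBlDl.
pose E t := phi1 t * D t - phi t * (1 - 2 * t * D t).
have Edec s u : u <= t1 -> s < u -> E u < E s.
  move=> ut su; rewrite -ltrN2.
  apply: (is_derive_lt (f := fun t => - E t) su (fun t => is_deriveN (is_derive_wronskian t))).
  move=> x /andP[_ xu]; rewrite oppr_gt0 pmulr_rlt0; last by apply: pos; lra.
  by apply: D_lt0; lra.
have [C C0 HC] := real_jost_bound.
have Eb s : `|E s| <= 4 * C * expR s.
  have [h1 h2] := HC s; have d1 := dawson_norm_le1 s; have d2 := dawson_der_norm s.
  rewrite /E (le_trans (ler_normB _ _))// (normrM (phi1 s)) (normrM (phi s)).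
  have := ler_pM (normr_ge0 _) (normr_ge0 _) h2 d1.
  have := ler_pM (normr_ge0 _) (normr_ge0 _) h1 d2; lra.
have E1 : E (t1 - 1) <= 0.
  apply: (@decay_nonpos E (4 * C)) => s; first by move=> _; exact: Eb.
  by rewrite le_eqVlt => /predU1P[->//|/Edec/ltW]; apply; lra.
have Eneg s : t1 - 1 < s -> s <= t1 -> E s < 0.
  by move=> h1 h2; apply: lt_le_trans E1; apply: Edec.
(* At [t1] = 0 the quotient phi / D makes no sense, but there E = - phi(0) >= 0, which already
   contradicts E < 0. *)
have [t10|t10] := ltP t1 0; last first.
  have e : t1 = 0 by apply/eqP; rewrite eq_le t1le.
  have lt1 : t1 - 1 < t1 by lra.
  have := Eneg t1 lt1 (lexx t1); rewrite /E e dawson0 !mulr0 subr0 mulr1 sub0r.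
  by rewrite e in pt1; lra.
have quot s : s < 0 -> is_derive s (1 : R) (fun t => phi t / D t) (E s / D s ^+ 2).
  move=> s0; have H := is_derive_dawson s.
  have := is_derive_div (ltr0_neq0 (D_lt0 s0)) (is_derive_phi s) H.
  by [].
pose s1 := t1 - 1 / 2.
have le1 : s1 <= t1 by rewrite /s1; lra.
have mono : - (phi s1 / D s1) <= - (phi t1 / D t1).
  apply: (is_derive_le_in (f := fun t => - (phi t / D t)) (df := fun t => - (E t / D t ^+ 2)) le1).
    by move=> x /andP[_ xt]; apply: is_deriveN; apply: quot; lra.
  move=> x /andP[x1 x2]; rewrite oppr_ge0 mulr_le0_ge0 ?invr_ge0 ?sqr_ge0//.
  by apply: ltW; apply: Eneg; [move: x1; rewrite /s1|]; lra.
move: mono; apply/negP; rewrite -ltNge ltrN2.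
apply: (@lt_le_trans _ _ 0).
  by rewrite pmulr_rlt0 ?invr_lt0 ?D_lt0//; [rewrite /s1; lra|apply: pos; rewrite /s1; lra].
by rewrite mulr_le0// invr_le0 ltW// D_lt0.
Qed.

(** The Wronskian of phi with chi = exp(-t^2) equals phi'(0) at 0. Since chi'' = (4 t^2 - 2) chi,
    its derivative is phi chi (1 - 2 t / D), which is negative because t / D >= 1, and it starts
    from 0 at -oo. *)
Lemma real_jost_der_lt0 : phi1 0 < 0.
Proof.
pose chi t : R := expR (- t ^+ 2).
pose G t := phi1 t * chi t - phi t * (- (2 * t * chi t)).
have HG t : is_derive t (1 : R) G (phi t * chi t * (1 - 2 * dratio t)).
  have H1 := is_derive_phi t; have H2 := is_derive_phi1 t.
  by apply: is_derive_eq; rewrite /GRing.scale /= /qz /chi; ring.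
have Gdec s t : t <= 0 -> s < t -> G t < G s.
  move=> t0 st; rewrite -ltrN2.
  apply: (is_derive_lt (f := fun t => - G t) st (fun t => is_deriveN (HG t))).
  move=> x /andP[_ xt]; rewrite oppr_gt0 pmulr_rlt0; last first.
    by rewrite mulr_gt0 ?expR_gt0// real_jost_gt0//; lra.
  by have := dratio_ge1 x; lra.
have [C C0 HC] := real_jost_bound.
have Gb s : `|G s| <= 2 * C * expR s.
  have [h1 h2] := HC s.
  have c0 : 0 <= chi s := expR_ge0 _.
  have ex : expR (s ^+ 2) * chi s = 1 by exact: expRxMexpNx_1.
  have ge : 1 + s ^+ 2 <= expR (s ^+ 2) by exact: expR_ge1Dx.
  have c1 : chi s * (1 + s ^+ 2) <= 1 by rewrite -[leRHS]ex mulrC ler_wpM2r.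
  have c2 : `|chi s| <= 1 by rewrite ger0_norm//; nra.
  have c3 : `|- (2 * s * chi s)| <= 1.
    rewrite normrN ler_norml; apply/andP; split; have := sqr_ge0 (s - 1); have := sqr_ge0 (s + 1); nra.
  rewrite /G (le_trans (ler_normB _ _))// (normrM (phi1 s)) (normrM (phi s)).
  have := ler_pM (normr_ge0 _) (normr_ge0 _) h2 c2.
  have := ler_pM (normr_ge0 _) (normr_ge0 _) h1 c3; lra.
have G1 : G (-1) <= 0.
  apply: (@decay_nonpos G (2 * C)) => s; first by move=> _; exact: Gb.
  by rewrite le_eqVlt => /predU1P[->//|/Gdec/ltW]; apply; lra.
have : G 0 < 0 by apply: lt_le_trans G1; apply: Gdec => //; lra.
by rewrite /G /chi expr0n/= mulr0 mul0r !oppr0 mulr0 subr0 expR0 mulr1.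
Qed.

(** With zero imaginary potential the equation for [b] contains [b] alone, so the contraction can be
    applied to the pair (0, [b]), a fixed point; its bound is halved indefinitely. *)
Lemma real_jost_im0 t : b t = 0.
Proof.
have [Ha Hb] := jost_bounded Hj.
have B0 : bounded_continuous (cst 0 : R -> R).
  by split; [exact: cst_continuous|exists 0 => s; rewrite normr0].
have eb s : b s = volterra (@qz R) (fun s => - cst 0 s) b (cst 0) s.
  case: (Hj) => _ _ _ /(_ s)[_ {1}->]; rewrite /volterra.
  suff -> : cmul_re (@qz R) (fun s => - cst 0 s) b a =
            cmul_re (@qz R) (fun s => - cst 0 s) b (cst 0) by [].
  by apply/funext => u; rewrite /cmul_re /= oppr0 !mul0r.
have Bn : 0 <= B := bound_ge0 M.
have it n : forall s, `|b s| <= B / 2 ^+ n * weight M s.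
  elim: n => [|n IH] s.
    rewrite expr0 divr1; apply: le_trans (le_trans _ (jost_norm s Hj)) _; first by rewrite lerDr.
    by rewrite ler_peMr// weight_ge1.
  have := @volterra_contraction R M (ltr0Sn _ _) _ _ (cst 0) b (B / 2 ^+ n) (om_bounded_qz R) (om_bounded0 R).
  move=> /(_ _ B0 Hb) H; rewrite eb.
  apply: le_trans (le_trans _ (H _ _ s)) _.
  - by rewrite lerDr.
  - by rewrite divr_ge0 ?exprn_ge0.
  - by move=> u; rewrite /= normr0 add0r.
  - by rewrite exprS le_eqVlt; apply/orP; left; apply/eqP; field; rewrite expf_neq0.
apply/eqP; rewrite -normr_le0; apply: (@le_half_pow _ _ _ (B * weight M t)) => n.
by rewrite add0r mulrAC; exact: it.
Qed.

Lemma disc_neutral : disc (@qz R) (cst 0) a b < 0.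
Proof.
rewrite /disc !real_jost_im0 mul0r addr0 -/(a1 0).
have := real_jost_gt0 (lexx 0); have := real_jost_der_lt0.
by rewrite /phi /phi1 expR0 !mul1r => h1 h2; rewrite pmulr_rlt0.
Qed.

End RealJost.
End NeutralLimit.

(** * Existence of a zero of the discriminant at some positive gamma *)

Section NeutralCrossing.
Variable R : realType.
Implicit Types (s t g : R) (a b f : R -> R).
Local Notation D := (@dawson R).
Local Notation J := (@left_integral R).
Local Notation J2 := (@left_resolvent R).
Local Notation M := (100 : R).
Local Notation mu := (@lebesgue_measure R).

Lemma M_gt0 : 0 < M. Proof. by []. Qed.

Lemma left_integral_leT f t : continuous f -> (forall s, 0 <= f s) ->
  mu.-integrable setT (EFin \o f) -> J f t <= fine (\int[mu]_s (f s)%:E).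
Proof.
move=> cf f0 fi; have mf : measurable_fun setT (EFin \o f).
  by apply/measurable_EFinP; exact: continuous_measurable_fun.
apply: fine_le.
- by apply: integrable_fin_num => //; exact: integrableS fi.
- exact: integrable_fin_num.
- by apply: ge0_subset_integral => // s _; rewrite lee_fin.
Qed.

Lemma left_integral_le_om f c t : left_dom f -> (forall s, f s <= c * om s) ->
  0 <= c -> J f t <= c * pi.
Proof.
move=> df H c0; apply: (@le_trans _ _ (J (fun s => c * om s) t)).
  by apply: left_integral_le => //; apply: left_domZ; exact: left_dom_om.
rewrite left_integralZ; last exact: left_dom_om.
rewrite ler_wpM2l// /left_integral /Rintegral integral_left_om /=.
by have /andP[_] := atan_bounds t; lra.
Qed.

Lemma left_dom_diff q r q' r' : om_bounded M q -> om_bounded M r ->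
  om_bounded M q' -> om_bounded M r' ->
  left_dom (fun s => `|q s - q' s| + `|r s - r' s|).
Proof.
have H p : om_bounded M p -> left_dom p by case=> cp bp; split => // t; exists M.
by move=> *; apply: left_domD; apply: left_dom_norm; apply: left_domB; exact: H.
Qed.

(** Convergence of the coefficients as gamma -> 0 fails at the critical point 0 where D vanishes:
    there [rayleigh_re] is 0 but [qz] is -4. Pointwise convergence elsewhere and the majorant 300
    [om] allow dominated convergence along gamma = 1 / (n + 1). *)
Lemma rayleigh_integral_cvg0 (e : R) : 0 < e -> exists2 g, 0 < g &
  forall t, J (fun s => `|rayleigh_re g s - qz s| + `|rayleigh_im g s - cst 0 s|) t <= e.
Proof.
move=> e0.
pose h n : R := n.+1%:R^-1.
have h0 n : 0 < h n by rewrite invr_gt0.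
pose F n s : R := `|rayleigh_re (h n) s - qz s| + `|rayleigh_im (h n) s - cst 0 s|.
have dF n : left_dom (F n).
  apply: left_dom_diff; [exact: rayleigh_re_bounded|exact: rayleigh_im_bounded|
    exact: om_bounded_qz|exact: om_bounded0].
have FM n s : F n s <= 300 * om s.
  have [_ /(_ s) h1] := rayleigh_re_bounded (h0 n).
  have [_ /(_ s) h2] := rayleigh_im_bounded (h0 n).
  have h3 := qz_bound s; rewrite /F subr0.
  have := ler_normB (rayleigh_re (h n) s) (qz s); lra.
have F0 n s : 0 <= F n s by rewrite addr_ge0.
have iom : mu.-integrable setT (EFin \o (fun s => 300 * om s)).
  rewrite (_ : EFin \o _ = (fun s => 300%:E * (EFin \o @om R) s)%E).
    by apply: integrableZl => //; exact: integrable_om.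
  by apply/funext => s /=; rewrite EFinM.
have mF n : measurable_fun setT (EFin \o F n).
  by apply/measurable_EFinP; apply: continuous_measurable_fun; case: (dF n).
have hc : h n @[n --> \oo] --> (0 : R) by exact: cvg_harmonic.
have Fc s : s != 0 -> F n s @[n --> \oo] --> (0 : R).
  move=> s0; have Ds : D s ^+ 2 != 0 by rewrite expf_neq0// dawson_neq0.
  have hc2 : (D s ^+ 2 + h n ^+ 2)^-1 @[n --> \oo] --> (D s ^+ 2)^-1.
    have -> : (D s ^+ 2)^-1 = (D s ^+ 2 + 0 ^+ 2)^-1 by rewrite expr0n addr0.
    apply: cvgV; first by rewrite expr0n addr0.
    apply: cvgD; first exact: cvg_cst.
    exact: (cvgM hc hc).
  have c1 : rayleigh_re (h n) s @[n --> \oo] --> qz s.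
    have -> : qz s = qz s * D s ^+ 2 * (D s ^+ 2)^-1 by rewrite mulfK.
    by apply: cvgM => //; exact: cvg_cst.
  have c2 : rayleigh_im (h n) s @[n --> \oo] --> (0 : R).
    have -> : 0 = qz s * D s * 0 * (D s ^+ 2)^-1 :> R by rewrite mulr0 mul0r.
    by apply: cvgM => //; apply: cvgM => //; exact: cvg_cst.
  have e00 : `|qz s - qz s| + `|(0 : R) - (0 : R)| = 0 :> R.
    by rewrite (subrr (qz s)) subr0 !normr0 addr0.
  rewrite -[X in _ --> X]e00.
  apply: cvgD; apply: cvg_norm; apply: cvgB => //; exact: cvg_cst.
have A1 : {ae mu, forall s, setT s -> (EFin \o F n) s @[n --> \oo] --> (cst 0%E : R -> \bar R) s}.
  exists [set 0]; split; [exact: measurable_set1|exact: lebesgue_measure_set1|].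
  move=> s /= H; apply/eqP/negPn/negP => s0; apply: H => _.
  by apply/fine_cvgP; split; [near=> n|exact: Fc].
have A2 : {ae mu, forall s, forall n, setT s -> (`|(EFin \o F n) s| <= (EFin \o (fun s => (300 * om s)%R)) s)%E}.
  by apply: aeW => s n _; rewrite /= lee_fin ger0_norm.
have [_ _ /=] := @dominated_convergence _ _ R mu setT measurableT (fun n => EFin \o F n)
  (cst 0%E) _ mF (measurable_cst _) A1 iom A2.
rewrite integral0 => /fine_cvgP[_ /cvgrPdist_le /(_ _ e0) [n _ /(_ n (leqnn _))]].
rewrite /= sub0r normrN => Hn.
have iF : mu.-integrable setT (EFin \o F n).
  apply: le_integrable iom => //; first exact: mF.
  move=> s _ /=; rewrite lee_fin ger0_norm//.
  exact: le_trans (FM n s) (ler_norm _).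
exists (h n) => // t; apply: le_trans (left_integral_leT t (dF n).1 (F0 n) iF) _.
exact: le_trans (ler_norm _) Hn.
Unshelve. all: by end_near. Qed.

Lemma rayleigh_large g t : 1 <= g ->
  J (fun s => `|rayleigh_re g s - cst 0 s| + `|rayleigh_im g s - cst 0 s|) t <= 200 * pi / g.
Proof.
move=> g1; have g0 : 0 < g by lra.
have -> : 200 * pi / g = 200 / g * pi by field; lra.
apply: left_integral_le_om.
- by apply: left_dom_diff; [exact: rayleigh_re_bounded|exact: rayleigh_im_bounded|
    exact: om_bounded0|exact: om_bounded0].
- move=> s; rewrite /= !subr0.
  have den := rayleigh_den_gt0 g0 s.
  have D1 := dawson_norm_le1 s; have q1 := qz_bound s.
  have w x : `|x| <= g^-1 -> `|qz s * x| <= 100 * om s / g by move=> xg; rewrite normrM ler_pM.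
  have D2 : D s ^+ 2 <= 1 by rewrite -[D s ^+ 2]ger0_norm ?sqr_ge0// normrX exprn_ile1.
  have D0 : 0 <= D s ^+ 2 := sqr_ge0 _.
  have iden : 0 <= (D s ^+ 2 + g ^+ 2)^-1 by rewrite invr_ge0 ltW.
  have h1 : `|rayleigh_re g s| <= 100 * om s / g.
    rewrite /rayleigh_re -(mulrA (qz s)); apply: w.
    rewrite normrM (ger0_norm D0) (ger0_norm iden) ler_pdivrMr// mulrC ler_pdivlMr//; nra.
  have h2 : `|rayleigh_im g s| <= 100 * om s / g.
    rewrite /rayleigh_im -(mulrA (qz s)) -(mulrA (qz s)); apply: w.
    rewrite normrM (normrM (D s)) (ger0_norm (ltW g0)) (ger0_norm iden).
    rewrite ler_pdivrMr// (mulrC g^-1) ler_pdivlMr//.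
    by have := normr_ge0 (D s); nra.
  rewrite (_ : 200 / g * om s = 100 * om s / g + 100 * om s / g); last by ring.
  exact: lerD.
- by apply: divr_ge0 (ler0n R 200) (ltW g0).
Qed.

Lemma rayleigh_lipschitz (g0 G : R) : 0 < g0 -> exists2 L, 0 <= L &
  forall g g', g0 <= g <= G -> g0 <= g' <= G -> forall t,
  J (fun s => `|rayleigh_re g s - rayleigh_re g' s| + `|rayleigh_im g s - rayleigh_im g' s|) t
    <= L * `|g - g'|.
Proof.
(* As |D| <= 1, the numerators of the differences are at most 2 G and 1 + G^2 times |g - g'|, and
   the denominators are at least [g0]^4. The norm of [G] appears because its sign is known only once
   some [g] in the interval is given. *)
move=> g0p; pose K := (2 * `|G| + 1 + G ^+ 2) / g0 ^+ 4.
have K0 : 0 <= K by rewrite /K divr_ge0 ?exprn_ge0 ?(ltW g0p)// !addr_ge0// ?sqr_ge0 ?mulr_ge0.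
exists (200 * K * pi); first exact: mulr_ge0 (mulr_ge0 (ler0n R 200) K0) (pi_ge0 R).
move=> g g' /andP[g0g gG] /andP[g0g' gG'] t.
have gp : 0 < g by lra. have gp' : 0 < g' by lra.
have Gp : 0 < G by lra.
have -> : 200 * K * pi * `|g - g'| = 200 * (K * `|g - g'|) * pi by ring.
apply: left_integral_le_om.
- by apply: left_dom_diff; [exact: rayleigh_re_bounded|exact: rayleigh_im_bounded|
    exact: rayleigh_re_bounded|exact: rayleigh_im_bounded].
- move=> s; have den := rayleigh_den_gt0 gp s; have den' := rayleigh_den_gt0 gp' s.
  have D1 := dawson_norm_le1 s; have q1 := qz_bound s.
  have D2 : D s ^+ 2 <= 1 by rewrite -[D s ^+ 2]ger0_norm ?sqr_ge0// normrX exprn_ile1.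
  have D0 : 0 <= D s ^+ 2 := sqr_ge0 _.
  set dd := (D s ^+ 2 + g ^+ 2) * (D s ^+ 2 + g' ^+ 2).
  have ddp : 0 < dd by rewrite mulr_gt0.
  have ddg : g0 ^+ 4 <= dd.
    rewrite (_ : g0 ^+ 4 = g0 ^+ 2 * g0 ^+ 2); last by ring.
    by apply: ler_pM; rewrite ?sqr_ge0//; nra.
  have g04 : 0 < g0 ^+ 4 by rewrite exprn_gt0.
  have w x : `|x| <= 2 * `|G| + 1 + G ^+ 2 -> `|qz s * (x * (g - g')) / dd| <= 100 * (K * `|g - g'|) * om s.
    move=> hx; rewrite (_ : _ / dd = qz s * (x / dd * (g - g'))); last by field; rewrite gt_eqF.
    rewrite normrM (_ : 100 * _ * _ = (100 * om s) * (K * `|g - g'|)); last by ring.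
    rewrite ler_pM// normrM ler_wpM2r// /K normrM [`|dd^-1|]ger0_norm ?invr_ge0 ?(ltW ddp)//.
    by apply: ler_pM => //; rewrite ?invr_ge0 ?(ltW ddp)// lef_pV2.
  have h1 : `|rayleigh_re g s - rayleigh_re g' s| <= 100 * (K * `|g - g'|) * om s.
    rewrite /rayleigh_re (_ : _ - _ = qz s * (- (D s ^+ 2 * (g + g')) * (g - g')) / dd); last first.
      by rewrite /dd; field; rewrite !gt_eqF.
    apply: w; rewrite normrN normrM (ger0_norm D0) (ger0_norm (ltW (addr_gt0 gp gp'))).
    by rewrite (ger0_norm (ltW Gp)); nra.
  have h2 : `|rayleigh_im g s - rayleigh_im g' s| <= 100 * (K * `|g - g'|) * om s.
    rewrite /rayleigh_im (_ : _ - _ = qz s * (D s * (D s ^+ 2 - g * g') * (g - g')) / dd); last first.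
      by rewrite /dd; field; rewrite !gt_eqF.
    apply: w; rewrite normrM; apply: (@le_trans _ _ (1 * (1 + G ^+ 2))); last first.
      by have := normr_ge0 G; lra.
    apply: ler_pM => //; rewrite ler_norml; apply/andP; split; nra.
  rewrite (_ : 200 * _ * _ = 100 * (K * `|g - g'|) * om s + 100 * (K * `|g - g'|) * om s); last by ring.
  exact: lerD.
- exact: mulr_ge0 (ler0n R 200) (mulr_ge0 K0 (normr_ge0 _)).
Qed.

(** The limit gamma -> +oo: the potential vanishes and psi = e^t, with discriminant 1. *)
Lemma jost_zero : jost M (cst 0) (cst 0) (cst 1) (cst 0).
Proof.
have z a b : cmul_re (cst 0) (cst 0) a b = cst (0 : R).
  by apply/funext => s; rewrite /cmul_re /= !mul0r subr0.
have N0 : (fun s : R => - cst (0 : R) s) = cst 0 by apply/funext => s; rewrite /= oppr0.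
have J0 t : J (cst 0) t = 0.
  by rewrite /left_integral Rintegral_cst// mul0r.
have V0 t : J2 (cst 0) t = 0.
  rewrite /left_resolvent (_ : (fun s => _) = cst 0) ?J0 ?mulr0//.
  by apply/funext => s; rewrite /= mulr0.
split; [exact: cst_continuous|exact: cst_continuous| |].
  by move=> t; rewrite /= normr1 normr0 addr0 lerDl mulr_ge0// expR_ge0.
by move=> t; rewrite N0 /volterra !z J0 V0 subrr mul0r addr0.
Qed.

Lemma clamp_lipschitz (lo hi x y : R) :
  `|Num.max lo (Num.min x hi) - Num.max lo (Num.min y hi)| <= `|x - y|.
Proof.
have maxl (u v : R) : `|Num.max lo u - Num.max lo v| <= `|u - v|.
  have := ler_norm (u - v); have := ler_norm (v - u); rewrite (distrC v) ler_norml.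
  have [?|?] := leP lo u; have [?|?] := leP lo v => ? ?; apply/andP; split; lra.
have minl : `|Num.min x hi - Num.min y hi| <= `|x - y|.
  have := ler_norm (x - y); have := ler_norm (y - x); rewrite (distrC y) ler_norml.
  have [?|?] := leP x hi; have [?|?] := leP y hi => ? ?; apply/andP; split; lra.
exact: le_trans (maxl _ _) minl.
Qed.

Lemma disc_crossing : exists2 g, 0 < g &
  exists a b, jost M (rayleigh_re g) (rayleigh_im g) a b /\
    disc (rayleigh_re g) (rayleigh_im g) a b = 0.
Proof.
have [L L0 HL] := disc_stability M_gt0.
(* Any choice of Jost solutions will do: [disc_stability] controls the discriminant whichever
   solutions are picked. *)
have /choice[w Hw] : forall g, exists x, 0 < g -> jost M (rayleigh_re g) (rayleigh_im g) x.1 x.2.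
  move=> g; have [g0|g0] := ltP 0 g; last by exists (cst 0, cst 0) => ?; lra.
  have [a [b H]] := jost_exists M_gt0 (rayleigh_re_bounded g0) (rayleigh_im_bounded g0).
  by exists (a, b).
pose f g := disc (rayleigh_re g) (rayleigh_im g) (w g).1 (w g).2.
have [g1 g10 fg1] : exists2 g, 0 < g & f g < 0.
  have [a [b Hj]] := jost_exists M_gt0 (om_bounded_qz R) (om_bounded0 R).
  have d0 := disc_neutral Hj; set d := disc _ _ a b in d0.
  (* With this tolerance the discriminant moves by at most half of |d| and keeps its sign. *)
  have e0 : 0 < - d / (2 * (L + 1)) by rewrite divr_gt0 ?oppr_gt0// mulr_gt0// ltr_wpDl.
  have [g g0 Hg] := rayleigh_integral_cvg0 e0; exists g => //.
  have := HL _ _ _ _ _ _ _ _ _ (rayleigh_re_bounded g0) (rayleigh_im_bounded g0) (Hw g g0)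
    (om_bounded_qz R) (om_bounded0 R) Hj Hg.
  rewrite -/(f g) -/d => H.
  have : L * (- d / (2 * (L + 1))) <= - d / 2.
    rewrite (_ : L * _ = (- d / 2) * (L / (L + 1))); last by field; rewrite gt_eqF// ltr_wpDl.
    by rewrite ler_piMr ?ler_pdivrMr ?ltr_wpDl//; lra.
  by have := ler_norm (f g - d); lra.
(* By [rayleigh_large], such a [G] keeps the discriminant at distance less than 1 from its value 1
   for the zero potential; it also lies beyond [g1] and 1. *)
pose G := g1 + 1 + L * (200 * pi) + 1.
have Lp : 0 <= L * (200 * pi) := mulr_ge0 L0 (mulr_ge0 (ler0n R 200) (pi_ge0 R)).
have G1 : 1 <= G by rewrite /G; lra.
have G0 : 0 < G by lra.
have fG : 0 < f G.
  have := HL _ _ _ _ _ _ _ _ _ (rayleigh_re_bounded G0) (rayleigh_im_bounded G0) (Hw G G0)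
    (om_bounded0 R) (om_bounded0 R) jost_zero (fun t => rayleigh_large t G1).
  have -> : disc (cst 0) (cst 0) (cst 1) (cst 0) = 1 :> R.
    have z a b : cmul_re (cst 0) (cst 0) a b = cst (0 : R).
      by apply/funext => s; rewrite /cmul_re /= !mul0r subr0.
    rewrite /disc z mul0r addr0 mul1r /left_resolvent (_ : (fun s => _) = cst 0).
      by rewrite /left_integral Rintegral_cst// mul0r mulr0 addr0.
    by apply/funext => s; rewrite /= mulr0.
  have : L * (200 * pi / G) < 1.
    by rewrite mulrA ltr_pdivrMr// mul1r /G; lra.
  by rewrite -/(f G) ler_norml => ? /andP[]; lra.
have g1G : g1 <= G by rewrite /G; lra.
have [K K0 HK] := rayleigh_lipschitz G g10.
(* The Lipschitz estimate holds on [g1, G] only. Precomposing with the projection onto this interval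
   gives a function continuous on the whole line. *)
pose cl g := Num.max g1 (Num.min g G).
have clG g : g1 <= cl g <= G by rewrite /cl le_max lexx ge_max g1G ge_min lexx orbT.
have clp g : 0 < cl g by have /andP[] := clG g; lra.
have clip g g' : `|cl g - cl g'| <= `|g - g'| := clamp_lipschitz g1 G g g'.
have fc : continuous (f \o cl).
  have lip g g' : `|f (cl g) - f (cl g')| <= L * K * `|g - g'|.
    apply: (@le_trans _ _ (L * (K * `|cl g - cl g'|))).
      exact: HL _ _ _ _ _ _ _ _ _ (rayleigh_re_bounded (clp g)) (rayleigh_im_bounded (clp g)) (Hw _ (clp g))
        (rayleigh_re_bounded (clp g')) (rayleigh_im_bounded (clp g')) (Hw _ (clp g')) (HK _ _ (clG g) (clG g')).
    by rewrite -mulrA ler_wpM2l// ler_wpM2l.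
  have LK : 0 < L * K + 1 by rewrite ltr_wpDl// mulr_ge0.
  move=> g; apply/cvgrPdist_le => e e0.
  have : \forall h \near g, `|g - h| <= e / (L * K + 1).
    by exists (e / (L * K + 1)) => /= [|h /= /ltW//]; rewrite divr_gt0.
  apply: filterS => h Hh; apply: le_trans (lip g h) _.
  apply: (@le_trans _ _ ((L * K + 1) * (e / (L * K + 1)))).
    by apply: ler_pM => //; [exact: mulr_ge0|rewrite lerDl].
  by rewrite mulrC divfK// gt_eqF.
have clg1 : cl g1 = g1 by rewrite /cl min_l// max_l.
have clGG : cl G = G by rewrite /cl min_l// max_r.
have [|g _ fg] := IVT g1G (continuous_subspaceT fc) (v := 0).
  by rewrite /= clg1 clGG ge_min le_max (ltW fg1) (ltW fG) orbT.
by exists (cl g); [exact: clp|exists (w (cl g)).1, (w (cl g)).2; split => //; exact: Hw].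
Qed.

End NeutralCrossing.

(** * The unstable mode, decaying at both ends *)

Section UnstableMode.
Variable R : realType.
Implicit Types (s t g : R).
Local Notation J2 := (@left_resolvent R).
Local Notation M := (100 : R).

(* Real form of Rayleigh's equation psi'' = (1 + D'' / (D - i g)) psi. *)
Definition rayleigh_solution g (u v u1 v1 : R -> R) := forall t,
  [/\ is_derive t (1 : R) u (u1 t), is_derive t (1 : R) v (v1 t),
      is_derive t (1 : R) u1 ((1 + rayleigh_re g t) * u t - rayleigh_im g t * v t) &
      is_derive t (1 : R) v1 ((1 + rayleigh_re g t) * v t + rayleigh_im g t * u t)].

(** Gronwall's argument for E = u^2 + v^2 + u1^2 + v1^2: the potential is bounded by 100, whence
    |E'| <= 400 E, and exp(- 400 |t|) E cannot grow away from 0. *)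
Lemma rayleigh_uniqueness g u v u1 v1 : 0 < g -> rayleigh_solution g u v u1 v1 ->
  u 0 = 0 -> v 0 = 0 -> u1 0 = 0 -> v1 0 = 0 ->
  forall t, [/\ u t = 0, v t = 0, u1 t = 0 & v1 t = 0].
Proof.
move=> g0 H z1 z2 z3 z4.
pose E t := u t ^+ 2 + v t ^+ 2 + u1 t ^+ 2 + v1 t ^+ 2.
pose E' t := 2 * (u t * u1 t + v t * v1 t +
  u1 t * ((1 + rayleigh_re g t) * u t - rayleigh_im g t * v t) +
  v1 t * ((1 + rayleigh_re g t) * v t + rayleigh_im g t * u t)).
have HE t : is_derive t (1 : R) E (E' t).
  have [h1 h2 h3 h4] := H t.
  by apply: is_derive_eq; rewrite /GRing.scale /= /E'; ring.
have E0 : E 0 = 0 by rewrite /E z1 z2 z3 z4 expr0n /= !addr0.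
have Ege t : 0 <= E t by rewrite !addr_ge0 ?sqr_ge0.
have bd t : `|E' t| <= 400 * E t.
  have [_ /(_ t)] := rayleigh_re_bounded g0; have [_ /(_ t)] := rayleigh_im_bounded g0.
  rewrite /E' /E; move: (rayleigh_re g t) (rayleigh_im g t) (u t) (v t) (u1 t) (v1 t) => q r x y x1 y1.
  have o1 := om_le1 t; have o0 := om_gt0 t.
  rewrite !ler_norml => /andP[r1 r2] /andP[q1 q2].
  have q1' : -100 <= q by lra. have q2' : q <= 100 by lra.
  have r1' : -100 <= r by lra. have r2' : r <= 100 by lra.
  have aux c d (k : R) : -100 <= k -> k <= 100 -> `|k * (c * d)| <= 50 * (c ^+ 2 + d ^+ 2).
    move=> k1 k2; rewrite ler_norml; have := sqr_ge0 (c - d); have := sqr_ge0 (c + d).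
    by move=> ? ?; apply/andP; split; nra.
  have := aux x1 x q q1' q2'; have := aux y1 y q q1' q2'.
  have := aux y1 x r r1' r2'; have := aux x1 y r r1' r2'.
  have := sqr_ge0 (x - x1); have := sqr_ge0 (x + x1).
  have := sqr_ge0 (y - y1); have := sqr_ge0 (y + y1).
  have := sqr_ge0 x; have := sqr_ge0 y; have := sqr_ge0 x1; have := sqr_ge0 y1.
  rewrite !ler_norml => ? ? ? ? ? ? ? ? /andP[? ?] /andP[? ?] /andP[? ?] /andP[? ?].
  by apply/andP; split; lra.
have Ez t : E t = 0.
  apply/eqP; rewrite eq_le Ege andbT.
  have ep s : 0 < expR s :> R := expR_gt0 s.
  have [t0|t0] := leP 0 t.
    have HF s : is_derive s (1 : R) (fun s => - (expR (- (400 * s)) * E s))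
        (- (expR (- (400 * s)) * (E' s - 400 * E s))).
      have h := HE s; apply: is_derive_eq; rewrite /GRing.scale /=; ring.
    have := is_derive_le t0 HF; rewrite E0 mulr0 oppr0 oppr_ge0 pmulr_rle0//; apply.
    move=> s _; rewrite oppr_ge0 (pmulr_rle0 _ (ep _)) subr_le0.
    exact: le_trans (ler_norm _) (bd s).
  have HF s : is_derive s (1 : R) (fun s => expR (400 * s) * E s)
      (expR (400 * s) * (E' s + 400 * E s)).
    have h := HE s; apply: is_derive_eq; rewrite /GRing.scale /=; ring.
  have := is_derive_le (ltW t0) HF; rewrite E0 mulr0 pmulr_rle0//; apply.
  move=> s _; apply: mulr_ge0; first exact: expR_ge0.
  by have := bd s; rewrite ler_norml => /andP[? _]; lra.
move=> t; have := Ez t; rewrite /E => e.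
have := sqr_ge0 (u t); have := sqr_ge0 (v t); have := sqr_ge0 (u1 t); have := sqr_ge0 (v1 t).
by move=> *; split; apply/eqP; rewrite -sqrf_eq0; apply/eqP; lra.
Qed.

Lemma unstable_mode : exists2 g, 0 < g & exists u v u1 v1,
  [/\ rayleigh_solution g u v u1 v1,
      exists C, forall t, [/\ `|u t| <= C * expR (- `|t|), `|v t| <= C * expR (- `|t|),
        `|u1 t| <= C * expR (- `|t|) & `|v1 t| <= C * expR (- `|t|)] &
      exists t, (u t != 0) || (v t != 0)].
Proof.
have [g g0 [a [b [Hj Hd]]]] := disc_crossing R; exists g => //.
have Hq := rayleigh_re_bounded g0; have Hr := rayleigh_im_bounded g0.
have [D1 D2] := jost_dom Hq Hr Hj.
pose a1 := J2 (cmul_re (rayleigh_re g) (rayleigh_im g) a b).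
pose b1 := J2 (cmul_re (rayleigh_re g) (fun s => - rayleigh_im g s) b a).
pose u t := expR t * a t; pose v t := expR t * b t.
pose u1 t := expR t * (a t + a1 t); pose v1 t := expR t * (b t + b1 t).
have Hsol : rayleigh_solution g u v u1 v1.
  move=> t; have [ha hb] := is_derive_jost t Hq Hr Hj.
  have ha1 : is_derive t (1 : R) a1 (rayleigh_re g t * a t - rayleigh_im g t * b t - 2 * a1 t).
    exact: left_resolventP t D1.
  have hb1 : is_derive t (1 : R) b1 (rayleigh_re g t * b t - - rayleigh_im g t * a t - 2 * b1 t).
    exact: left_resolventP t D2.
  rewrite -/a1 in ha; rewrite -/b1 in hb.
  move: a1 b1 ha hb ha1 hb1 @u1 @v1 => a1 b1 ha hb ha1 hb1 u1 v1.
  by split; apply: is_derive_eq; rewrite /GRing.scale /= /u1 /v1 /u /v; ring.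
have [C C0 HC] : exists2 C, 0 <= C & forall t, [/\ `|u t| <= C * expR t, `|v t| <= C * expR t,
    `|u1 t| <= C * expR t & `|v1 t| <= C * expR t].
  set B := 1 + 4 * expR (4 * M * pi).
  have B0 : 0 <= B := bound_ge0 M.
  have p0 := pi_ge0 R.
  have MB : 0 <= 2 * M * B by apply: mulr_ge0 => //; lra.
  exists (B + 2 * M * B * pi) => [|t]; first by rewrite addr_ge0 ?(mulr_ge0 MB).
  have [_ _ h1 h2] := jost_asymptotic t Hq Hr Hj; have h := jost_norm t Hj.
  rewrite -/a1 -/B in h1; rewrite -/b1 -/B in h2; rewrite -/B in h.
  have na := normr_ge0 (a t); have nb := normr_ge0 (b t).
  have H2 : 2 * M * B * (atan t + pi / 2) <= 2 * M * B * pi.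
    by rewrite ler_wpM2l//; have /andP[_] := atan_bounds t; lra.
  have H3 := mulr_ge0 MB p0.
  have n1 := ler_normD (a t) (a1 t); have n2 := ler_normD (b t) (b1 t).
  by split; rewrite normrM (ger0_norm (expR_ge0 _)) mulrC ler_wpM2r ?expR_ge0//; lra.
have disc0 : u 0 * u1 0 + v 0 * v1 0 = 0.
  by rewrite /u /u1 /v /v1 expR0 !mul1r.
(* The normalisation [a] -> 1 at -oo makes the solution nontrivial. *)
have [T HT] : exists T, a T > 0.
  have h0 : 0 < 1 / 2 :> R by lra.
  have [T HT] := om_int_small (2 * M * (1 + 4 * expR (4 * M * pi))) h0; exists T.
  have [h _ _ _] := jost_asymptotic T Hq Hr Hj.
  by have := le_trans h (HT T (lexx _)); rewrite ler_norml => /andP[? _]; lra.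
have uT : 0 < u T by rewrite mulr_gt0 ?expR_gt0.
(* conj z psi(t) - e z conj psi(- t) solves the same equation. *)
have Hsym x y (e : R) : e ^+ 2 = 1 -> rayleigh_solution g
    (fun t => x * u t + y * v t - e * (x * u (- t) + y * v (- t)))
    (fun t => x * v t - y * u t - e * (y * u (- t) - x * v (- t)))
    (fun t => x * u1 t + y * v1 t + e * (x * u1 (- t) + y * v1 (- t)))
    (fun t => x * v1 t - y * u1 t + e * (y * u1 (- t) - x * v1 (- t))).
  move=> _ t; have [h1 h2 h3 h4] := Hsol t; have [k1 k2 k3 k4] := Hsol (- t).
  have opp (f : R -> R) (d : R) : is_derive (- t) (1 : R) f d -> is_derive t (1 : R) (fun t => f (- t)) (- d).
    move=> hf; have : is_derive t (1 : R) (f \o -%R) (d * -1) by exact: is_derive1_comp.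
    by rewrite mulrN1.
  move/opp: k1 => k1; move/opp: k2 => k2; move/opp: k3 => k3; move/opp: k4 => k4.
  rewrite rayleigh_reN rayleigh_imN in k3 k4.
  by split; apply: is_derive_eq; rewrite /GRing.scale /=; ring.
(* For z = psi(0) and e = 1, the combination has value 0 and derivative 2 Re(psi' conj psi)(0) = 0
   at the origin. If psi(0) = 0, take z = psi'(0) and e = -1. By uniqueness conj z psi(t) = e z conj
   psi(- t), which carries the decay at -oo over to +oo. *)
have [x [y [e [e1 xy Hz]]]] : exists x y e, [/\ e ^+ 2 = 1, 0 < x ^+ 2 + y ^+ 2 & forall t,
    [/\ x * u t + y * v t = e * (x * u (- t) + y * v (- t)),
        x * v t - y * u t = e * (y * u (- t) - x * v (- t)),
        x * u1 t + y * v1 t = - e * (x * u1 (- t) + y * v1 (- t)) &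
        x * v1 t - y * u1 t = - e * (y * u1 (- t) - x * v1 (- t))]].
  have fin x y e : (forall t, [/\ x * u t + y * v t - e * (x * u (- t) + y * v (- t)) = 0,
      x * v t - y * u t - e * (y * u (- t) - x * v (- t)) = 0,
      x * u1 t + y * v1 t + e * (x * u1 (- t) + y * v1 (- t)) = 0 &
      x * v1 t - y * u1 t + e * (y * u1 (- t) - x * v1 (- t)) = 0]) -> forall t,
      [/\ x * u t + y * v t = e * (x * u (- t) + y * v (- t)),
        x * v t - y * u t = e * (y * u (- t) - x * v (- t)),
        x * u1 t + y * v1 t = - e * (x * u1 (- t) + y * v1 (- t)) &
        x * v1 t - y * u1 t = - e * (y * u1 (- t) - x * v1 (- t))].
    by move=> h t; have [? ? ? ?] := h t; split; lra.
  have [z0|z0] := ltP 0 (u 0 ^+ 2 + v 0 ^+ 2).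
    exists (u 0), (v 0), 1; split => //; first by rewrite expr1n.
    apply: fin; apply: (rayleigh_uniqueness g0 (Hsym _ _ _ (expr1n _ _))); rewrite oppr0; lra.
  have s1 := sqr_ge0 (u 0); have s2 := sqr_ge0 (v 0).
  have u0 : u 0 = 0 by apply/eqP; rewrite -sqrf_eq0; apply/eqP; lra.
  have v0 : v 0 = 0 by apply/eqP; rewrite -sqrf_eq0; apply/eqP; lra.
  have [z1|z1] := ltP 0 (u1 0 ^+ 2 + v1 0 ^+ 2).
    have e1 : (-1) ^+ 2 = 1 :> R by rewrite sqrrN expr1n.
    exists (u1 0), (v1 0), (-1); split => //.
    apply: fin; apply: (rayleigh_uniqueness g0 (Hsym _ _ _ e1)); rewrite oppr0 ?u0 ?v0; lra.
  have s3 := sqr_ge0 (u1 0); have s4 := sqr_ge0 (v1 0).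
  have u10 : u1 0 = 0 by apply/eqP; rewrite -sqrf_eq0; apply/eqP; lra.
  have v10 : v1 0 = 0 by apply/eqP; rewrite -sqrf_eq0; apply/eqP; lra.
  by have [uT0 _ _ _] := rayleigh_uniqueness g0 Hsol u0 v0 u10 v10 T; rewrite uT0 ltxx in uT.
exists u, v, u1, v1; split => //; last by exists T; rewrite (gt_eqF uT).
set N := `|x| + `|y|.
have N0 : 0 <= N by rewrite addr_ge0.
pose K := 4 * N * N / (x ^+ 2 + y ^+ 2) * C + C.
have KC : C <= K.
  by rewrite lerDr; apply: mulr_ge0 => //; apply: divr_ge0 (ltW xy); do 2![apply: mulr_ge0 => //].
(* Multiplying by z undoes conj z up to the factor x^2 + y^2, by which [K] is divided. *)
have dec p r p' r' m (c : R) : `|c| = 1 -> 0 <= m ->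
    x * p + y * r = c * (x * p' + y * r') -> x * r - y * p = c * (y * p' - x * r') ->
    `|p'| <= C * m -> `|r'| <= C * m -> `|p| <= K * m /\ `|r| <= K * m.
  move=> c1 m0 h1 h2 hp hr.
  have Cm : 0 <= C * m by rewrite mulr_ge0.
  have w X Y f k : `|X| <= N -> `|Y| <= N -> `|f| <= C * m -> `|k| <= C * m ->
     `|X * f + Y * k| <= 2 * N * (C * m).
    move=> hX hY hf hk; rewrite (le_trans (ler_normD _ _))// !normrM.
    have := ler_pM (normr_ge0 _) (normr_ge0 _) hX hf.
    by have := ler_pM (normr_ge0 _) (normr_ge0 _) hY hk; lra.
  have hx : `|x| <= N by rewrite lerDl. have hy : `|y| <= N by rewrite lerDr.
  have hyN : `|- y| <= N by rewrite normrN. have hxN : `|- x| <= N by rewrite normrN.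
  have a1' : `|x * p + y * r| <= 2 * N * (C * m) by rewrite h1 normrM c1 mul1r; exact: w.
  have a2 : `|x * r - y * p| <= 2 * N * (C * m).
    by rewrite h2 normrM c1 mul1r -mulNr; exact: w.
  have s0 : x ^+ 2 + y ^+ 2 != 0 by rewrite gt_eqF.
  have key f : `|(x ^+ 2 + y ^+ 2) * f| <= 4 * N * N * (C * m) -> `|f| <= K * m.
    rewrite normrM (ger0_norm (ltW xy)) mulrC -ler_pdivlMr// => /le_trans; apply.
    have -> : K * m = 4 * N * N * (C * m) / (x ^+ 2 + y ^+ 2) + C * m by rewrite /K; field.
    by rewrite lerDl.
  have w2 X Y f k : `|X| <= N -> `|Y| <= N -> `|f| <= 2 * N * (C * m) -> `|k| <= 2 * N * (C * m) ->
     `|X * f + Y * k| <= 4 * N * N * (C * m).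
    move=> hX hY hf hk; rewrite (le_trans (ler_normD _ _))// !normrM.
    have := ler_pM (normr_ge0 _) (normr_ge0 _) hX hf.
    by have := ler_pM (normr_ge0 _) (normr_ge0 _) hY hk; lra.
  split; apply: key.
    rewrite (_ : _ * p = x * (x * p + y * r) + - y * (x * r - y * p)); last by ring.
    exact: w2.
  rewrite (_ : _ * r = y * (x * p + y * r) + x * (x * r - y * p)); last by ring.
  exact: w2.
exists K => t; have [h1 h2 h3 h4] := HC t; have [k1 k2 k3 k4] := HC (- t).
have [i1 i2 i3 i4] := Hz t.
have ne : `|e| = 1 by apply/eqP; rewrite -(@eqrXn2 _ 2)// ?expr1n -?normrX ?e1 ?normr1.
have ne' : `|- e| = 1 by rewrite normrN.
have ge m f : 0 <= m -> `|f| <= C * m -> `|f| <= K * m.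
  by move=> m0 /le_trans; apply; rewrite ler_wpM2r.
have [t0|t0] := leP 0 t.
  have m0 := expR_ge0 (- t).
  have [? ?] := dec _ _ _ _ _ _ ne m0 i1 i2 k1 k2.
  have [? ?] := dec _ _ _ _ _ _ ne' m0 i3 i4 k3 k4.
  by rewrite (ger0_norm t0); split.
by rewrite (ltr0_norm t0) opprK; split; apply: ge => //; exact: expR_ge0.
Qed.

End UnstableMode.

(** * Integration on R^3 *)

Section ProductMeasures.
Local Open Scope ereal_scope.
Context d1 d2 d3 (T1 : measurableType d1) (T2 : measurableType d2)
  (T3 : measurableType d3) (R : realType).
Variable m1 : {sigma_finite_measure set T1 -> \bar R}.
Variable m2 : {sigma_finite_measure set T2 -> \bar R}.
Variable m3 : {sigma_finite_measure set T3 -> \bar R}.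

Lemma product_sigma_finite : sigma_finite setT (m1 \x m2).
Proof.
have /sigma_finiteP[F [TF ndF Foo]] := sigma_finiteT m1.
have /sigma_finiteP[G [TG ndG Goo]] := sigma_finiteT m2.
exists (fun n => F n `*` G n).
  rewrite -setXTT TF TG predeqE => -[x y]; split.
    move=> [/= [n _ Fnx] [k _ Gky]]; exists (maxn n k) => //; split.
    - by move: x Fnx; exact/subsetPset/ndF/leq_maxl.
    - by move: y Gky; exact/subsetPset/ndG/leq_maxr.
  by move=> [n _ []/= ? ?]; split; exists n.
move=> k; have [? ?] := Foo k; have [? ?] := Goo k.
split; first exact: measurableX.
by rewrite product_measure1E// lte_mul_pinfty// ge0_fin_numE.
Qed.

(* The canonical sigma-finite structure of [m1 \x m2] is shadowed by the one for
   products of probabilities, hence the alias. *)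
Definition prodm : set (T1 * T2) -> \bar R := m1 \x m2.
HB.instance Definition _ := Measure.on prodm.
HB.instance Definition _ :=
  Measure_isSigmaFinite.Build _ _ _ prodm product_sigma_finite.

End ProductMeasures.

Section TripleProduct.
Local Open Scope ereal_scope.
Context d1 d2 d3 (T1 : measurableType d1) (T2 : measurableType d2)
  (T3 : measurableType d3) (R : realType).
Variable m1 : {sigma_finite_measure set T1 -> \bar R}.
Variable m2 : {sigma_finite_measure set T2 -> \bar R}.
Variable m3 : {sigma_finite_measure set T3 -> \bar R}.
Implicit Types f : T1 * T2 * T3 -> \bar R.

Lemma tonelli3 f : measurable_fun setT f -> (forall x, 0 <= f x) ->
  \int[(m1 \x m2) \x m3]_x f x = \int[m1]_x \int[m2]_y \int[m3]_z f (x, y, z).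
Proof.
move=> mf f0.
rewrite [LHS](@fubini_tonelli1 _ _ _ _ R (prodm m1 m2) m3 f mf f0).
have m' := @measurable_fun_fubini_tonelli_F _ _ _ _ R m3 f mf f0.
have f' x : 0 <= fubini_F m3 f x by apply: integral_ge0 => y _; exact: f0.
exact: (@fubini_tonelli1 _ _ _ _ R m1 m2 (fubini_F m3 f) m' f').
Qed.

Lemma fubini3_12 f : ((m1 \x m2) \x m3).-integrable setT f ->
  \int[(m1 \x m2) \x m3]_x f x = \int[m1 \x m2]_x \int[m3]_z f (x, z).
Proof. by move=> fi; rewrite -[LHS](@integral12_prod_meas1 _ _ _ _ R (prodm m1 m2) m3 f fi). Qed.

Lemma fubini3_21 f : ((m1 \x m2) \x m3).-integrable setT f ->
  \int[(m1 \x m2) \x m3]_x f x = \int[m3]_z \int[m1 \x m2]_x f (x, z).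
Proof. by move=> fi; rewrite -[LHS](@integral21_prod_meas1 _ _ _ _ R (prodm m1 m2) m3 f fi). Qed.

End TripleProduct.

Section MeasureR3.
Variable R : realType.
Local Notation R3 := (R * R * R)%type.
Local Notation mu := (@lebesgue_measure R).
Local Notation leb3 := (@leb3 R).

(** The sigma-algebra on triples is the product one, so an open set is written as a countable union
    of cubes with rational centres and half-sides. *)
Lemma open_measurable3 (U : set R3) : open U -> measurable U.
Proof.
move=> oU.
pose box (c : rat * rat * rat * rat) : set R3 :=
  `](ratr c.1.1.1 - ratr c.2)%R, (ratr c.1.1.1 + ratr c.2)%R[%classic `*`
  `](ratr c.1.1.2 - ratr c.2)%R, (ratr c.1.1.2 + ratr c.2)%R[%classic `*`
  `](ratr c.1.2 - ratr c.2)%R, (ratr c.1.2 + ratr c.2)%R[%classic.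
pose F c := if `[< box c `<=` U >] then box c else set0.
suff -> : U = \bigcup_c F c.
  apply: countable_bigcupT_measurable => // c; rewrite /F; case: ifP => // _.
  by apply: measurableX; [apply: measurableX|]; exact: measurable_itv.
apply/seteqP; split => [x Ux|x [c _]]; last first.
  by rewrite /F; case: asboolP => [H|//]; exact: H.
have /nbhs_ballP[e /= e0 He] : nbhs x U by exact: open_nbhs_nbhs.
have [r /[!in_itv]/= /andP[r0 re]] : exists r : rat, ratr r \in `]0, (e / 2) : R[.
  by apply: rat_in_itvoo; rewrite divr_gt0.
have ap (t : R) : exists q : rat, ratr q \in `]t - ratr r, (t + ratr r) : R[.
  by apply: rat_in_itvoo; lra.
have [q1 /[!in_itv]/= /andP[a1 b1]] := ap x.1.1.
have [q2 /[!in_itv]/= /andP[a2 b2]] := ap x.1.2.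
have [q3 /[!in_itv]/= /andP[a3 b3]] := ap x.2.
exists (q1, q2, q3, r) => //; rewrite /F asboolT.
  have inq (c y : R) : y - ratr r < c -> c < y + ratr r -> y \in `]c - ratr r, (c + ratr r)[.
    by move=> ? ?; rewrite in_itv/=; apply/andP; split; lra.
  by rewrite /box /=; split; [split|]; apply: inq.
have close (c u w : R) : u - ratr r < c -> c < u + ratr r ->
    c - ratr r < w < c + ratr r -> `|u - w| < e.
  by move=> ? ? /andP[? ?]; rewrite ltr_norml; apply/andP; split; lra.
move=> y [[]]; rewrite /= !in_itv/= => C1 C2 C3.
apply: He; split; [split|]; rewrite /ball /=.
- exact: close C1.
- exact: close C2.
- exact: close C3.
Qed.

Lemma continuous_measurable3 (f : R3 -> R) : continuous f -> measurable_fun setT f.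
Proof.
move=> /continuousP cf; apply: (measurability _ (RGenOpens.measurableE R)).
move=> _ [_ [a [b ->] <-]]; rewrite setTI; apply: open_measurable3.
exact/cf/interval_open.
Qed.

Lemma integral_om_scale (a : R) : 0 < a -> (\int[mu]_t (om (a * t))%:E = (pi / a)%:E)%E.
Proof.
move=> a0.
have HF (t : R) : is_derive t (1 : R) (fun t => a * t) a.
  by apply: is_derive_eq; rewrite /GRing.scale /= mulr1.
have dF : (fun t : R => a * t)^`()%classic = cst a.
  by apply/funext => t; rewrite derive1E; case: (HF t).
have := @increasing_ge0_integration_by_substitutionT R (fun t => a * t) (@om R).
rewrite dF integralT_om => H.
have {}H : (pi%:E = \int[mu]_x (om (a * x) * a)%:E)%E.
  apply: H.
  - by move=> x y xy; rewrite ltr_pM2l.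
  - exact: cst_continuous.
  - exact: is_cvg_cst.
  - exact: is_cvg_cst.
  - by move=> x; case: (HF x).
  - exact: gt0_cvgMrNy cvg_id.
  - exact: gt0_cvgMry cvg_id.
  - exact: om_continuous.
  - by move=> x; exact/ltW/om_gt0.
have mom : measurable_fun setT (fun t : R => (om (a * t))%:E).
  apply/measurable_EFinP; apply: continuous_measurable_fun => t.
  apply: continuous_comp; last exact: om_continuous.
  by apply: cvgM; [exact: cvg_cst|exact: cvg_id].
have {}H : (pi%:E = a%:E * \int[mu]_x (om (a * x))%:E)%E.
  rewrite -ge0_integralZl//; first last.
  - by rewrite lee_fin ltW.
  - by move=> t _; rewrite lee_fin ltW// om_gt0.
  by rewrite H; apply: eq_integral => x _; rewrite EFinM muleC.
rewrite EFinM muleC H muleA -EFinM mulVf ?mul1e// gt_eqF//.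
Qed.

(** The envelope of the packets: width 1/a in the two horizontal directions and width 1 across the
    shear, where the profiles decay by themselves. With a = 1 it also serves as integrable majorant
    of compactly supported functions. *)
Definition om3 (a : R) (x : R3) : R := om (a * x.1.1) * om x.1.2 * om (a * x.2).

Lemma om3_gt0 a x : 0 < om3 a x.
Proof. by rewrite !mulr_gt0 ?om_gt0. Qed.

Lemma fst_continuous (S T : topologicalType) : continuous (@fst S T).
Proof. by move=> x; exact: cvg_fst. Qed.

Lemma snd_continuous (S T : topologicalType) : continuous (@snd S T).
Proof. by move=> x; exact: cvg_snd. Qed.

Lemma om_scale_continuous a : continuous (fun t : R => om (a * t)).
Proof.
move=> t; apply: (continuous_comp (f := fun t => a * t)); last exact: om_continuous.
by apply: cvgM; [exact: cvg_cst|exact: cvg_id].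
Qed.

Lemma continuous_x1 (f : R -> R) : continuous f -> continuous (fun x : R3 => f x.1.1).
Proof.
move=> cf x; apply: (continuous_comp (f := fun x : R3 => x.1.1)); last exact: cf.
by apply: (continuous_comp (f := fst)); exact: fst_continuous.
Qed.

Lemma continuous_x2 (f : R -> R) : continuous f -> continuous (fun x : R3 => f x.1.2).
Proof.
move=> cf x; apply: (continuous_comp (f := fun x : R3 => x.1.2)); last exact: cf.
by apply: (continuous_comp (f := fst)); [exact: fst_continuous|exact: snd_continuous].
Qed.

Lemma continuous_x3 (f : R -> R) : continuous f -> continuous (fun x : R3 => f x.2).
Proof.
by move=> cf x; apply: (continuous_comp (f := snd)); [exact: snd_continuous|exact: cf].
Qed.

Lemma om3_continuous a : continuous (om3 a).
Proof.
move=> x; apply: cvgM; last exact: (continuous_x3 (@om_scale_continuous a)).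
apply: cvgM; first exact: (continuous_x1 (@om_scale_continuous a)).
exact: (continuous_x2 (@om_continuous R)).
Qed.

Lemma integral_om3 a : 0 < a ->
  (\int[leb3]_x (om3 a x)%:E = (pi / a * pi * (pi / a))%:E)%E.
Proof.
move=> a0.
have pa : 0 <= pi / a :> R by rewrite divr_ge0 ?pi_ge0// ltW.
have o0 (t : R) : (0 <= (om t)%:E)%E by rewrite lee_fin ltW// om_gt0.
have m1 b : measurable_fun setT (fun t : R => (om (b * t))%:E).
  by apply/measurable_EFinP; apply: continuous_measurable_fun; exact: om_scale_continuous.
have m0 : measurable_fun setT (fun t : R => (om t)%:E).
  by apply/measurable_EFinP; apply: continuous_measurable_fun; exact: om_continuous.
have m3 : measurable_fun setT (EFin \o om3 a).
  by apply/measurable_EFinP; apply: continuous_measurable3; exact: om3_continuous.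
have p3 x : (0 <= (EFin \o om3 a) x)%E by rewrite lee_fin ltW// om3_gt0.
rewrite [LHS](@tonelli3 _ _ _ _ _ _ R mu mu mu (EFin \o om3 a) m3 p3).
have E1 (x y : R) : (\int[mu]_z (EFin \o om3 a) (x, y, z) =
    (om (a * x))%:E * (om y)%:E * (pi / a)%:E)%E.
  by rewrite -(integral_om_scale a0) -ge0_integralZl ?mule_ge0//; exact: m1.
have E2 (x : R) : (\int[mu]_y \int[mu]_z (EFin \o om3 a) (x, y, z) =
    (om (a * x))%:E * (pi * (pi / a))%:E)%E.
  under eq_integral do rewrite E1.
  rewrite ge0_integralZr ?lee_fin//; first last.
  - by move=> y _; exact: mule_ge0.
  - by apply: emeasurable_funM => //; exact: m0.
  by rewrite ge0_integralZl// integralT_om [in RHS]EFinM muleA.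
under eq_integral do rewrite E2.
rewrite ge0_integralZr ?lee_fin ?mulr_ge0 ?pi_ge0 ?invr_ge0 ?(ltW a0)//; last exact: m1.
rewrite (integral_om_scale a0) -EFinM; congr (_%:E); ring.
Qed.

Lemma integrable_om3 a : 0 < a -> leb3.-integrable setT (EFin \o om3 a).
Proof.
move=> a0; apply/integrableP; split.
  by apply/measurable_EFinP; apply: continuous_measurable3; exact: om3_continuous.
under eq_integral do rewrite /= ger0_norm ?(ltW (om3_gt0 _ _))//.
by rewrite integral_om3// ltry.
Qed.

Lemma integral_derive_compact (h h' : R -> R) N :
  (forall t, is_derive t (1 : R) h (h' t)) -> continuous h' ->
  (forall t, N < `|t| -> h t = 0) -> (forall t, N < `|t| -> h' t = 0) ->
  (\int[mu]_t (h' t)%:E = 0)%E.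
Proof.
move=> dh ch' h0 h'0; pose M := `|N| + 1.
have M0 : 0 < M by rewrite ltr_wpDl.
have NM t : M <= `|t| -> N < `|t|.
  by move=> Mt; apply: lt_le_trans Mt; rewrite (le_lt_trans (ler_norm _))// ltrDl.
have ch : continuous h by exact: is_derive_continuous dh.
have -> : (\int[mu]_t (h' t)%:E = \int[mu]_(t in `[(- M)%R, M]) (h' t)%:E)%E.
  rewrite [RHS]integral_mkcond; apply: eq_integral => t _; rewrite patchE.
  case: ifPn => // tM; rewrite h'0//; apply: NM; rewrite leNgt; apply: contra tM.
  by rewrite ltr_norml => /andP[a b]; rewrite inE/= in_itv/= !ltW.
rewrite (@continuous_FTC2 _ h' h).
- by rewrite !h0 ?subee// NM// ?normrN ger0_norm// ltW.
- by rewrite (lt_trans _ M0)// oppr_lt0.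
- exact: continuous_subspaceT.
- split.
  + by move=> t _; case: (dh t).
  + exact/cvg_at_right_filter/ch.
  + exact/cvg_at_left_filter/ch.
- by move=> t _; rewrite derive1E; case: (dh t).
Qed.

Lemma integrable_om2 : (mu \x mu)%E.-integrable setT
  (fun x : R * R => (om x.1 * om x.2)%:E).
Proof.
have m2 : measurable_fun setT (fun x : R * R => (om x.1 * om x.2)%:E).
  apply/measurable_EFinP; apply: measurable_funM.
    apply: (measurableT_comp (f := @om R)) => //.
    by apply: continuous_measurable_fun; exact: om_continuous.
  apply: (measurableT_comp (f := @om R)) => //.
  by apply: continuous_measurable_fun; exact: om_continuous.
have p2 (x : R * R) : (0 <= (om x.1 * om x.2)%:E)%E.
  by rewrite lee_fin mulr_ge0// ltW// om_gt0.
have mo : measurable_fun setT (fun t : R => (om t)%:E).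
  by apply/measurable_EFinP; apply: continuous_measurable_fun; exact: om_continuous.
have o0 (t : R) : (0 <= (om t)%:E)%E by rewrite lee_fin ltW// om_gt0.
apply/integrableP; split; first exact: m2.
under eq_integral do rewrite gee0_abs//.
rewrite (@fubini_tonelli1 _ _ _ _ R mu mu _ m2 p2).
have E (x : R) : (fubini_F mu (fun x : R * R => (om x.1 * om x.2)%:E) x =
    (om x)%:E * pi%:E)%E.
  by rewrite -integralT_om -ge0_integralZl.
have -> : (\int[mu]_x fubini_F mu (fun x : R * R => (om x.1 * om x.2)%:E) x =
    \int[mu]_x ((om x)%:E * pi%:E))%E by apply: eq_integral => x _; exact: E.
by rewrite ge0_integralZr ?lee_fin ?pi_ge0// integralT_om -EFinM ltry.
Qed.

Lemma is_derive_line (f : R3 -> R) (x v : R3) (d t : R) :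
  is_derive (t *: v + x) v f d -> is_derive t (1 : R) (fun h => f (h *: v + x)) d.
Proof.
move=> [df fd].
have E : (fun h : R => h^-1 *: (f (h *: v + (t *: v + x)) - f (t *: v + x))) =
    (fun h : R => h^-1 *: (((fun h => f (h *: v + x)) \o shift t) (h *: (1 : R)) -
      (fun h => f (h *: v + x)) t)).
  by apply/funext => h /=; rewrite [h *: 1]mulr1 scalerDl addrA.
apply: DeriveDef; first by move: df; rewrite /derivable E.
by rewrite -fd /derive E.
Qed.

Lemma line_is_derive (f : R3 -> R) (x v : R3) (d : R) :
  is_derive (0 : R) (1 : R) (fun h => f (h *: v + x)) d -> is_derive x v f d.
Proof.
move=> [df fd].
have E : (fun h : R => h^-1 *: (((fun h => f (h *: v + x)) \o shift 0) (h *: (1 : R)) -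
      (fun h => f (h *: v + x)) 0)) =
    (fun h : R => h^-1 *: (f (h *: v + x) - f x)).
  by apply/funext => h /=; rewrite [h *: 1]mulr1 addr0 scale0r add0r.
apply: DeriveDef; first by move: df; rewrite /derivable E.
by rewrite -fd /derive E.
Qed.

Lemma is_derive_x1 (f : R3 -> R) (x y z d : R) :
  is_derive ((x, y, z) : R3) ((1, 0, 0) : R3) f d ->
  is_derive x (1 : R) (fun t => f (t, y, z)) d.
Proof.
move=> df; have E (t : R) : (t, y, z) = t *: ((1, 0, 0) : R3) + (0, y, z).
  by congr (_, _, _); rewrite /= ?[t *: _]mulr1 ?[t *: _]mulr0 ?addr0 ?add0r.
have -> : (fun t => f (t, y, z)) = (fun t => f (t *: ((1, 0, 0) : R3) + (0, y, z))).
  by apply/funext => t; rewrite E.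
by apply: is_derive_line; rewrite -E.
Qed.

Lemma is_derive_x2 (f : R3 -> R) (x y z d : R) :
  is_derive ((x, y, z) : R3) ((0, 1, 0) : R3) f d ->
  is_derive y (1 : R) (fun t => f (x, t, z)) d.
Proof.
move=> df; have E (t : R) : (x, t, z) = t *: ((0, 1, 0) : R3) + (x, 0, z).
  by congr (_, _, _); rewrite /= ?[t *: _]mulr1 ?[t *: _]mulr0 ?addr0 ?add0r.
have -> : (fun t => f (x, t, z)) = (fun t => f (t *: ((0, 1, 0) : R3) + (x, 0, z))).
  by apply/funext => t; rewrite E.
by apply: is_derive_line; rewrite -E.
Qed.

Lemma is_derive_x3 (f : R3 -> R) (x y z d : R) :
  is_derive ((x, y, z) : R3) ((0, 0, 1) : R3) f d ->
  is_derive z (1 : R) (fun t => f (x, y, t)) d.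
Proof.
move=> df; have E (t : R) : (x, y, t) = t *: ((0, 0, 1) : R3) + (x, y, 0).
  by congr (_, _, _); rewrite /= ?[t *: _]mulr1 ?[t *: _]mulr0 ?addr0 ?add0r.
have -> : (fun t => f (x, y, t)) = (fun t => f (t *: ((0, 0, 1) : R3) + (x, y, 0))).
  by apply/funext => t; rewrite E.
by apply: is_derive_line; rewrite -E.
Qed.

End MeasureR3.

(** * Integrals of partial derivatives over R^3 *)

Section PartialIntegration.
Variable R : realType.
Local Notation R3 := (R * R * R)%type.
Local Notation mu := (@lebesgue_measure R).
Local Notation leb3 := (@leb3 R).

Lemma dominated_integrable3 (f g : R3 -> R) : continuous f ->
  (forall x, `|f x| <= g x) -> leb3.-integrable setT (EFin \o g) ->
  leb3.-integrable setT (EFin \o f).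
Proof.
move=> cf fg ig.
have mf : measurable_fun setT (EFin \o f).
  by apply/measurable_EFinP; exact: continuous_measurable3.
have H := @le_integrable _ _ R leb3 setT measurableT (EFin \o f) (EFin \o g).
apply: H.
exact: mf.
move=> x _ /=; rewrite lee_fin; apply: le_trans (fg x) _; exact: ler_norm.
exact: ig.
Qed.

Lemma continuous_pair (S T U : topologicalType) (f : S -> T) (g : S -> U) :
  continuous f -> continuous g -> continuous (fun x => (f x, g x)).
Proof.
move=> cf cg x.
exact: (@cvg_pair _ _ _ (nbhs x) (nbhs (f x)) (nbhs (g x)) _ _ _ f g (cf x) (cg x)).
Qed.

Lemma continuous_id (T : topologicalType) : continuous (fun x : T => x).
Proof. by move=> x; exact: cvg_id. Qed.

Lemma continuous_slice1 (f : R3 -> R) y z : continuous f -> continuous (fun t => f (t, y, z)).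
Proof.
move=> cf t; apply: (continuous_comp (f := fun t => (t, y, z))); last exact: cf.
exact: (continuous_pair (continuous_pair (@continuous_id _) (@cst_continuous _ _ y)) (@cst_continuous _ _ z)).
Qed.

Lemma continuous_slice2 (f : R3 -> R) x z : continuous f -> continuous (fun t => f (x, t, z)).
Proof.
move=> cf t; apply: (continuous_comp (f := fun t => (x, t, z))); last exact: cf.
exact: (continuous_pair (continuous_pair (@cst_continuous _ _ x) (@continuous_id _)) (@cst_continuous _ _ z)).
Qed.

Lemma continuous_slice3 (f : R3 -> R) x y : continuous f -> continuous (fun t => f (x, y, t)).
Proof.
move=> cf t; apply: (continuous_comp (f := fun t => (x, y, t))); last exact: cf.
exact: (continuous_pair (@cst_continuous _ _ (x, y)) (@continuous_id _)).
Qed.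

Lemma integral_partial_compact (i : 'I_3) (g g' : R3 -> R) (C N : R) :
  (forall x, is_derive x (basis3 R i) g (g' x)) -> continuous g' ->
  (forall x, `|g' x| <= C * om3 1 x) ->
  (forall x, N < `|x| -> g x = 0) -> (forall x, N < `|x| -> g' x = 0) ->
  (\int[leb3]_x (g' x)%:E = 0)%E.
Proof.
move=> dg cg' bg g0 g'0.
have ig' : leb3.-integrable setT (EFin \o g').
  apply: (dominated_integrable3 cg' bg).
  exact: (@integrableZl _ _ R leb3 setT measurableT C (EFin \o om3 1) (integrable_om3 ltr01)).
have mg' : measurable_fun setT (EFin \o g').
  by apply/measurable_EFinP; exact: continuous_measurable3.
have N1 (x : R3) : N < `|x.1.1| -> N < `|x|.
  by move=> Nx; apply: lt_le_trans Nx _; rewrite /= !prod_normE le_max le_max lexx.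
have N2 (x : R3) : N < `|x.1.2| -> N < `|x|.
  by move=> Nx; apply: lt_le_trans Nx _; rewrite /= !prod_normE le_max le_max lexx orbT.
have N3 (x : R3) : N < `|x.2| -> N < `|x|.
  by move=> Nx; apply: lt_le_trans Nx _; rewrite /= !prod_normE le_max lexx orbT.
have sl z : (mu \x mu)%E.-integrable setT (fun x : R * R => (g' (x, z))%:E).
  apply: (@le_integrable _ _ R (mu \x mu)%E setT measurableT _
    (fun x : R * R => (C%:E * (om x.1 * om x.2)%:E)%E)).
  - exact: (measurable_fun_pair1 z mg').
  - move=> x _ /=; rewrite lee_fin; apply: le_trans (bg (x, z)) _.
    rewrite (le_trans (ler_norm _))// !normrM ler_wpM2l// /om3 /= !mul1r.
    by rewrite -!normrM ger0_norm ?mulr_ge0 ?(ltW (om_gt0 _))// ler_normr ler_piMr ?om_le1 ?mulr_ge0 ?(ltW (om_gt0 _)).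
  - exact: (@integrableZl _ _ R (mu \x mu)%E setT measurableT C _ (@integrable_om2 R)).
move: i dg => [[|[|[|//]]] i3] dg.
- rewrite [LHS](fubini3_21 ig'); apply: integral0_eq => z _ /=.
  rewrite -[LHS](@integral21_prod_meas1 _ _ _ _ R mu mu _ (sl z)).
  apply: integral0_eq => y _ /=.
  apply: (@integral_derive_compact R (fun t => g (t, y, z)) (fun t => g' (t, y, z)) N).
  + by move=> t; apply: is_derive_x1; exact: dg.
  + exact: continuous_slice1.
  + by move=> t Nt; exact/g0/N1.
  + by move=> t Nt; exact/g'0/N1.
- rewrite [LHS](fubini3_21 ig'); apply: integral0_eq => z _ /=.
  rewrite -[LHS](@integral12_prod_meas1 _ _ _ _ R mu mu _ (sl z)).
  apply: integral0_eq => x _ /=.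
  apply: (@integral_derive_compact R (fun t => g (x, t, z)) (fun t => g' (x, t, z)) N).
  + by move=> t; apply: is_derive_x2; exact: dg.
  + exact: continuous_slice2.
  + by move=> t Nt; exact/g0/N2.
  + by move=> t Nt; exact/g'0/N2.
- rewrite [LHS](fubini3_12 ig'); apply: integral0_eq => -[x y] _ /=.
  apply: (@integral_derive_compact R (fun t => g (x, y, t)) (fun t => g' (x, y, t)) N).
  + by move=> t; apply: is_derive_x3; exact: dg.
  + exact: continuous_slice3.
  + by move=> t Nt; exact/g0/N3.
  + by move=> t Nt; exact/g'0/N3.
Qed.

End PartialIntegration.

(** * Agreement of classical and distributional derivatives *)

Section WeakCalculus.
Variable R : realType.
Local Notation R3 := (R * R * R)%type.
Local Notation leb3 := (@leb3 R).
Local Open Scope complex_scope.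

Lemma om3_neq0 a (x : R3) : om3 a x != 0.
Proof. by rewrite gt_eqF// om3_gt0. Qed.

(** The quotient by the positive function [om3] is continuous, hence bounded on the compact set. *)
Lemma compact_dominated (K : set R3) (f : R3 -> R) : compact K -> continuous f ->
  (forall x, ~ K x -> f x = 0) -> exists C, forall x, `|f x| <= C * om3 1 x.
Proof.
move=> cK cf f0; pose h x := f x / om3 1 x.
have ch : continuous h.
  by move=> x; apply: cvgM; [exact: cf|apply: cvgV; [exact: om3_neq0|exact: om3_continuous]].
have : compact (h @` K) by apply: continuous_compact => //; exact: continuous_subspaceT.
move=> /compact_bounded[M [_ HM]].
have bM : 0 <= `|M| + 1 by rewrite addr_ge0.
exists (`|M| + 1) => x; have [Kx|nKx] := pselect (K x).
  have /= : `|h x| <= `|M| + 1.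
    by apply: HM; [rewrite (le_lt_trans (ler_norm _))// ltrDl|exists x].
  by rewrite /h normrM normfV (ger0_norm (ltW (om3_gt0 1 x))) ler_pdivrMr ?om3_gt0.
by rewrite f0// normr0 mulr_ge0// ltW// om3_gt0.
Qed.

Lemma dominated_om3_integrable (f : R3 -> R) C : continuous f ->
  (forall x, `|f x| <= C * om3 1 x) -> leb3.-integrable setT (EFin \o f).
Proof.
move=> cf bf; apply: (dominated_integrable3 cf bf).
exact: (@integrableZl _ _ R leb3 setT measurableT C (EFin \o om3 1) (integrable_om3 ltr01)).
Qed.

Lemma test_derive (phi : R3 -> R) i x : test_function phi ->
  is_derive x (basis3 R i) phi (partial i phi x).
Proof. by move=> [/(_ 1%N)[_ /(_ i)[d _]] _]; apply: DeriveDef. Qed.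

Lemma test_continuous (phi : R3 -> R) : test_function phi -> continuous phi.
Proof. by move=> [/(_ 1%N)[]]. Qed.

Lemma test_partial_continuous (phi : R3 -> R) i :
  test_function phi -> continuous (partial i phi).
Proof. by move=> [/(_ 1%N)[_ /(_ i)[_ []]]]. Qed.

Lemma test_support (phi : R3 -> R) : test_function phi ->
  exists K : set R3, [/\ compact K, forall x, ~ K x -> phi x = 0 &
    forall i x, ~ K x -> partial i phi x = 0].
Proof.
move=> [_ cK]; exists (closure [set x | phi x != 0]).
have p0 x : ~ closure [set x | phi x != 0] x -> phi x = 0.
  by move=> Kx; apply/eqP/negPn/negP => px; exact/Kx/subset_closure.
split => // i x Kx.
have /near_eq_derive E : \forall y \near x, phi y = (cst 0 : R3 -> R) y.
  have H : nbhs x (~` closure [set x | phi x != 0]).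
    by apply: open_nbhs_nbhs; split => //; apply: closed_openC; exact: closed_closure.
  by apply: filterS H => y; exact: p0.
by rewrite /partial E derive_cst.
Qed.

Lemma integrable_test (f phi : R3 -> R) : continuous f -> test_function phi ->
  leb3.-integrable setT (EFin \o (fun x => f x * phi x)).
Proof.
move=> cf tp; have [K [cK p0 _]] := test_support tp.
have c : continuous (fun x => f x * phi x).
  by move=> x; apply: cvgM; [exact: cf|exact: test_continuous].
have [|C HC] := compact_dominated cK c; last exact: dominated_om3_integrable HC.
by move=> x /p0 ->; rewrite mulr0.
Qed.

Lemma integrable_test_partial i (f phi : R3 -> R) : continuous f -> test_function phi ->
  leb3.-integrable setT (EFin \o (fun x => f x * partial i phi x)).
Proof.
move=> cf tp; have [K [cK _ p0]] := test_support tp.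
have c : continuous (fun x => f x * partial i phi x).
  by move=> x; apply: cvgM; [exact: cf|exact: test_partial_continuous].
have [|C HC] := compact_dominated cK c; last exact: dominated_om3_integrable HC.
by move=> x /p0 ->; rewrite mulr0.
Qed.

(** The derivative of the compactly supported product f phi integrates to 0. *)
Lemma partial_integration i (f f' phi : R3 -> R) : continuous f -> continuous f' ->
  (forall x, is_derive x (basis3 R i) f (f' x)) -> test_function phi ->
  \int[leb3]_x (f x * partial i phi x) = - \int[leb3]_x (f' x * phi x).
Proof.
move=> cf cf' df tp; have [K [cK p0 p'0]] := test_support tp.
have cp := test_continuous tp; have cp' := test_partial_continuous (i := i) tp.
pose g x := f x * phi x; pose g' x := f x * partial i phi x + f' x * phi x.
have cg' : continuous g'.
  by move=> x; apply: cvgD; apply: cvgM; [exact: cf|exact: cp'|exact: cf'|exact: cp].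
have dg x : is_derive x (basis3 R i) g (g' x).
  have d1 := df x; have d2 := test_derive i x tp.
  by apply: is_derive_eq; rewrite /g' /GRing.scale /= [phi x * _]mulrC.
have g0 x : ~ K x -> g x = 0 by move=> /p0 E; rewrite /g E mulr0.
have g'0 x : ~ K x -> g' x = 0.
  by move=> Kx; rewrite /g' p0// p'0// !mulr0 addr0.
have [C HC] := compact_dominated cK cg' g'0.
have [M [_ HM]] := compact_bounded cK.
have KN x : M + 1 < `|x| -> ~ K x.
  have M1 : M < M + 1 by rewrite ltrDl.
  by move=> Nx /(HM _ M1)/= /le_lt_trans/(_ Nx); rewrite ltxx.
have I0 : \int[leb3]_x g' x = 0.
  rewrite /Rintegral.
  by rewrite (integral_partial_compact dg cg' HC (fun x h => g0 x (KN x h))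
    (fun x h => g'0 x (KN x h))).
apply/eqP; rewrite -subr_eq0 opprK -I0 /g'; apply/eqP/esym.
exact: (@RintegralD _ _ R leb3 setT _ _ measurableT
  (integrable_test_partial i cf tp) (integrable_test cf' tp)).
Qed.

Definition ccontinuous (T : topologicalType) (F : T -> R[i]) :=
  continuous (fun x => complex.Re (F x)) /\ continuous (fun x => complex.Im (F x)).

Definition cpartial (i : 'I_3) (F F' : R3 -> R[i]) := forall x,
  is_derive x (basis3 R i) (fun x => complex.Re (F x)) (complex.Re (F' x)) /\
  is_derive x (basis3 R i) (fun x => complex.Im (F x)) (complex.Im (F' x)).

Lemma ReM_real (z : R[i]) (r : R) : complex.Re (z * r%:C) = complex.Re z * r.
Proof. by case: z => a b /=; rewrite mulr0 subr0. Qed.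

Lemma ImM_real (z : R[i]) (r : R) : complex.Im (z * r%:C) = complex.Im z * r.
Proof. by case: z => a b /=; rewrite mulr0 add0r. Qed.

Lemma cintegral_real (F : R3 -> R[i]) (phi : R3 -> R) :
  cintegral (fun x => F x * (phi x)%:C) =
  (\int[leb3]_x (complex.Re (F x) * phi x)) +i* (\int[leb3]_x (complex.Im (F x) * phi x)).
Proof.
by rewrite /cintegral; congr (_ +i* _); apply: eq_Rintegral => x _; rewrite (ReM_real, ImM_real).
Qed.

Lemma dpartial_dfun i (F F' : R3 -> R[i]) phi : ccontinuous F -> ccontinuous F' ->
  cpartial i F F' -> test_function phi -> dpartial i (dfun F) phi = dfun F' phi.
Proof.
move=> [c1 c2] [c1' c2'] dF tp; rewrite /dpartial /dfun !cintegral_real.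
rewrite (partial_integration c1 c1' (fun x => (dF x).1) tp).
rewrite (partial_integration c2 c2' (fun x => (dF x).2) tp).
by apply/eqP; rewrite eq_complex /= !opprK !eqxx.
Qed.

Lemma dfunD (F G : R3 -> R[i]) phi : ccontinuous F -> ccontinuous G ->
  test_function phi -> dfun F phi + dfun G phi = dfun (fun x => F x + G x) phi.
Proof.
move=> [c1 c2] [d1 d2] tp; rewrite /dfun !cintegral_real.
apply/eqP; rewrite eq_complex /=; apply/andP; split; apply/eqP.
- rewrite -(@RintegralD _ _ R leb3 setT _ _ measurableT
    (integrable_test c1 tp) (integrable_test d1 tp)).
  by apply: eq_Rintegral => x _; case: (F x) (G x) => a b [c d] /=; rewrite mulrDl.
- rewrite -(@RintegralD _ _ R leb3 setT _ _ measurableT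
    (integrable_test c2 tp) (integrable_test d2 tp)).
  by apply: eq_Rintegral => x _; case: (F x) (G x) => a b [c d] /=; rewrite mulrDl.
Qed.

Lemma dfunN (F : R3 -> R[i]) phi : ccontinuous F ->
  test_function phi -> - dfun F phi = dfun (fun x => - F x) phi.
Proof.
move=> [c1 c2] tp; rewrite /dfun !cintegral_real.
apply/eqP; rewrite eq_complex /=; apply/andP; split; apply/eqP.
- rewrite -mulN1r -(@RintegralZl _ _ R leb3 setT _ _ measurableT (integrable_test c1 tp)).
  by apply: eq_Rintegral => x _; case: (F x) => a b /=; rewrite mulN1r mulNr.
- rewrite -mulN1r -(@RintegralZl _ _ R leb3 setT _ _ measurableT (integrable_test c2 tp)).
  by apply: eq_Rintegral => x _; case: (F x) => a b /=; rewrite mulN1r mulNr.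
Qed.

Lemma dfun0 (phi : R3 -> R) : dfun (fun=> 0) phi = 0.
Proof.
rewrite /dfun; have -> : (fun x => 0 * (phi x)%:C) = (fun=> 0).
  by apply/funext => x; rewrite mul0r.
by rewrite /cintegral /= /Rintegral integral0.
Qed.

End WeakCalculus.

(** * Profiles of the wave packets *)

Section ComplexDerivative.
Variable R : realType.
Local Open Scope complex_scope.
Local Notation normc := Normc.normc.
Implicit Types f g : R -> R[i].

Definition cder f f' := forall t,
  is_derive t (1 : R) (fun t => complex.Re (f t)) (complex.Re (f' t)) /\
  is_derive t (1 : R) (fun t => complex.Im (f t)) (complex.Im (f' t)).

Lemma cderD f g f' g' : cder f f' -> cder g g' ->
  cder (fun t => f t + g t) (fun t => f' t + g' t).
Proof.
move=> df dg t; have [d1 d2] := df t; have [d3 d4] := dg t.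
have -> : (fun t => complex.Re (f t + g t)) = (fun t => complex.Re (f t) + complex.Re (g t)).
  by apply/funext => s; case: (f s) (g s) => a b [c d].
have -> : (fun t => complex.Im (f t + g t)) = (fun t => complex.Im (f t) + complex.Im (g t)).
  by apply/funext => s; case: (f s) (g s) => a b [c d].
by split; apply: is_derive_eq; case: (f' t) (g' t) => a b [c d].
Qed.

Lemma ReM (z w : R[i]) : complex.Re (z * w) =
  complex.Re z * complex.Re w - complex.Im z * complex.Im w.
Proof. by case: z w => a b [c d]. Qed.

Lemma ImM (z w : R[i]) : complex.Im (z * w) =
  complex.Re z * complex.Im w + complex.Im z * complex.Re w.
Proof. by case: z w => a b [c d]. Qed.

Lemma ReD (z w : R[i]) : complex.Re (z + w) = complex.Re z + complex.Re w.
Proof. by case: z w => a b [c d]. Qed.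

Lemma ImD (z w : R[i]) : complex.Im (z + w) = complex.Im z + complex.Im w.
Proof. by case: z w => a b [c d]. Qed.

Lemma cderM f g f' g' : cder f f' -> cder g g' ->
  cder (fun t => f t * g t) (fun t => f' t * g t + f t * g' t).
Proof.
move=> df dg t; have [d1 d2] := df t; have [d3 d4] := dg t.
have -> : (fun t => complex.Re (f t * g t)) = (fun t => complex.Re (f t) * complex.Re (g t)
    - complex.Im (f t) * complex.Im (g t)) by apply/funext => s; rewrite ReM.
have -> : (fun t => complex.Im (f t * g t)) = (fun t => complex.Re (f t) * complex.Im (g t)
    + complex.Im (f t) * complex.Re (g t)) by apply/funext => s; rewrite ImM.
by split; apply: is_derive_eq; rewrite ?ReD ?ImD ?ReM ?ImM /GRing.scale /=; ring.
Qed.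

Lemma cder_cst (c : R[i]) : cder (fun=> c) (fun=> 0).
Proof. by move=> t; split; exact: is_derive_cst. Qed.

Lemma cder_real (h h' : R -> R) : (forall t, is_derive t (1 : R) h (h' t)) ->
  cder (fun t => (h t)%:C) (fun t => (h' t)%:C).
Proof. by move=> dh t; split; [exact: dh|exact: is_derive_cst]. Qed.

Lemma cderZ (c : R[i]) f f' : cder f f' -> cder (fun t => c * f t) (fun t => c * f' t).
Proof.
move=> df; have := cderM (cder_cst c) df.
by rewrite (_ : (fun t => 0 * f t + c * f' t) = (fun t => c * f' t))//;
  apply/funext => t; rewrite mul0r add0r.
Qed.

Lemma cder_scale (a : R) f f' : cder f f' ->
  cder (fun t => f (a * t)) (fun t => a%:C * f' (a * t)).
Proof.
move=> df t; have [d1 d2] := df (a * t).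
have da : is_derive t (1 : R) (fun t => a * t) a.
  by apply: is_derive_eq; rewrite /GRing.scale /= mulr1.
split.
- have := @is_derive1_comp R (fun t => complex.Re (f t)) (fun t => a * t) t _ _ d1 da.
  by move/is_derive_eq; apply; rewrite ReM /GRing.scale /= mul0r subr0 mulrC.
- have := @is_derive1_comp R (fun t => complex.Im (f t)) (fun t => a * t) t _ _ d2 da.
  by move/is_derive_eq; apply; rewrite ImM /GRing.scale /= mul0r addr0 mulrC.
Qed.

Lemma cder_ccontinuous f f' : cder f f' -> ccontinuous f.
Proof.
by move=> df; split; apply: is_derive_continuous => t; [exact: (df t).1|exact: (df t).2].
Qed.

(** The successive derivatives are quantified existentially rather than named, so that closure under
    sums and products follows by induction from the Leibniz rule. *)
Fixpoint regular (B : (R -> R[i]) -> Prop) k f : Prop :=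
  B f /\ if k is k'.+1 then exists2 f', cder f f' & regular B k' f' else True.

Lemma regular_pred B k f : regular B k.+1 f -> regular B k f.
Proof.
elim: k f => [|k IH] f [Bf [f' df rf']]; split => //.
by exists f' => //; exact: IH.
Qed.

Lemma regular_bound B k f : regular B k f -> B f.
Proof. by case: k => [|k] []. Qed.

Lemma regularD B k f g : (forall f g, B f -> B g -> B (fun t => f t + g t)) ->
  regular B k f -> regular B k g -> regular B k (fun t => f t + g t).
Proof.
move=> BD; elim: k f g => [|k IH] f g [Bf]; first by move=> _ [Bg _]; split; [exact: BD|].
move=> [f' df rf'] [Bg [g' dg rg']]; split; first exact: BD.
by exists (fun t => f' t + g' t); [exact: cderD|exact: IH].
Qed.

Lemma regularM B1 B2 B3 k f g :
  (forall f g, B3 f -> B3 g -> B3 (fun t => f t + g t)) ->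
  (forall f g, B1 f -> B2 g -> B3 (fun t => f t * g t)) ->
  regular B1 k f -> regular B2 k g -> regular B3 k (fun t => f t * g t).
Proof.
move=> BD BM; elim: k f g => [|k IH] f g [Bf]; first by move=> _ [Bg _]; split; [exact: BM|].
move=> [f' df rf'] [Bg [g' dg rg']]; split; first exact: BM.
exists (fun t => f' t * g t + f t * g' t); first exact: cderM.
apply: regularD => //; apply: IH => //.
- by apply: regular_pred; split => //; exists g'.
- by apply: regular_pred; split => //; exists f'.
Qed.

(** A total operator, so that jets can be written as iterates; by [cDE] it agrees with any
    derivative already exhibited. *)
Definition cD f : R -> R[i] := fun t =>
  (derive1 (fun t => complex.Re (f t)) t) +i* (derive1 (fun t => complex.Im (f t)) t).

Lemma cDE f f' : cder f f' -> cD f = f'.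
Proof.
move=> df; apply/funext => t; have [[_ a] [_ b]] := df t.
by apply/eqP; rewrite eq_complex /= !derive1E a b !eqxx.
Qed.

Lemma regular_iter B f n : (forall k, regular B k f) ->
  cder (iter n cD f) (iter n.+1 cD f) /\ B (iter n cD f).
Proof.
move=> rf; have : forall k, regular B k (iter n cD f).
  elim: n => [//|n IH] k; have /= [_ [f' df rf']] := IH k.+1.
  by rewrite (cDE df).
move=> rn; split; last exact: regular_bound (rn 0%N).
by have /= [_ [f' df _]] := rn 1%N; rewrite (cDE df).
Qed.

End ComplexDerivative.

(** * Classes of exponential growth and decay *)

Section GrowthClasses.
Variable R : realType.
Local Open Scope complex_scope.
Local Notation normc := Normc.normc.
Implicit Types f g : R -> R[i].

Lemma normc_ge0 (z : R[i]) : 0 <= normc z.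
Proof. by case: z => a b; exact: sqrtr_ge0. Qed.

Lemma normc_real (r : R) : normc r%:C = `|r|.
Proof. by rewrite /= expr0n addr0 sqrtr_sqr. Qed.

Lemma normc_le (z : R[i]) : normc z <= `|complex.Re z| + `|complex.Im z|.
Proof.
case: z => a b /=; rewrite -(@ler_pXn2r _ 2)// ?nnegrE ?sqrtr_ge0 ?addr_ge0//.
rewrite sqr_sqrtr ?addr_ge0 ?sqr_ge0// sqrrD !real_normK ?num_real//.
by rewrite -addrA lerD2l -subr_ge0 addrK mulrn_wge0// mulr_ge0.
Qed.

(* Growth at most exp((a + 0)|t|): polynomial factors do not matter. *)
Definition egrowth (a : R) f := forall d, 0 < d ->
  exists C, forall t, normc (f t) <= C * expR ((a + d) * `|t|).

Lemma egrowthD a f g : egrowth a f -> egrowth a g -> egrowth a (fun t => f t + g t).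
Proof.
move=> ef eg d d0; have [C HC] := ef d d0; have [C' HC'] := eg d d0.
by exists (C + C') => t; rewrite mulrDl (le_trans (le_normcD _ _))// lerD.
Qed.

Lemma egrowthM a b f g : egrowth a f -> egrowth b g ->
  egrowth (a + b) (fun t => f t * g t).
Proof.
move=> ef eg d d0; have d2 : 0 < d / 2 by rewrite divr_gt0.
have [C HC] := ef _ d2; have [C' HC'] := eg _ d2.
exists (C * C') => t; rewrite Normc.normcM.
have -> : (a + b + d) * `|t| = (a + d / 2) * `|t| + (b + d / 2) * `|t| by field.
by rewrite expRD mulrACA ler_pM ?normc_ge0.
Qed.

Lemma egrowth_bounded f C : (forall t, normc (f t) <= C) -> egrowth 0 f.
Proof.
move=> fC d d0; exists C => t; apply: le_trans (fC t) _.
have C0 : 0 <= C by apply: le_trans (fC 0); exact: normc_ge0.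
by rewrite ler_peMr// -[leLHS]expR0 ler_expR add0r mulr_ge0// ltW.
Qed.

Lemma egrowth_id : egrowth 0 (fun t : R => t%:C).
Proof.
move=> d d0; exists d^-1 => t; rewrite normc_real mulrC ler_pdivlMr// add0r mulrC.
by apply: le_trans (expR_ge1Dx _); rewrite lerDr.
Qed.

Lemma egrowth_scale a b f : 0 < b -> egrowth a f -> egrowth (a * b) (fun t => f (b * t)).
Proof.
move=> b0 ef d d0; have [C HC] := ef (d / b) (divr_gt0 d0 b0).
exists C => t; apply: le_trans (HC _) _; rewrite normrM (gtr0_norm b0).
by rewrite mulrA mulrDl divfK// gt_eqF.
Qed.

Lemma egrowth_om a f : a < 0 -> egrowth a f ->
  exists C, forall t, normc (f t) <= C * om t.
Proof.
(* Half of the rate is spent on the loss allowed by [egrowth]; the remaining rate b = - a / 2 beats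
   the weight through 1 + (b t / 2)^2 <= exp(b |t|). *)
move=> a0 ef; have b0 : 0 < - a / 2 by rewrite divr_gt0// oppr_gt0.
have [C HC] := ef _ b0; set b := - a / 2 in b0 HC.
have C0 : 0 <= C.
  by have := le_trans (normc_ge0 _) (HC 0); rewrite normr0 mulr0 expR0 mulr1.
have k0 : 0 < 1 + (b / 2) ^- 2 by rewrite ltr_pwDl// invr_ge0 sqr_ge0.
exists (C * (1 + (b / 2) ^- 2)) => t; apply: le_trans (HC t) _.
rewrite -mulrA ler_wpM2l//.
have -> : (a + b) * `|t| = - (b / 2 * `|t| + b / 2 * `|t|) by rewrite /b; field.
rewrite expRN /om ler_pdivlMr ?ltr_pwDl ?sqr_ge0//.
rewrite mulrC ler_pdivrMr ?expR_gt0// expRD.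
have e1 := expR_ge1Dx (b / 2 * `|t|).
have bt : 0 <= b / 2 * `|t| by rewrite mulr_ge0// divr_ge0// ltW.
have e2 : 1 + (b / 2 * `|t|) ^+ 2 <= expR (b / 2 * `|t|) * expR (b / 2 * `|t|).
  apply: (@le_trans _ _ ((1 + b / 2 * `|t|) * (1 + b / 2 * `|t|))); first by nra.
  by rewrite ler_pM// addr_ge0.
apply: (le_trans _ (ler_wpM2l (ltW k0) e2)).
have b20 : (b / 2) ^+ 2 != 0 by rewrite expf_neq0// gt_eqF// divr_gt0.
move: b20; set c := b / 2; clear; move=> c0.
rewrite (exprMn 2 c) real_normK ?num_real// -subr_ge0.
have -> : (1 + c ^- 2) * (1 + c ^+ 2 * t ^+ 2) - (1 + t ^+ 2) =
    c ^+ 2 * t ^+ 2 + c ^- 2.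
  by field; move: c0; rewrite expf_eq0.
by apply: addr_ge0; rewrite ?invr_ge0 ?sqr_ge0// -exprMn sqr_ge0.
Qed.

(** Coefficients such as polynomials in t and D. Multiplying by them does not change the rate of
    [decaying] functions, so every profile inherits the rate of the mode. *)
Definition slow f := forall k, regular (egrowth 0) k f.
Definition decaying a f := forall k, regular (egrowth a) k f.

Lemma slowD f g : slow f -> slow g -> slow (fun t => f t + g t).
Proof. by move=> sf sg k; apply: regularD => //; exact: egrowthD. Qed.

Lemma slowM f g : slow f -> slow g -> slow (fun t => f t * g t).
Proof.
move=> sf sg k; apply: (@regularM R (egrowth 0) (egrowth 0)) => //; first exact: egrowthD.
by move=> f1 g1 ef eg; have := egrowthM ef eg; rewrite addr0.
Qed.

Lemma decayingD a f g : decaying a f -> decaying a g -> decaying a (fun t => f t + g t).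
Proof. by move=> sf sg k; apply: regularD => //; exact: egrowthD. Qed.

Lemma decayingM a f g : slow f -> decaying a g -> decaying a (fun t => f t * g t).
Proof.
move=> sf sg k; apply: (@regularM R (egrowth 0) (egrowth a)) => //; first exact: egrowthD.
by move=> f1 g1 ef eg; have := egrowthM ef eg; rewrite add0r.
Qed.

Lemma slow_cst (c : R[i]) : slow (fun=> c).
Proof.
move=> k; elim: k c => [|k IH] c; split => //; first exact: (@egrowth_bounded _ (normc c)).
  exact: (@egrowth_bounded _ (normc c)).
by exists (fun=> 0) => //; exact: cder_cst.
Qed.

Lemma slow_id : slow (fun t : R => t%:C).
Proof.
case=> [|k]; split => //; [exact: egrowth_id|exact: egrowth_id|].
exists (fun=> 1); last exact: slow_cst.
by move=> t; split; [exact: is_derive_id|exact: is_derive_cst].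
Qed.

Lemma decaying_scale a b f : 0 < b -> decaying a f -> decaying (a * b) (fun t => f (b * t)).
Proof.
move=> b0 df k; elim: k f df => [|k IH] f df.
  by have [ef _] := df 0%N; split => //; exact: egrowth_scale.
split; first by apply: egrowth_scale => //; exact: regular_bound (df 0%N).
exists (fun t => b%:C * (cD f) (b * t)).
  by apply: cder_scale; have [] := @regular_iter _ _ f 0 df.
apply: (@regularM R (egrowth 0) (egrowth (a * b))); last 2 first.
- exact: slow_cst.
- apply: IH => j.
  by have /= [_ [f' df' rf']] := df j.+1; rewrite (cDE df').
- exact: egrowthD.
- by move=> f1 g1 ef eg; have := egrowthM ef eg; rewrite add0r.
Qed.

End GrowthClasses.

(** * Profiles of the mode, its pressure and the correctors *)

Section ModeProfiles.
Variable R : realType.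
Local Open Scope complex_scope.
Local Notation normc := Normc.normc.
Local Notation D := (@dawson R).

(** [d0] to [d3] are D and its first three derivatives, all expressed through t and D by means of D'
    = 1 - 2 t D. *)
Let s1 (t : R) : R[i] := t%:C.
Let d0 t : R[i] := (D t)%:C.
Let d1 t := 1 - 2 * s1 t * d0 t.
Let d2 t := - 2 * d0 t - 2 * s1 t * d1 t.
Let d3 t := - 4 * d1 t - 2 * s1 t * d2 t.

Lemma cder_id : cder s1 (fun=> 1).
Proof. by move=> t; split; [exact: is_derive_id|exact: is_derive_cst]. Qed.

Lemma dawson_der_real t : (1 - 2 * t * D t)%:C = d1 t.
Proof. by rewrite rmorphB rmorph1 (rmorphM _ (2 * t)) (rmorphM _ 2) rmorph_nat. Qed.

Lemma cder_d0 : cder d0 d1.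
Proof.
have := cder_real (@is_derive_dawson R).
by rewrite (funext dawson_der_real).
Qed.

Lemma cder_d1 : cder d1 d2.
Proof.
have H := cderD (cder_cst 1) (cderZ (- 2) (cderM cder_id cder_d0)).
have E1 : (fun t => 1 + - 2 * (s1 t * d0 t)) = d1 by apply/funext => t; rewrite /d1; ring.
have E2 : (fun t => 0 + - 2 * (1 * d0 t + s1 t * d1 t)) = d2.
  by apply/funext => t; rewrite /d2; ring.
by rewrite E1 E2 in H.
Qed.

Lemma cder_d2 : cder d2 d3.
Proof.
have H := cderD (cderZ (- 2) cder_d0) (cderZ (- 2) (cderM cder_id cder_d1)).
have E1 : (fun t => - 2 * d0 t + - 2 * (s1 t * d1 t)) = d2.
  by apply/funext => t; rewrite /d2; ring.
have E2 : (fun t => - 2 * d1 t + - 2 * (1 * d1 t + s1 t * d2 t)) = d3.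
  by apply/funext => t; rewrite /d3; ring.
by rewrite E1 E2 in H.
Qed.

(** D is bounded and its equation expresses D' through D with a slow coefficient, which closes the
    induction on the order. *)
Lemma slow_d0 : slow d0.
Proof.
have b0 : egrowth 0 d0.
  by apply: (@egrowth_bounded _ _ 1) => t; rewrite normc_real dawson_norm_le1.
elim=> [|k IH]; split => //; exists d1; first exact: cder_d0.
have E : d1 = (fun t => 1 + (- 2 * s1 t) * d0 t) by apply/funext => t; rewrite /d1; ring.
rewrite E; apply: regularD; [exact: egrowthD|exact: slow_cst|].
apply: (@regularM R (egrowth 0) (egrowth 0)); first exact: egrowthD.
- by move=> f g ef eg; have := egrowthM ef eg; rewrite addr0.
- by apply: slowM; [exact: slow_cst|exact: slow_id].
- exact: IH.
Qed.

Lemma slow_d1 : slow d1.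
Proof.
have E : d1 = (fun t => 1 + (- 2 * s1 t) * d0 t) by apply/funext => t; rewrite /d1; ring.
rewrite E; apply: slowD; first exact: slow_cst.
by apply: slowM; [apply: slowM; [exact: slow_cst|exact: slow_id]|exact: slow_d0].
Qed.

Lemma slow_d2 : slow d2.
Proof.
have E : d2 = (fun t => (- 2) * d0 t + (- 2 * s1 t) * d1 t) by apply/funext => t; rewrite /d2; ring.
rewrite E; apply: slowD; apply: slowM; [exact: slow_cst|exact: slow_d0| |exact: slow_d1].
by apply: slowM; [exact: slow_cst|exact: slow_id].
Qed.

Lemma slow_d3 : slow d3.
Proof.
have E : d3 = (fun t => (- 4) * d1 t + (- 2 * s1 t) * d2 t) by apply/funext => t; rewrite /d3; ring.
rewrite E; apply: slowD; apply: slowM; [exact: slow_cst|exact: slow_d1| |exact: slow_d2].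
by apply: slowM; [exact: slow_cst|exact: slow_id].
Qed.

Section Mode.
Variables (g : R) (u v u1 v1 : R -> R) (C : R).
Hypothesis g0 : 0 < g.
Hypothesis sol : rayleigh_solution g u v u1 v1.
Hypothesis decay : forall t, [/\ `|u t| <= C * expR (- `|t|), `|v t| <= C * expR (- `|t|),
  `|u1 t| <= C * expR (- `|t|) & `|v1 t| <= C * expR (- `|t|)].

Let den t : R := (D t ^+ 2 + g ^+ 2)^-1.
Let den1 t : R[i] := (den t)%:C.
Let ig : R[i] := 0 +i* g.
Let psi t : R[i] := u t +i* v t.
Let psi1 t : R[i] := u1 t +i* v1 t.

Lemma ig2 : ig ^+ 2 = - (g ^+ 2)%:C.
Proof. by rewrite expr2; apply/eqP; rewrite eq_complex /= expr2; apply/andP; split; apply/eqP; ring. Qed.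

Lemma den1E t : (d0 t ^+ 2 + (g ^+ 2)%:C) * den1 t = 1.
Proof.
rewrite /d0 /den1 -rmorphXn -rmorphD -rmorphM /den mulfV ?rmorph1//.
by rewrite gt_eqF// rayleigh_den_gt0.
Qed.

Lemma cder_den1 : cder den1 (fun t => - (2 * d0 t * d1 t) * (den1 t * den1 t)).
Proof.
have H t : is_derive t (1 : R) den (- (2 * D t * (1 - 2 * t * D t)) * (den t * den t)).
  pose N t := D t ^+ 2 + g ^+ 2; have dD := is_derive_dawson t.
  have n0 : N t != 0 by rewrite gt_eqF// rayleigh_den_gt0.
  have dN : is_derive t (1 : R) N (2 * D t * (1 - 2 * t * D t)).
    by apply: is_derive_eq; rewrite /GRing.scale /=; ring.
  have -> : den = (fun t => (N t)^-1) by [].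
  apply: is_derive_eq; rewrite /GRing.scale /=.
  by rewrite -/(N t); field; exact: n0.
have := cder_real H; set F := (X in cder _ X -> _).
suff -> : F = (fun t => - (2 * d0 t * d1 t) * (den1 t * den1 t)) by [].
apply/funext => t; rewrite /F (rmorphM _ (- _)) rmorphN (rmorphM _ (den t)) (rmorphM _ (2 * D t)).
congr (- (_ * _) * (_ * _)); last exact: dawson_der_real.
by rewrite (rmorphM _ 2) rmorph_nat.
Qed.

Lemma slow_den1 : slow den1.
Proof.
have b0 : egrowth 0 den1.
  apply: (@egrowth_bounded _ _ (g ^- 2)) => t; rewrite normc_real /den.
  rewrite ger0_norm ?invr_ge0 ?(ltW (rayleigh_den_gt0 g0 t))//.
  by rewrite lef_pV2 ?posrE ?rayleigh_den_gt0 ?exprn_gt0// lerDr sqr_ge0.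
elim=> [|k IH]; split => //; eexists; first exact: cder_den1.
have M0 : forall f1 f2 : R -> R[i], egrowth 0 f1 -> egrowth 0 f2 -> egrowth 0 (fun t => f1 t * f2 t).
  by move=> f1 f2 ef eg; have := egrowthM ef eg; rewrite addr0.
apply: (@regularM R (egrowth 0) (egrowth 0)) => //; first exact: egrowthD.
- have -> : (fun t => - (2 * d0 t * d1 t)) = (fun t => (- 2 * d0 t) * d1 t).
    by apply/funext => t; ring.
  by apply: slowM; [apply: slowM; [exact: slow_cst|exact: slow_d0]|exact: slow_d1].
- by apply: (@regularM R (egrowth 0) (egrowth 0)) => //; exact: egrowthD.
Qed.

(** This is 1 + D'' / (D - i gamma), with the denominator made real. *)
Let coef t := 1 + d2 t * (d0 t + ig) * den1 t.

Lemma coef_eq t : (d0 t - ig) * (coef t - 1) = d2 t.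
Proof.
have -> : (d0 t - ig) * (coef t - 1) = d2 t * ((d0 t ^+ 2 - ig ^+ 2) * den1 t).
  by rewrite /coef; ring.
by rewrite ig2 opprK den1E mulr1.
Qed.

Lemma slow_coef : slow coef.
Proof.
apply: slowD; first exact: slow_cst.
apply: slowM slow_den1; apply: slowM; first exact: slow_d2.
by apply: slowD; [exact: slow_d0|exact: slow_cst].
Qed.

Lemma cder_psi : cder psi psi1.
Proof. by move=> t; have [a b _ _] := sol t. Qed.

Lemma coef_rayleigh t : coef t = (1 + rayleigh_re g t) +i* rayleigh_im g t.
Proof.
have D2 : d2 t = (qz t * D t)%:C.
  have -> : qz t * D t = - 2 * D t - 2 * t * (1 - 2 * t * D t).
    have E := dratioM t; rewrite /qz.
    have -> : (4 * t ^+ 2 - 2 - 2 * dratio t) * D t =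
      (4 * t ^+ 2 - 2) * D t - 2 * (dratio t * D t) by ring.
    by rewrite E; ring.
  rewrite rmorphB (rmorphM _ (- 2)) (rmorphM _ (2 * t)) (rmorphM _ 2 t).
  rewrite rmorphN !rmorph_nat /d2; congr (_ - _ * _); exact/esym/dawson_der_real.
rewrite /coef D2 /d0 /den1 /ig; apply/eqP; rewrite eq_complex /rayleigh_re /rayleigh_im /=.
by apply/andP; split; apply/eqP; rewrite -/(den t); ring.
Qed.

Lemma cder_psi1 : cder psi1 (fun t => coef t * psi t).
Proof.
move=> t; have [_ _ a b] := sol t; rewrite coef_rayleigh /=; split; first exact: a.
exact: b.
Qed.

(** The system psi' = [psi1], [psi1]' = [coef] psi has slow coefficients, so the decay of psi and
    psi' passes to all derivatives. *)
Lemma decaying_mode : decaying (-1) psi /\ decaying (-1) psi1.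
Proof.
have eg (a b : R -> R) : (forall t, `|a t| <= C * expR (- `|t|)) ->
    (forall t, `|b t| <= C * expR (- `|t|)) -> egrowth (-1) (fun t => a t +i* b t).
  move=> Ha Hb e e_gt0; exists (C + C) => t; apply: le_trans (normc_le _) _ => /=.
  rewrite mulrDl; apply: lerD.
    apply: le_trans (Ha t) _; rewrite ler_wpM2l//; last by rewrite ler_expR; have := normr_ge0 t; nra.
    by have := le_trans (normr_ge0 _) (Ha 0); rewrite normr0 oppr0 expR0 mulr1.
  apply: le_trans (Hb t) _; rewrite ler_wpM2l//; last by rewrite ler_expR; have := normr_ge0 t; nra.
  by have := le_trans (normr_ge0 _) (Ha 0); rewrite normr0 oppr0 expR0 mulr1.
have e0 : egrowth (-1) psi by apply: eg => t; have [] := decay t.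
have e1 : egrowth (-1) psi1 by apply: eg => t; have [] := decay t.
suff H k : regular (egrowth (-1)) k psi /\ regular (egrowth (-1)) k psi1.
  by split => k; have [] := H k.
elim: k => [//|k [r0 r1]]; split; split => //.
- by exists psi1; first exact: cder_psi.
- exists (fun t => coef t * psi t); first exact: cder_psi1.
  apply: (@regularM R (egrowth 0) (egrowth (-1))); first exact: egrowthD.
  + by move=> f1 f2 ef eg'; have := egrowthM ef eg'; rewrite add0r.
  + exact: slow_coef.
  + exact: r0.
Qed.

(** Up to a factor, the pressure of the mode. Rayleigh's equation is equivalent to Pi' = (D - i
    gamma) psi. *)
Let Pi t := (d0 t - ig) * psi1 t - d1 t * psi t.
Let Pi1 t := (d0 t - ig) * psi t.
Let Pi2 t := Pi t + 2 * d1 t * psi t.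

Lemma cder_Pi : cder Pi Pi1.
Proof.
have H := cderD (cderM (cderD cder_d0 (cder_cst (- ig))) cder_psi1)
  (cderZ (-1) (cderM cder_d1 cder_psi)).
set F := (X in cder X _) in H; set F' := (X in cder _ X) in H.
have EF : F = Pi by apply/funext => t; rewrite /F /Pi; ring.
have EF' : F' = Pi1.
  apply/funext => t; rewrite /F' /Pi1.
  transitivity ((d0 t - ig) * psi t + ((d0 t - ig) * (coef t - 1) - d2 t) * psi t); first by ring.
  by rewrite coef_eq; ring.
by rewrite -EF -EF'.
Qed.

Lemma cder_Pi1 : cder Pi1 Pi2.
Proof.
have H := cderM (cderD cder_d0 (cder_cst (- ig))) cder_psi.
set F' := (X in cder _ X) in H.
by have <- : F' = Pi2 by apply/funext => t; rewrite /F' /Pi2 /Pi; ring.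
Qed.

(** Two quotients have to be regular: Q / D' and (Pi / 2 - Q'' / 4) / D'. The factor D'^2 settles
    the first. For the second, wherever D' = 0 one has s D'' = -1, so that there Q'' = 2 s^2 D''^2
    Pi = 2 Pi and the numerator vanishes too. *)
Let Q t := s1 t ^+ 2 * d1 t ^+ 2 * Pi t.
Let Q1 t := (2 * s1 t * d1 t ^+ 2 + 2 * s1 t ^+ 2 * d1 t * d2 t) * Pi t
  + s1 t ^+ 2 * d1 t ^+ 2 * Pi1 t.
Let Q2 t := (2 * d1 t ^+ 2 + 8 * s1 t * d1 t * d2 t + 2 * s1 t ^+ 2 * d2 t ^+ 2
    + 2 * s1 t ^+ 2 * d1 t * d3 t) * Pi t
  + 2 * (2 * s1 t * d1 t ^+ 2 + 2 * s1 t ^+ 2 * d1 t * d2 t) * Pi1 t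
  + s1 t ^+ 2 * d1 t ^+ 2 * Pi2 t.

Lemma cder_Q : cder Q Q1.
Proof.
have H := cderM (cderM (cderM cder_id cder_id) (cderM cder_d1 cder_d1)) cder_Pi.
set F := (X in cder X _) in H; set F' := (X in cder _ X) in H.
have EF : F = Q by apply/funext => t; rewrite /F /Q; ring.
have EF' : F' = Q1 by apply/funext => t; rewrite /F' /Q1; ring.
by rewrite -EF -EF'.
Qed.

Lemma cder_Q1 : cder Q1 Q2.
Proof.
have S := cderM cder_id cder_id; have SD := cderM S cder_d1.
have H := cderD (cderM (cderZ 2 (cderD (cderM cder_id (cderM cder_d1 cder_d1)) (cderM SD cder_d2))) cder_Pi)
   (cderM (cderM SD cder_d1) cder_Pi1).
set F := (X in cder X _) in H; set F' := (X in cder _ X) in H.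
have EF : F = Q1 by apply/funext => t; rewrite /F /Q1; ring.
have EF' : F' = Q2 by apply/funext => t; rewrite /F' /Q2; ring.
by rewrite -EF -EF'.
Qed.

Let h : R[i] := 2^-1.
(* (Pi / 2 - Q'' / 4) / D': although D' vanishes, the quotient is regular thanks
   to s D'' = D' - 1 - 2 s^2 D'. *)
Let A t := - h * ((d1 t + 4 * s1 t * d2 t - 2 * (1 - 2 * s1 t ^+ 2)
    + d1 t * (1 - 2 * s1 t ^+ 2) ^+ 2 + s1 t ^+ 2 * d3 t) * Pi t
  + 2 * (s1 t * d1 t + s1 t ^+ 2 * d2 t) * Pi1 t + h * s1 t ^+ 2 * d1 t * Pi2 t).

Lemma profile_A t : h * Pi t - h ^+ 2 * Q2 t = d1 t * A t.
Proof.
have E : s1 t * d2 t = d1 t - 1 - 2 * s1 t ^+ 2 * d1 t by rewrite /d2 /d1; ring.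
have E2 : s1 t ^+ 2 * d2 t ^+ 2 = (1 - (1 - 2 * s1 t ^+ 2) * d1 t) ^+ 2.
  by rewrite -exprMn E; ring.
have -> : Q2 t = (2 * d1 t ^+ 2 + 8 * s1 t * d1 t * d2 t
    + 2 * (1 - (1 - 2 * s1 t ^+ 2) * d1 t) ^+ 2
    + 2 * s1 t ^+ 2 * d1 t * d3 t) * Pi t
  + 2 * (2 * s1 t * d1 t ^+ 2 + 2 * s1 t ^+ 2 * d1 t * d2 t) * Pi1 t
  + s1 t ^+ 2 * d1 t ^+ 2 * Pi2 t by rewrite -E2 /Q2; ring.
by rewrite /A /h; field.
Qed.

Variable beta : R.
Let b : R := 2^-1.
Let hU y := (beta * D (b * y))%:C.
Let hU' y := (beta / 2 * (1 - 2 * (b * y) * D (b * y)))%:C.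
Let bc : R[i] := beta%:C.

Let bE : b%:C = h.
Proof. by rewrite /b /h fmorphV rmorph_nat. Qed.

Let hUE y : hU y = bc * d0 (b * y).
Proof. by rewrite /hU rmorphM. Qed.

Let hU'E y : hU' y = bc * h * d1 (b * y).
Proof. rewrite /hU' rmorphM (rmorphM _ beta); congr (_ * _ * _); first exact: bE.
exact: dawson_der_real. Qed.

Lemma decaying_half f : decaying (-1) f -> decaying (- 2^-1) (fun y => f (b * y)).
Proof.
by have -> : - 2^-1 = -1 * b; [rewrite mulN1r|apply: decaying_scale; rewrite invr_gt0].
Qed.

Lemma packet_profiles_of_mode : (exists t, (u t != 0) || (v t != 0)) ->
  exists f P A B Q : R -> R[i],
  [/\ [/\ decaying (- 2^-1) f, decaying (- 2^-1) P, decaying (- 2^-1) A,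
          decaying (- 2^-1) B & decaying (- 2^-1) Q],
      forall y, P y = (hU y - bc * ig) * cD f y - hU' y * f y,
      forall y, cD P y = 4^-1 * (hU y - bc * ig) * f y /\
        cD (cD P) y = 4^-1 * P y + 2^-1 * hU' y * f y,
      forall y, P y - cD (cD Q) y = 2 * hU' y * A y /\ Q y = - 2 * hU' y * B y &
      exists y, f y != 0].
Proof.
move=> [t0 nz]; have [dpsi dpsi1] := decaying_mode.
have dPi : decaying (-1) Pi.
  have -> : Pi = (fun t => (d0 t + - ig) * psi1 t + ((- 1) * d1 t) * psi t).
    by apply/funext => t; rewrite /Pi; ring.
  apply: decayingD; apply: decayingM => //.
  - by apply: slowD; [exact: slow_d0|exact: slow_cst].
  - by apply: slowM; [exact: slow_cst|exact: slow_d1].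
have dPi1 : decaying (-1) Pi1.
  by apply: decayingM => //; apply: slowD; [exact: slow_d0|exact: slow_cst].
have dPi2 : decaying (-1) Pi2.
  apply: decayingD => //; apply: decayingM => //.
  by apply: slowM; [exact: slow_cst|exact: slow_d1].
have sl := @slow_cst R; have s2 : slow (fun t => s1 t ^+ 2) by apply: slowM; exact: slow_id.
have s4 : slow (fun t => 1 + (- 2) * s1 t ^+ 2) by apply: slowD; [|apply: slowM].
have dA : decaying (-1) A.
  have -> : A = (fun t => - h * (((d1 t + (4 * s1 t) * d2 t + (- 2) * (1 + (- 2) * s1 t ^+ 2)
    + d1 t * ((1 + (- 2) * s1 t ^+ 2) * (1 + (- 2) * s1 t ^+ 2)) + s1 t ^+ 2 * d3 t) * Pi t
    + (2 * (s1 t * d1 t + s1 t ^+ 2 * d2 t)) * Pi1 t) + ((h * s1 t ^+ 2) * d1 t) * Pi2 t)).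
    by apply/funext => t; rewrite /A; ring.
  apply: decayingM => //; apply: decayingD; [apply: decayingD|]; apply: decayingM => //.
  - apply: slowD; [apply: slowD; [apply: slowD; [apply: slowD; [exact: slow_d1|]|]|]|].
    + by apply: slowM; [apply: slowM; [|exact: slow_id]|exact: slow_d2].
    + exact: slowM.
    + by apply: slowM; [exact: slow_d1|exact: slowM].
    + by apply: slowM; [|exact: slow_d3].
  - apply: slowM => //; apply: slowD; apply: slowM => //; first exact: slow_id.
    + exact: slow_d1.
    + exact: slow_d2.
  - by apply: slowM; [exact: slowM|exact: slow_d1].
have d2' : slow (fun t => d1 t ^+ 2) by apply: slowM; exact: slow_d1.
(* Under s = y / 2 the expression (U - c) f' - U' f becomes beta / 2 times [Pi], and the fourth
   profile is the last one divided by - 2 U' = - beta D'. *)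
exists (fun y => psi (b * y)), (fun y => bc * h * Pi (b * y)), (fun y => A (b * y)),
  (fun y => - s1 (b * y) ^+ 2 * d1 (b * y) * Pi (b * y)), (fun y => bc * Q (b * y)).
have c1 := cDE (cderZ (bc * h) (cder_scale b cder_Pi)).
have c2 := cDE (cderZ (bc * h) (cderZ b%:C (cder_scale b cder_Pi1))).
have c3 := cDE (cderZ bc (cder_scale b cder_Q)).
have c4 := cDE (cderZ bc (cderZ b%:C (cder_scale b cder_Q1))).
have c0 := cDE (cder_scale b cder_psi).
rewrite c0 c1 c2 c3 c4; split.
- split; last 2 first.
  + apply: (@decaying_half (fun t => - s1 t ^+ 2 * d1 t * Pi t)); apply: decayingM => //.
    apply: slowM; last exact: slow_d1.
    by have := slowM (sl (-1)) s2; under eq_fun do rewrite mulN1r.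
  + apply: decayingM => //; apply: (@decaying_half Q); apply: decayingM => //.
    exact: slowM.
  + exact: decaying_half.
  + by apply: decayingM => //; exact: decaying_half.
  + exact: decaying_half.
- move=> y; rewrite hUE hU'E bE /Pi; ring.
- move=> y; rewrite hUE hU'E bE /Pi2 /Pi1; split; by rewrite /h; field.
- move=> y; rewrite hU'E bE /Q; split; last by rewrite /h; field.
  have := profile_A (b * y); set X := A _ => HX.
  transitivity (2 * bc * h * (d1 (b * y) * X)); last by ring.
  by rewrite -HX /h; field.
- exists (2 * t0); rewrite /b mulKf ?pnatr_eq0// eq_complex /=.
  by rewrite negb_and.
Qed.

End Mode.

Lemma packet_profiles (beta : R) : exists2 g, 0 < g & exists f P A B Q : R -> R[i],
  let U y := (beta * D (2^-1 * y))%:C in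
  let U' y := (beta / 2 * (1 - 2 * (2^-1 * y) * D (2^-1 * y)))%:C in
  [/\ [/\ decaying (- 2^-1) f, decaying (- 2^-1) P, decaying (- 2^-1) A,
          decaying (- 2^-1) B & decaying (- 2^-1) Q],
      forall y, P y = (U y - beta%:C * (0 +i* g)) * cD f y - U' y * f y,
      forall y, cD P y = 4^-1 * (U y - beta%:C * (0 +i* g)) * f y /\
        cD (cD P) y = 4^-1 * P y + 2^-1 * U' y * f y,
      forall y, P y - cD (cD Q) y = 2 * U' y * A y /\ Q y = - 2 * U' y * B y &
      exists y, f y != 0].
Proof.
have [g g0 [u [v [u1 [v1 [sol [C dec] nz]]]]]] := unstable_mode R.
exists g => //; have := packet_profiles_of_mode g0 sol dec beta nz; exact.
Qed.
End ModeProfiles.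

(** * Slowly modulated carrier waves *)

Section HorizontalWave.
Variable R : realType.
Local Open Scope complex_scope.
Local Notation normc := Normc.normc.
Implicit Types f : R -> R[i].

Definition dominated (w : R -> R) f := exists C, forall t, normc (f t) <= C * w t.

Lemma dominatedD w f g : dominated w f -> dominated w g -> dominated w (fun t => f t + g t).
Proof.
move=> [C HC] [C' HC']; exists (C + C') => t.
by rewrite mulrDl (le_trans (le_normcD _ _))// lerD.
Qed.

Lemma dominatedM w f g : dominated (cst 1) f -> dominated w g -> dominated w (fun t => f t * g t).
Proof.
move=> [C HC] [C' HC']; exists (C * C') => t; rewrite Normc.normcM.
have -> : C * C' * w t = C * cst 1 t * (C' * w t) by rewrite /= mulr1 mulrA.
by rewrite ler_pM ?normc_ge0.
Qed.

Let om1 (t : R) : R[i] := (om t)%:C.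
Let tom (t : R) : R[i] := (t * om t)%:C.

Lemma tom_le1 (t : R) : `|t * om t| <= 1.
Proof.
rewrite normrM (ger0_norm (ltW (om_gt0 t))) /om ler_pdivrMr; last by nra.
by rewrite mul1r ler_norml; apply/andP; split; nra.
Qed.

Lemma cder_om1 : cder om1 (fun t => - 2 * tom t * om1 t).
Proof.
have H : forall t, is_derive t (1 : R) (@om R) (- (2) * (t * om t) * om t).
  by move=> t; apply: (is_derive_eq (is_derive_om t)); rewrite expr2; ring.
have := cder_real H; set F := (X in cder _ X -> _).
suff -> : F = (fun t => - 2 * tom t * om1 t) by [].
by apply/funext => t; rewrite /F rmorphM (rmorphM _ (- (2))) rmorphN rmorph_nat.
Qed.

Lemma cder_tom : cder tom (fun t => om1 t + - 2 * (tom t * tom t)).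
Proof.
have H : forall t, is_derive t (1 : R) (fun t => t * om t) (om t + - (2) * (t * om t * (t * om t))).
  move=> t; have d := is_derive_om t.
  by apply: is_derive_eq; rewrite /GRing.scale /=; ring.
have := cder_real H; set F := (X in cder _ X -> _).
suff -> : F = (fun t => om1 t + - 2 * (tom t * tom t)) by [].
apply/funext => t; rewrite /F rmorphD (rmorphM _ (- (2))) (rmorphM _ (t * om t)).
by rewrite rmorphN rmorph_nat.
Qed.

(** [om] and t [om] generate an algebra closed under differentiation: om' = - 2 (t om) om and (t
    om)' = om - 2 (t om)^2. Both generators are bounded. *)
Lemma regular_bounded k :
  regular (dominated (cst 1)) k om1 /\ regular (dominated (cst 1)) k tom.
Proof.
have b1 : dominated (cst 1) om1.
  by exists 1 => t; rewrite normc_real mulr1 ger0_norm ?om_le1// ltW// om_gt0.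
have b2 : dominated (cst 1) tom.
  by exists 1 => t; rewrite normc_real mulr1 tom_le1.
have bc (c : R[i]) j : regular (dominated (cst 1)) j (fun=> c).
  elim: j c => [|j IH] c; split => //; try by exists (normc c) => t; rewrite mulr1.
  by exists (fun=> 0) => //; exact: cder_cst.
have bD := @dominatedD (cst 1); have bM := @dominatedM (cst 1).
elim: k => [//|k [r1 r2]]; split; split => //.
- exists (fun t => - 2 * tom t * om1 t); first exact: cder_om1.
  by apply: (regularM bD bM) => //; exact: (regularM bD bM).
- exists (fun t => om1 t + - 2 * (tom t * tom t)); first exact: cder_tom.
  apply: (regularD bD) => //; apply: (regularM bD bM) => //; exact: (regularM bD bM).
Qed.

(** By om' = - 2 (t om) om, differentiation multiplies the cutoff by functions that are bounded with
    all their derivatives. *)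
Lemma regular_om k : regular (dominated (@om R)) k om1.
Proof.
have b1 : dominated (@om R) om1.
  by exists 1 => t; rewrite normc_real mul1r ger0_norm// ltW// om_gt0.
elim: k => [//|k IH]; split => //.
exists (fun t => - 2 * tom t * om1 t); first exact: cder_om1.
apply: (regularM (@dominatedD _) (@dominatedM _) _ IH).
have bD := @dominatedD (cst 1); have bM := @dominatedM (cst 1).
apply: (regularM bD bM); last exact: (regular_bounded k).2.
have bc (c : R[i]) j : regular (dominated (cst 1)) j (fun=> c).
  elim: j c => [|j IH'] c; split => //; try by exists (normc c) => t; rewrite mulr1.
  by exists (fun=> 0) => //; exact: cder_cst.
exact: bc.
Qed.

Definition om_jet n : R -> R[i] := iter n (@cD R) om1.

Lemma cder_om_jet n : cder (om_jet n) (om_jet n.+1).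
Proof. exact: (regular_iter n regular_om).1. Qed.

Lemma om_jet_dominated n : dominated (@om R) (om_jet n).
Proof. exact: (regular_iter n regular_om).2. Qed.

Definition carrier (a t : R) : R[i] := cos (a * t) +i* sin (a * t).

Lemma cder_carrier a : cder (carrier a) (fun t => (0 +i* a) * carrier a t).
Proof.
move=> t; have da : is_derive t (1 : R) (fun t => a * t) a.
  by apply: is_derive_eq; rewrite /GRing.scale /= mulr1.
split => /=.
- have := @is_derive1_comp R (@cos R) (fun t => a * t) t _ _ (is_derive_cos _) da.
  by move/is_derive_eq; apply; rewrite /GRing.scale /=; ring.
- have := @is_derive1_comp R (@sin R) (fun t => a * t) t _ _ (is_derive_sin _) da.
  by move/is_derive_eq; apply; rewrite /GRing.scale /=; ring.
Qed.

Lemma normc_carrier a t : normc (carrier a t) = 1.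
Proof. by rewrite /= cos2Dsin2 sqrtr1. Qed.

(* [wave a e i k] is the [i]-th derivative of [carrier a t * om_jet k (e * t)];
   every differentiation either multiplies by [i a] or raises [k] at cost [e]. *)
Fixpoint wave (a e : R) (i k : nat) (t : R) : R[i] :=
  if i is i'.+1 then (0 +i* a) * wave a e i' k t + e%:C * wave a e i' k.+1 t
  else carrier a t * om_jet k (e * t).

Lemma cder_wave a e i k : cder (wave a e i k) (wave a e i.+1 k).
Proof.
elim: i k => [|i IH] k.
  have := cderM (cder_carrier a) (cder_scale e (cder_om_jet k)).
  set F := (X in cder _ X -> _); suff -> : F = wave a e 1 k by [].
  by apply/funext => t; rewrite /F /=; ring.
exact: (cderD (cderZ (0 +i* a) (IH k)) (cderZ e%:C (IH k.+1))).
Qed.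

(** The constant is independent of [e]: a derivative brings out |a| or [e] <= 1, and all jets of the
    cutoff are dominated by [om]. *)
Lemma wave_dominated a i k : exists2 C, 0 <= C & forall e t, 0 < e <= 1 ->
  normc (wave a e i k t) <= C * om (e * t).
Proof.
elim: i k => [|i IH] k.
  have [C HC] := om_jet_dominated k; exists C.
    have := le_trans (normc_ge0 _) (HC 0); rewrite pmulr_lge0// om_gt0//.
  by move=> e t _; rewrite /= Normc.normcM normc_carrier mul1r.
have [C C0 HC] := IH k; have [C' C'0 HC'] := IH k.+1.
exists (`|a| * C + C'); first by rewrite addr_ge0// mulr_ge0.
move=> e t e01; have /andP[e0 e1] := e01; rewrite [wave _ _ _ _ _]/= mulrDl.
apply: le_trans (le_normcD _ _) _; rewrite !Normc.normcM; apply: lerD.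
  rewrite -mulrA; apply: ler_pM; rewrite ?normc_ge0//; last exact: HC.
  by rewrite /= expr0n add0r sqrtr_sqr.
rewrite normc_real (gtr0_norm e0); apply: le_trans (HC' e t e01).
by rewrite ler_piMl// normc_ge0.
Qed.

End HorizontalWave.

(** * Wave packets *)

Section PacketFields.
Variable R : realType.
Local Notation R3 := (R * R * R)%type.
Local Open Scope complex_scope.
Local Notation normc := Normc.normc.
Implicit Types F G : R3 -> R[i].

Lemma cpartialD i F G F' G' : cpartial i F F' -> cpartial i G G' ->
  cpartial i (fun x => F x + G x) (fun x => F' x + G' x).
Proof.
move=> dF dG x; have [d1 d2] := dF x; have [d3 d4] := dG x.
have -> : (fun x => complex.Re (F x + G x)) = (fun x => complex.Re (F x) + complex.Re (G x)).
  by apply/funext => s; rewrite ReD.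
have -> : (fun x => complex.Im (F x + G x)) = (fun x => complex.Im (F x) + complex.Im (G x)).
  by apply/funext => s; rewrite ImD.
by split; apply: is_derive_eq; rewrite ?ReD ?ImD.
Qed.

Lemma cpartialM i F G F' G' : cpartial i F F' -> cpartial i G G' ->
  cpartial i (fun x => F x * G x) (fun x => F' x * G x + F x * G' x).
Proof.
move=> dF dG x; have [d1 d2] := dF x; have [d3 d4] := dG x.
have -> : (fun x => complex.Re (F x * G x)) = (fun x => complex.Re (F x) * complex.Re (G x)
    - complex.Im (F x) * complex.Im (G x)) by apply/funext => s; rewrite ReM.
have -> : (fun x => complex.Im (F x * G x)) = (fun x => complex.Re (F x) * complex.Im (G x)
    + complex.Im (F x) * complex.Re (G x)) by apply/funext => s; rewrite ImM.
by split; apply: is_derive_eq; rewrite ?ReD ?ImD ?ReM ?ImM /GRing.scale /=; ring.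
Qed.

Lemma cpartial_cst i (c : R[i]) : cpartial i (fun=> c) (fun=> 0).
Proof. by move=> x; split; exact: is_derive_cst. Qed.

Definition coord (i : 'I_3) (x : R3) : R :=
  if val i == 0%N then x.1.1 else if val i == 1%N then x.1.2 else x.2.

Lemma coord_line (i j : 'I_3) (x : R3) (h : R) :
  coord j (h *: basis3 R i + x) = (if i == j then h else 0) + coord j x.
Proof.
move: i j => [[|[|[|//]]] ?] [[|[|[|//]]] ?]; rewrite /coord /=;
  by rewrite ?[h *: _]mulr1 ?[h *: _]mulr0.
Qed.

Lemma cpartial_coord i j (f f' : R -> R[i]) : cder f f' ->
  cpartial i (fun x => f (coord j x)) (fun x => if i == j then f' (coord j x) else 0).
Proof.
move=> df x; split; apply: line_is_derive.
- have -> : (fun h => complex.Re (f (coord j (h *: basis3 R i + x)))) =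
      (fun h => complex.Re (f ((if i == j then h else 0) + coord j x))).
    by apply/funext => h; rewrite coord_line.
  case: ifP => _; last exact: is_derive_cst.
  have dh : is_derive (0 : R) (1 : R) (fun h => h + coord j x) 1.
    by apply: is_derive_eq; rewrite addr0.
  have d := (df (0 + coord j x)).1.
  have := @is_derive1_comp R (fun t => complex.Re (f t)) (fun h => h + coord j x) 0 _ _ d dh.
  by rewrite add0r [_ * 1]mulr1.
- have -> : (fun h => complex.Im (f (coord j (h *: basis3 R i + x)))) =
      (fun h => complex.Im (f ((if i == j then h else 0) + coord j x))).
    by apply/funext => h; rewrite coord_line.
  case: ifP => _; last exact: is_derive_cst.
  have dh : is_derive (0 : R) (1 : R) (fun h => h + coord j x) 1.
    by apply: is_derive_eq; rewrite addr0.
  have d := (df (0 + coord j x)).2.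
  have := @is_derive1_comp R (fun t => complex.Im (f t)) (fun h => h + coord j x) 0 _ _ d dh.
  by rewrite add0r [_ * 1]mulr1.
Qed.

Lemma ccontinuousD (T : topologicalType) (F G : T -> R[i]) :
  ccontinuous F -> ccontinuous G -> ccontinuous (fun x => F x + G x).
Proof.
move=> [a b] [c d]; split.
- under eq_fun do rewrite ReD.
  by move=> x; apply: cvgD; [exact: a|exact: c].
- under eq_fun do rewrite ImD.
  by move=> x; apply: cvgD; [exact: b|exact: d].
Qed.

Lemma ccontinuousM (T : topologicalType) (F G : T -> R[i]) :
  ccontinuous F -> ccontinuous G -> ccontinuous (fun x => F x * G x).
Proof.
move=> [a b] [c d]; split.
- under eq_fun do rewrite ReM.
  by move=> x; apply: cvgB; apply: cvgM; [exact: a|exact: c|exact: b|exact: d].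
- under eq_fun do rewrite ImM.
  by move=> x; apply: cvgD; apply: cvgM; [exact: a|exact: d|exact: b|exact: c].
Qed.

Lemma ccontinuous_cst (T : topologicalType) (c : R[i]) : ccontinuous (fun _ : T => c).
Proof. by split; exact: cst_continuous. Qed.

Lemma ccontinuous_coord j (f : R -> R[i]) : ccontinuous f ->
  ccontinuous (fun x => f (coord j x)).
Proof.
by move: j => [[|[|[|//]]] ?] [a b]; split; rewrite /coord /=;
  [exact: (continuous_x1 a)|exact: (continuous_x1 b)|exact: (continuous_x2 a)
  |exact: (continuous_x2 b)|exact: (continuous_x3 a)|exact: (continuous_x3 b)].
Qed.

(** The indices [m] and [n] count derivatives in x and in z. The carrier oscillates in x only, so
    each z-derivative costs a factor [e]. *)
Definition horizontal (al e : R) m n (x : R3) : R[i] :=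
  wave al e m 0 x.1.1 * wave 0 e n 0 x.2.

(* (1 + 4 Laplace_h) applied to [horizontal], which is O(e) because the carrier
   frequency satisfies al^2 = 1/4. *)
Definition horizontal1 al e m n (x : R3) : R[i] :=
  horizontal al e m n x + 4 * horizontal al e m.+2 n x + 4 * horizontal al e m n.+2 x.

(* The horizontal Laplacian of [horizontal1]. *)
Definition horizontal2 al e m n (x : R3) : R[i] :=
  horizontal1 al e m.+2 n x + horizontal1 al e m n.+2 x.

(** This form is stable under partial derivatives, which raise [m] or [n] or differentiate the
    profiles. The last two terms hold the correctors and are O(e). *)
Definition packet al e (a0 a1 a2 : R -> R[i]) m n (x : R3) : R[i] :=
  a0 x.1.2 * horizontal al e m n x + a1 x.1.2 * horizontal1 al e m n x
  + a2 x.1.2 * horizontal2 al e m n x.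

Section Partials.
Variables al e : R.

Definition hshift (F : nat -> nat -> R3 -> R[i]) (i : 'I_3) m n (x : R3) : R[i] :=
  if val i == 0%N then F m.+1 n x else if val i == 1%N then 0 else F m n.+1 x.

Lemma cpartial_ext i F G G' : G = G' -> cpartial i F G -> cpartial i F G'.
Proof. by move=> ->. Qed.

Let i0 : 'I_3 := Ordinal (isT : (0 < 3)%N).
Let i1 : 'I_3 := Ordinal (isT : (1 < 3)%N).
Let i2 : 'I_3 := Ordinal (isT : (2 < 3)%N).

Lemma cpartial_horizontal i m n :
  cpartial i (horizontal al e m n) (hshift (horizontal al e) i m n).
Proof.
have := cpartialM (@cpartial_coord i i0 _ _ (@cder_wave R al e m 0))
  (@cpartial_coord i i2 _ _ (@cder_wave R 0 e n 0)).
apply: cpartial_ext; apply/funext => x; rewrite /hshift /horizontal.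
move: i => [[|[|[|//]]] ?]; rewrite -!val_eqE /= ?mul0r ?mulr0 ?addr0 ?add0r//.
Qed.

Lemma cpartial_horizontal1 i m n :
  cpartial i (horizontal1 al e m n) (hshift (horizontal1 al e) i m n).
Proof.
have := cpartialD (cpartialD (cpartial_horizontal i m n)
  (cpartialM (cpartial_cst i 4) (cpartial_horizontal i m.+2 n)))
  (cpartialM (cpartial_cst i 4) (cpartial_horizontal i m n.+2)).
apply: cpartial_ext; apply/funext => x; rewrite /hshift /horizontal1.
by move: i => [[|[|[|//]]] ?] /=; rewrite ?mul0r ?mulr0 ?addr0 ?add0r.
Qed.

Lemma cpartial_horizontal2 i m n :
  cpartial i (horizontal2 al e m n) (hshift (horizontal2 al e) i m n).
Proof.
have := cpartialD (cpartial_horizontal1 i m.+2 n) (cpartial_horizontal1 i m n.+2).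
apply: cpartial_ext; apply/funext => x; rewrite /hshift /horizontal2.
by move: i => [[|[|[|//]]] ?] /=; rewrite ?addr0.
Qed.

Section PacketPartial.
Variables a0 a1 a2 b0 b1 b2 : R -> R[i].
Hypotheses (d0 : cder a0 b0) (d1 : cder a1 b1) (d2 : cder a2 b2).

Lemma cpartial_packet i m n : cpartial i (packet al e a0 a1 a2 m n)
  (fun x => if val i == 0%N then packet al e a0 a1 a2 m.+1 n x
    else if val i == 1%N then packet al e b0 b1 b2 m n x
    else packet al e a0 a1 a2 m n.+1 x).
Proof.
have := cpartialD (cpartialD
  (cpartialM (@cpartial_coord i i1 _ _ d0) (cpartial_horizontal i m n))
  (cpartialM (@cpartial_coord i i1 _ _ d1) (cpartial_horizontal1 i m n)))
  (cpartialM (@cpartial_coord i i1 _ _ d2) (cpartial_horizontal2 i m n)).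
apply: cpartial_ext; apply/funext => x; rewrite /hshift /packet.
by move: i => [[|[|[|//]]] ?]; rewrite -!val_eqE /= ?mul0r ?mulr0 ?addr0 ?add0r.
Qed.

End PacketPartial.

Lemma ccontinuous_horizontal m n : ccontinuous (horizontal al e m n).
Proof.
apply: ccontinuousM.
- exact: (@ccontinuous_coord i0 _ (cder_ccontinuous (@cder_wave R al e m 0))).
- exact: (@ccontinuous_coord i2 _ (cder_ccontinuous (@cder_wave R 0 e n 0))).
Qed.

Lemma ccontinuous_horizontal1 m n : ccontinuous (horizontal1 al e m n).
Proof.
have H := ccontinuous_horizontal; have C := @ccontinuous_cst R3.
by apply: ccontinuousD; [apply: ccontinuousD|]; first exact: H; apply: ccontinuousM.
Qed.

Lemma ccontinuous_packet (a0 a1 a2 : R -> R[i]) m n :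
  ccontinuous a0 -> ccontinuous a1 -> ccontinuous a2 ->
  ccontinuous (packet al e a0 a1 a2 m n).
Proof.
move=> c0 c1 c2; have H := ccontinuous_horizontal1.
apply: ccontinuousD; [apply: ccontinuousD|]; apply: ccontinuousM.
- exact: (@ccontinuous_coord i1).
- exact: ccontinuous_horizontal.
- exact: (@ccontinuous_coord i1).
- exact: H.
- exact: (@ccontinuous_coord i1).
- exact: ccontinuousD.
Qed.

End Partials.

(* Uniform bound by e^k times a profile of width 1/e in x and z. *)
Definition small k (F : R -> R3 -> R[i]) := exists2 C, 0 <= C &
  forall e x, 0 < e <= 1 -> normc (F e x) <= C * e ^+ k * om3 e x.

Lemma smallD k (F G : R -> R3 -> R[i]) : small k F -> small k G -> small k (fun e x => F e x + G e x).
Proof.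
move=> [C C0 HC] [C' C'0 HC']; exists (C + C'); first exact: addr_ge0.
move=> e x e01; apply: le_trans (le_normcD _ _) _.
by rewrite !mulrDl lerD ?HC ?HC'.
Qed.

Lemma smallM k (b : R3 -> R[i]) (F : R -> R3 -> R[i]) B : (forall x, normc (b x) <= B) ->
  small k F -> small k (fun e x => b x * F e x).
Proof.
move=> bB [C C0 HC]; have B0 : 0 <= B := le_trans (normc_ge0 _) (bB 0).
exists (B * C); first exact: mulr_ge0.
move=> e x e01; rewrite Normc.normcM -!mulrA.
by apply: ler_pM; rewrite ?normc_ge0// mulrA HC.
Qed.

Lemma smallZ k (c : R[i]) (F : R -> R3 -> R[i]) : small k F -> small k (fun e x => c * F e x).
Proof. by apply: (@smallM k (fun=> c) F (normc c)). Qed.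

Lemma smallW k (F : R -> R3 -> R[i]) : small k.+1 F -> small k F.
Proof.
move=> [C C0 HC]; exists C => // e x e01; apply: le_trans (HC e x e01) _.
have /andP[e0 e1] := e01.
rewrite ler_wpM2r ?(ltW (om3_gt0 _ _))// ler_wpM2l// exprS ler_piMl ?exprn_ge0// ltW//.
Qed.

Lemma small_term k al m j n l (a : R -> R[i]) : dominated (@om R) a ->
  small k (fun e x => a x.1.2 * ((e ^+ k)%:C * (wave al e m j x.1.1 * wave 0 e n l x.2))).
Proof.
move=> [A HA]; have [B B0 HB] := wave_dominated al m j.
have [C C0 HC] := wave_dominated (0 : R) n l.
have A0 : 0 <= A.
  by have := le_trans (normc_ge0 _) (HA 0); rewrite pmulr_lge0// om_gt0.
exists (A * (B * C)); first by rewrite !mulr_ge0.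
move=> e x e01; have /andP[e0 _] := e01; rewrite !Normc.normcM normc_real.
rewrite ger0_norm ?exprn_ge0 ?(ltW e0)// /om3.
have -> : A * (B * C) * e ^+ k * (om (e * x.1.1) * om x.1.2 * om (e * x.2)) =
  (A * om x.1.2) * (e ^+ k * ((B * om (e * x.1.1)) * (C * om (e * x.2)))) by ring.
apply: ler_pM; rewrite ?HA ?normc_ge0 ?mulr_ge0 ?exprn_ge0 ?(ltW e0) ?normc_ge0//.
by rewrite ler_wpM2l ?exprn_ge0 ?(ltW e0)// ler_pM ?normc_ge0 ?HB ?HC.
Qed.

Section Resonance.
Variable al : R.
Hypothesis al2 : al ^+ 2 = 4^-1.
Variable a : R -> R[i].
Hypothesis da : dominated (@om R) a.

Let ia : R[i] := 0 +i* al.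

Lemma ia2 : ia ^+ 2 = - 4^-1.
Proof.
have -> : (4^-1 : R[i]) = (4^-1)%:C by rewrite fmorphV rmorph_nat.
rewrite -al2 !expr2; apply/eqP; rewrite eq_complex /=.
by apply/andP; split; apply/eqP; ring.
Qed.

Lemma wave0S (e : R) n k (t : R) : wave 0 e n.+1 k t = e%:C * wave 0 e n k.+1 t.
Proof. by rewrite [LHS]/= (_ : 0 +i* 0 = 0) ?mul0r ?add0r. Qed.

(** Two x-derivatives of the carrier give (i al)^2 = -1/4, which the operator cancels. There remain
    waves with differentiated cutoffs, with the coefficients 8 i al e, 4 e^2 and 4 e^2. *)
Lemma small_horizontal1 m n :
  small 1 (fun e x => a x.1.2 * horizontal1 al e m n x).
Proof.
have H := smallD (smallD (smallZ (8 * ia) (small_term 1 al m 1 n 0 da))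
  (smallZ 4 (smallW (small_term 2 al m 2 n 0 da))))
  (smallZ 4 (smallW (small_term 2 al m 0 n 2 da))).
move: H; set F := (X in small 1 X -> _).
suff -> : F = (fun e x => a x.1.2 * horizontal1 al e m n x) by [].
apply/funext => e; apply/funext => x; rewrite /F /horizontal1 /horizontal !wave0S.
rewrite [wave al e m.+2 0 _]/= -/ia rmorphXn.
set w0 := wave al e m 0 _; set w1 := wave al e m 1 _; set w2 := wave al e m 2 _.
set z0 := wave 0 e n 0 _; set z2 := wave 0 e n 2 _.
rewrite [X in _ = _ * (_ + 4 * (X * _) + _)](_ : _ =
  ia ^+ 2 * w0 + 2 * ia * e%:C * w1 + e%:C ^+ 2 * w2); last by ring.
by rewrite ia2; field.
Qed.

Lemma small_horizontal2 m n :
  small 1 (fun e x => a x.1.2 * horizontal2 al e m n x).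
Proof.
move: (smallD (small_horizontal1 m.+2 n) (small_horizontal1 m n.+2)).
set F := (X in small 1 X -> _).
suff -> : F = (fun e x => a x.1.2 * horizontal2 al e m n x) by [].
by apply/funext => e; apply/funext => x; rewrite /F /horizontal2; ring.
Qed.

Lemma small_horizontal_dx m n : small 1 (fun e x =>
  a x.1.2 * (horizontal al e m.+1 n x - ia * horizontal al e m n x)).
Proof.
move: (small_term 1 al m 1 n 0 da); set F := (X in small 1 X -> _).
suff -> : F = (fun e x => a x.1.2 * (horizontal al e m.+1 n x - ia * horizontal al e m n x)) by [].
apply/funext => e; apply/funext => x; rewrite /F /horizontal [wave al e m.+1 0 _]/= expr1 -/ia.
ring.
Qed.

Lemma small_horizontal_dz m n : small 1 (fun e x => a x.1.2 * horizontal al e m n.+1 x).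
Proof.
move: (small_term 1 al m 0 n 1 da); set F := (X in small 1 X -> _).
suff -> : F = (fun e x => a x.1.2 * horizontal al e m n.+1 x) by [].
apply/funext => e; apply/funext => x; rewrite /F /horizontal wave0S expr1.
ring.
Qed.

Lemma small_horizontal m n : small 0 (fun e x => a x.1.2 * horizontal al e m n x).
Proof.
move: (small_term 0 al m 0 n 0 da); set F := (X in small 0 X -> _).
suff -> : F = (fun e x => a x.1.2 * horizontal al e m n x) by [].
by apply/funext => e; apply/funext => x; rewrite /F /horizontal expr0 rmorph1 mul1r.
Qed.

End Resonance.

Lemma small_packet al (a0 a1 a2 : R -> R[i]) m n : al ^+ 2 = 4^-1 ->
  dominated (@om R) a0 -> dominated (@om R) a1 -> dominated (@om R) a2 ->
  small 0 (fun e x => packet al e a0 a1 a2 m n x).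
Proof.
move=> al2 d0 d1 d2; apply: smallD; first apply: smallD.
- exact: small_horizontal.
- exact/smallW/small_horizontal1.
- exact/smallW/small_horizontal2.
Qed.

End PacketFields.

(** * Upper and lower bounds for L^2 norms *)

Section EnergyEstimates.
Variable R : realType.
Local Notation R3 := (R * R * R)%type.
Local Notation leb3 := (@leb3 R).
Local Notation mu := (@lebesgue_measure R).
Local Open Scope complex_scope.
Local Notation normc := Normc.normc.

Definition sqnorm (V : cvfield R) (x : R3) : R :=
  \sum_(i < 3) (complex.Re (V i x) ^+ 2 + complex.Im (V i x) ^+ 2).

Lemma sqnorm_ge0 V x : 0 <= sqnorm V x.
Proof. by apply: sumr_ge0 => i _; rewrite addr_ge0 ?sqr_ge0. Qed.

Lemma normc_sqr (z : R[i]) : normc z ^+ 2 = complex.Re z ^+ 2 + complex.Im z ^+ 2.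
Proof. by case: z => a b /=; rewrite sqr_sqrtr// addr_ge0 ?sqr_ge0. Qed.

Lemma sqnormE V x : sqnorm V x = \sum_(i < 3) normc (V i x) ^+ 2.
Proof. by apply: eq_bigr => i _; rewrite normc_sqr. Qed.

Lemma Lnorm2E (f : R3 -> R) : Lnorm leb3 2%:E (EFin \o f) =
  ((\int[leb3]_x (f x ^+ 2)%:E) `^ 2^-1)%E.
Proof.
rewrite unlock; congr (_ `^ _)%E; apply: eq_integral => x _ /=.
by rewrite powR_mulrn// real_normK// num_real.
Qed.

Lemma L2normE V : L2norm V = ((\int[leb3]_x (sqnorm V x)%:E) `^ 2^-1)%E.
Proof.
rewrite /L2norm (Lnorm2E (fun x => Num.sqrt (sqnorm V x))); congr (_ `^ _)%E.
by apply: eq_integral => x _; rewrite sqr_sqrtr// sqnorm_ge0.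
Qed.

Lemma sqnorm_continuous V : (forall i, ccontinuous (V i)) -> continuous (sqnorm V).
Proof.
move=> cV; pose t i x := complex.Re (V i x) * complex.Re (V i x)
  + complex.Im (V i x) * complex.Im (V i x).
have ct i : continuous (t i).
  have [a b] := cV i; move=> x.
  by apply: cvgD; apply: cvgM; [exact: a|exact: a|exact: b|exact: b].
have -> : sqnorm V = (fun x => t ord0 x + (t (lift ord0 ord0) x + t (lift ord0 (lift ord0 ord0)) x)).
  by apply/funext => x; rewrite /sqnorm !big_ord_recl big_ord0 addr0 /t !expr2.
by move=> x; apply: cvgD; [exact: ct|apply: cvgD; exact: ct].
Qed.

Lemma om3_le1 (e : R) (x : R3) : om3 e x <= 1.
Proof.
have o (t : R) := ltW (om_gt0 t); have l := @om_le1 R.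
by rewrite /om3 !mulr_ile1 ?mulr_ge0.
Qed.

Lemma square_integral_le (f : R3 -> R) (e C : R) : 0 < e -> continuous f ->
  (forall x, 0 <= f x <= C ^+ 2 * om3 e x) ->
  (\int[leb3]_x (f x)%:E <= (C ^+ 2 * (pi ^+ 3 / e ^+ 2))%:E)%E.
Proof.
move=> e0 cf bf.
have -> : C ^+ 2 * (pi ^+ 3 / e ^+ 2) = C ^+ 2 * (pi / e * pi * (pi / e)).
  by field; rewrite gt_eqF.
rewrite EFinM -(integral_om3 e0).
have m3 : measurable_fun setT (fun x => (om3 e x)%:E).
  by apply/measurable_EFinP; apply: continuous_measurable3; exact: om3_continuous.
have mf : measurable_fun setT (fun x => (f x)%:E).
  by apply/measurable_EFinP; apply: continuous_measurable3.
have p3 x : (0 <= (om3 e x)%:E)%E by rewrite lee_fin ltW// om3_gt0.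
have C0 : (0 <= (C ^+ 2)%:E)%E by rewrite lee_fin sqr_ge0.
rewrite -(@ge0_integralZl_EFin _ _ R leb3 setT measurableT _ (fun x _ => p3 x) m3 _ (sqr_ge0 C)).
apply: (@ge0_le_integral _ _ R leb3 setT measurableT).
- by move=> x _; rewrite lee_fin; have /andP[] := bf x.
- exact: mf.
- exact: measurable_funeM.
- by move=> x _; rewrite -EFinM lee_fin; have /andP[] := bf x.
Qed.

(** As [om3] <= 1, its square is at most itself, so the integral of [om3] also controls L^2
    norms. *)
Lemma om3_sqr_le (e z C : R) (x : R3) : 0 <= z -> z <= C * om3 e x ->
  0 <= z ^+ 2 <= C ^+ 2 * om3 e x.
Proof.
move=> z0 zC; rewrite sqr_ge0/=; have o0 := ltW (om3_gt0 e x).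
apply: (@le_trans _ _ ((C * om3 e x) ^+ 2)).
  by rewrite !expr2; apply: ler_pM.
rewrite exprMn ler_wpM2l ?sqr_ge0// expr2 ler_piMl//; exact: om3_le1.
Qed.

Lemma dominated_L2fun (F : R3 -> R[i]) (e C : R) : 0 < e -> ccontinuous F ->
  (forall x, normc (F x) <= C * om3 e x) -> L2fun F.
Proof.
move=> e0 [c1 c2] bF.
have H (f : R3 -> R) : continuous f -> (forall x, f x ^+ 2 <= normc (F x) ^+ 2) ->
    f \in Lfun leb3 2%:E.
  move=> cf fF; apply/andP; split; rewrite inE /=.
    exact: continuous_measurable3.
  rewrite /finite_norm Lnorm2E poweR_lty//.
  have cf2 : continuous (fun x => f x ^+ 2).
    by have -> : (fun x => f x ^+ 2) = (fun x => f x * f x);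
      [apply/funext => x; rewrite expr2|move=> x; apply: cvgM; exact: cf].
  apply: (le_lt_trans (square_integral_le (C := C) e0 cf2 _)); last exact: ltry.
  move=> x; rewrite sqr_ge0/= (le_trans (fF x))//.
  by have /andP[] := om3_sqr_le (normc_ge0 _) (bF x).
split; apply: H => // x; rewrite normc_sqr ?lerDl ?lerDr sqr_ge0//.
Qed.

Lemma energy_le V (e C : R) : 0 < e -> (forall i, ccontinuous (V i)) ->
  (forall i x, normc (V i x) <= C * om3 e x) ->
  (\int[leb3]_x (sqnorm V x)%:E <= (3 * C ^+ 2 * (pi ^+ 3 / e ^+ 2))%:E)%E.
Proof.
move=> e0 cV bV.
have s3 : Num.sqrt 3 ^+ 2 = 3 :> R by rewrite sqr_sqrtr.
rewrite -s3 -exprMn; apply: square_integral_le => //; first exact: sqnorm_continuous.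
move=> x; rewrite sqnorm_ge0/= sqnormE exprMn s3 !big_ord_recl big_ord0 addr0.
have b i : normc (V i x) ^+ 2 <= C ^+ 2 * om3 e x.
  by have /andP[] := om3_sqr_le (normc_ge0 _) (bV i x).
have -> : 3 * C ^+ 2 * om3 e x = C ^+ 2 * om3 e x + (C ^+ 2 * om3 e x + C ^+ 2 * om3 e x) by ring.
by rewrite !lerD.
Qed.

(** The box has volume of order L^2; with L = 1/e this is the growth e^-2 of the energy of the
    packets. *)
Lemma energy_ge V (j : 'I_3) (L d y0 m : R) : 0 < L -> 0 < d -> 0 <= m ->
  (forall i, ccontinuous (V i)) ->
  (forall x y z, `|x| <= L -> `|y - y0| <= d -> `|z| <= L -> m <= normc (V j (x, y, z)) ^+ 2) ->
  ((m * (2 * L * (2 * d) * (2 * L)))%:E <= \int[leb3]_x (sqnorm V x)%:E)%E.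
Proof.
move=> L0 d0 m0 cV bV.
pose I := `[- L, L]%classic : set R; pose K := `[y0 - d, y0 + d]%classic : set R.
pose B : set R3 := I `*` K `*` I.
have mB : measurable B.
  by apply: measurableX; [apply: measurableX|]; exact: measurable_itv.
have vB : leb3 B = (2 * L * (2 * d) * (2 * L))%:E.
  have mI : measurable I by exact: measurable_itv.
  have mK : measurable K by exact: measurable_itv.
  have vI : mu I = (2 * L)%:E.
    rewrite /I lebesgue_measure_itv /= lte_fin ifT; last lra.
    by rewrite -EFinD; congr (_%:E); ring.
  have vK : mu K = (2 * d)%:E.
    rewrite /K lebesgue_measure_itv /= lte_fin ifT; last lra.
    by rewrite -EFinD; congr (_%:E); ring.
  have v2 : ((mu \x mu) (I `*` K) = (2 * L * (2 * d))%:E)%E.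
    rewrite (@product_measure1E _ _ _ _ R mu mu _ _ mI mK) EFinM.
    by congr (_ * _)%E; [exact: vI|exact: vK].
  rewrite [LHS](@product_measure1E _ _ _ _ R (mu \x mu)%E mu _ _ (measurableX mI mK) mI).
  by transitivity ((2 * L * (2 * d))%:E * (2 * L)%:E)%E; first by congr (_ * _)%E; [exact: v2|exact: vI].
have ms : measurable_fun setT (fun x => (sqnorm V x)%:E).
  by apply/measurable_EFinP; apply: continuous_measurable3; exact: sqnorm_continuous.
rewrite EFinM -vB -(@integral_cst _ _ R leb3 B mB m%:E).
apply: (@le_trans _ _ (\int[leb3]_(x in B) (sqnorm V x)%:E)%E); last first.
  apply: (@ge0_subset_integral _ _ R leb3 B setT) => //.
  by move=> x _; rewrite lee_fin sqnorm_ge0.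
apply: (@ge0_le_integral _ _ R leb3 B mB) => //.
- by apply: measurable_funTS.
- move=> [[x y] z] [[]] /=; rewrite /I /K /= !in_itv/= => Ix Ky Iz.
  rewrite lee_fin sqnormE (bigD1 j)//=; apply: (@le_trans _ _ (normc (V j (x, y, z)) ^+ 2)).
    apply: bV; rewrite ler_norml//; by move: Ky => /andP[a b]; apply/andP; split; lra.
  by rewrite lerDl sumr_ge0// => i _; exact: sqr_ge0.
Qed.

End EnergyEstimates.

(** * The advection terms of a shear flow as functions *)

Section ShearAdvection.
Variable R : realType.
Local Notation R3 := (R * R * R)%type.
Local Notation leb3 := (@leb3 R).
Local Open Scope complex_scope.
Local Notation normc := Normc.normc.
Variable beta : R.

Definition shear (y : R) : R := beta * dawson (2^-1 * y).
Definition shear' (y : R) : R := beta / 2 * (1 - 2 * (2^-1 * y) * dawson (2^-1 * y)).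

Lemma is_derive_shear y : is_derive y (1 : R) shear (shear' y).
Proof.
have d := is_derive_dawson (2^-1 * y).
have db : is_derive y (1 : R) (fun t => 2^-1 * t) 2^-1.
  by apply: is_derive_eq; rewrite /GRing.scale /= mulr1.
have dc : is_derive y (1 : R) (fun t => dawson (2^-1 * t)) _ :=
  @is_derive1_comp R (@dawson R) (fun t => 2^-1 * t) y _ _ d db.
rewrite /shear; apply: is_derive_eq.
by rewrite /shear' /GRing.scale /=; field.
Qed.

Lemma shear'_continuous : continuous shear'.
Proof.
have c : continuous (fun y : R => 2^-1 * y).
  by move=> y; apply: cvgM; [exact: cvg_cst|exact: cvg_id].
have cd : continuous (fun y : R => dawson (2^-1 * y)).
  move=> y; apply: (@continuous_comp _ _ _ (fun y : R => 2^-1 * y) (@dawson R)); first exact: c.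
  exact: dawson_continuous.
move=> y; apply: cvgM; first exact: cvg_cst.
apply: cvgB; first exact: cvg_cst.
apply: cvgM; first by apply: cvgM; [exact: cvg_cst|exact: c].
exact: cd.
Qed.

Lemma Ubar0 (i : 'I_3) x : val i = 0%N -> Ubar beta i x = shear x.1.2.
Proof.
move=> i0; rewrite /Ubar i0 /= /shear /dawson.
by have -> : x.1.2 ^+ 2 / 4 = (2^-1 * x.1.2) ^+ 2; [field|rewrite [2^-1 * _]mulrC].
Qed.

Lemma UbarN0 (i : 'I_3) : val i != 0%N -> Ubar beta i = (fun=> 0).
Proof. by move=> i0; apply/funext => x; rewrite /Ubar (negPf i0). Qed.

Lemma is_derive_Ubar (i j : 'I_3) x : val j = 0%N ->
  is_derive x (basis3 R i) (Ubar beta j) (if val i == 1%N then shear' x.1.2 else 0).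
Proof.
move=> j0; have -> : Ubar beta j = (fun x => shear x.1.2).
  by apply/funext => y; rewrite Ubar0.
have [H _] := @cpartial_coord R i (Ordinal (isT : (1 < 3)%N)) _ _ (cder_real is_derive_shear) x.
move: H; rewrite -val_eqE /=; case: ifP => //.
Qed.

Lemma partial_Ubar (i j : 'I_3) x : partial i (Ubar beta j) x =
  if (val j == 0%N) && (val i == 1%N) then shear' x.1.2 else 0.
Proof.
case: eqP => [j0|/eqP j0] /=; last by rewrite /partial (UbarN0 j0) derive_cst.
by have [_ <-] := is_derive_Ubar i x j0.
Qed.

Lemma shear_advection (V : cvfield R) (Vx : R3 -> R[i]) (j : 'I_3) phi :
  (forall i, ccontinuous (V i)) -> ccontinuous Vx ->
  (forall i : 'I_3, val i = 0%N -> cpartial i (V j) Vx) -> test_function phi ->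
  lin_advection (Ubar beta) V j phi =
    dfun (fun x => (shear x.1.2)%:C * Vx x +
      (if val j == 0%N then (shear' x.1.2)%:C * V (lift ord0 ord0) x else 0)) phi.
Proof.
move=> cV cVx dV tp.
have cU : ccontinuous (fun x : R3 => (shear x.1.2)%:C).
  exact: (@ccontinuous_coord R (Ordinal (isT : (1 < 3)%N)) _ (cder_ccontinuous (cder_real is_derive_shear))).
have cU' : ccontinuous (fun x : R3 => (shear' x.1.2)%:C).
  by split; [exact: (continuous_x2 shear'_continuous)|exact: cst_continuous].
have D0 (F : R3 -> R[i]) : dfun F (fun=> 0) = 0.
  rewrite /dfun; have -> : (fun x => F x * (0 : R)%:C) = (fun=> 0).
    by apply/funext => x; rewrite mulr0.
  by rewrite /cintegral /= /Rintegral integral0.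
rewrite /lin_advection.
have -> : \sum_(i < 3) dmul (Ubar beta i) (dpartial i (dfun (V j))) phi =
    dfun (fun x => (shear x.1.2)%:C * Vx x) phi.
  rewrite (bigD1 ord0)//= big1 ?addr0 => [|i i0]; last first.
    rewrite /dmul /dpartial (@UbarN0 i)//.
    have -> : (fun x => 0 * phi x) = cst 0 by apply/funext => x; rewrite mul0r.
    by have -> : partial i (cst 0) = (fun=> 0) :> (R3 -> R);
      [apply/funext => x; rewrite /partial derive_cst|rewrite D0 oppr0].
  (* As U does not depend on x, the x-derivative of U phi is U times that of phi. The factor U thus
     moves from the test function to V, and the weak derivative of U V is taken against [phi]
     itself. *)
  have cUV : ccontinuous (fun x => (shear x.1.2)%:C * V j x) by exact: ccontinuousM.
  have cUVx : ccontinuous (fun x => (shear x.1.2)%:C * Vx x) by exact: ccontinuousM.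
  rewrite -(@dpartial_dfun R ord0 _ _ phi cUV cUVx _ tp).
    rewrite /dmul /dpartial /dfun; congr (- cintegral _); apply/funext => x.
    have -> : partial ord0 (fun x => Ubar beta ord0 x * phi x) x =
        shear x.1.2 * partial ord0 phi x.
      have d1 := is_derive_Ubar ord0 x (erefl : val (ord0 : 'I_3) = 0%N).
      have d2 := test_derive ord0 x tp.
      have [_ E] := is_deriveM d1 d2; rewrite [LHS]E.
      by rewrite /GRing.scale /= mulr0 addr0 Ubar0.
    by rewrite rmorphM mulrA [V j x * _]mulrC.
  have := cpartialM (@cpartial_coord R ord0 (Ordinal (isT : (1 < 3)%N)) _ _ (cder_real is_derive_shear)) (dV ord0 erefl).
  by apply: cpartial_ext; apply/funext => x; rewrite -val_eqE /= mul0r add0r.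
have -> : \sum_(i < 3) dmul (partial i (Ubar beta j)) (dfun (V i)) phi =
    dfun (fun x => if val j == 0%N then (shear' x.1.2)%:C * V (lift ord0 ord0) x else 0) phi.
  rewrite (bigD1 (lift ord0 ord0))//= big1 ?addr0 => [|i i1]; last first.
    have -> : partial i (Ubar beta j) = (fun=> 0).
      apply/funext => x; rewrite partial_Ubar (_ : (val i == 1%N) = false) ?andbF//.
      by apply: contraNF i1 => /eqP i1; apply/eqP/val_inj.
    rewrite /dmul; have -> : (fun x => 0 * phi x) = (fun=> 0) by apply/funext => x; rewrite mul0r.
    exact: D0.
  rewrite /dmul /dfun; congr cintegral; apply/funext => x; rewrite partial_Ubar /= andbT.
  case: ifP => _; last by rewrite !mul0r mulr0.
  by rewrite rmorphM mulrA [V _ x * _]mulrC.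
rewrite dfunD//; first exact: ccontinuousM.
by case: (val j == 0%N); [exact: ccontinuousM|exact: ccontinuous_cst].
Qed.

End ShearAdvection.

(** * The packets, their images under the operator, and the errors *)

Section UnstablePacket.
Variable R : realType.
Local Notation R3 := (R * R * R)%type.
Local Notation leb3 := (@leb3 R).
Local Open Scope complex_scope.
Local Notation normc := Normc.normc.
Local Notation decays := (@decaying R (- 2^-1)).

Definition vec3 (a b c : R3 -> R[i]) : cvfield R :=
  fun i => if val i == 0%N then a else if val i == 1%N then b else c.

Lemma vec3_ind (Pr : (R3 -> R[i]) -> Prop) a b c i : Pr a -> Pr b -> Pr c -> Pr (vec3 a b c i).
Proof. by rewrite /vec3; case: (val i == 0%N); case: (val i == 1%N). Qed.

Lemma sum3E (V : nmodType) (F : 'I_3 -> V) :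
  \sum_(i < 3) F i = F ord0 + (F (lift ord0 ord0) + F (lift ord0 (lift ord0 ord0))).
Proof. by rewrite !big_ord_recl big_ord0 addr0. Qed.

Lemma divergence_free a b c a' b' c' phi :
  ccontinuous a -> ccontinuous b -> ccontinuous c ->
  ccontinuous a' -> ccontinuous b' -> ccontinuous c' ->
  (forall i : 'I_3, val i = 0%N -> cpartial i a a') ->
  (forall i : 'I_3, val i = 1%N -> cpartial i b b') ->
  (forall i : 'I_3, val i = 2%N -> cpartial i c c') ->
  (forall x, a' x + (b' x + c' x) = 0) -> test_function phi ->
  \sum_(i < 3) dpartial i (dfun (vec3 a b c i)) phi = 0.
Proof.
move=> ca cb cc ca' cb' cc' da db dc div0 tp.
transitivity (dpartial ord0 (dfun a) phi + (dpartial (lift ord0 ord0) (dfun b) phi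
    + dpartial (lift ord0 (lift ord0 ord0)) (dfun c) phi)); first exact: sum3E.
rewrite (dpartial_dfun ca ca' (da ord0 erefl) tp) (dpartial_dfun cb cb' (db (lift ord0 ord0) erefl) tp).
rewrite (dpartial_dfun cc cc' (dc (lift ord0 (lift ord0 ord0)) erefl) tp) dfunD// dfunD//; last exact: ccontinuousD.
by rewrite -(dfun0 phi) (funext div0).
Qed.

Lemma decaying_dominated a : decays a -> dominated (@om R) a.
Proof.
by move=> da; apply: (@egrowth_om R (- 2^-1)); [rewrite oppr_lt0 invr_gt0|exact: regular_bound (da 0%N)].
Qed.

Lemma decaying_cder a : decays a -> cder a (cD a).
Proof. by move=> da; have [] := regular_iter 0 da. Qed.

Lemma decaying_cD a : decays a -> decays (cD a).
Proof. by move=> da k; have /= [_ [a' d r]] := da k.+1; rewrite (cDE d). Qed.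

Lemma decaying_ccontinuous a : decays a -> ccontinuous a.
Proof. by move=> da; exact: cder_ccontinuous (decaying_cder da). Qed.

Lemma decayingZ (c : R[i]) a : decays a -> decays (fun y => c * a y).
Proof. by move=> da; apply: decayingM => //; exact: slow_cst. Qed.

Lemma cDZ (c : R[i]) a : decays a -> cD (fun y => c * a y) = (fun y => c * cD a y).
Proof. by move=> da; apply: cDE; apply: cderZ; exact: decaying_cder. Qed.

Variables (beta g : R).
Hypothesis beta0 : beta != 0.
Hypothesis g0 : 0 < g.

Let al : R := Num.sg beta / 2.
Let Uc y : R[i] := (shear beta y)%:C.
Let Uc' y : R[i] := (shear' beta y)%:C.
Let bg : R[i] := beta%:C * (0 +i* g).

Lemma al2 : al ^+ 2 = 4^-1.
Proof. by rewrite exprMn sqr_sg beta0 mul1r; field. Qed.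

Definition growth_rate : R := al * beta * g.

Lemma growth_rate_gt0 : 0 < growth_rate.
Proof.
have -> : growth_rate = `|beta| * (g / 2) by rewrite /growth_rate /al (normrEsg beta); field.
by rewrite mulr_gt0 ?normr_gt0// divr_gt0.
Qed.

(* With U the shear, c = i beta g and k^2 = 1/4: the first two lines say that f
   solves Rayleigh's equation (U - c)(f'' - k^2 f) = U'' f, written for
   P = (U - c) f' - U' f, while [A] and [B] correct the stream function so that
   the Poisson equation for the pressure holds exactly, see [packet_image]. *)
Definition is_profile (f P A B Q : R -> R[i]) : Prop :=
  [/\ [/\ decays f, decays P, decays A, decays B & decays Q],
      forall y, P y = (Uc y - bg) * cD f y - Uc' y * f y,
      forall y, cD P y = 4^-1 * (Uc y - bg) * f y /\
        cD (cD P) y = 4^-1 * P y + 2^-1 * Uc' y * f y &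
      forall y, P y - cD (cD Q) y = 2 * Uc' y * A y /\ Q y = - 2 * Uc' y * B y].

(** The system is linear, so packets can be normalised by scaling their profiles, which keeps them
    in the domain. *)
Lemma is_profileZ c f P A B Q : is_profile f P A B Q ->
  is_profile (fun y => c * f y) (fun y => c * P y) (fun y => c * A y)
    (fun y => c * B y) (fun y => c * Q y).
Proof.
move=> [[df dP dA dB dQ] H1 H2 H3]; split.
- by split; exact: decayingZ.
- by move=> y; rewrite cDZ// H1; ring.
- move=> y; rewrite !cDZ//; last exact: decaying_cD.
  by have [-> ->] := H2 y; split; ring.
- move=> y; rewrite !cDZ//; last exact: decaying_cD.
  have [H4 ->] := H3 y; split; last by ring.
  by rewrite -mulrBr H4; ring.
Qed.

Local Notation nul := (fun _ : R => 0 : R[i]).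

(* The field (d_y Psi, - d_x Psi, 0) for Psi = [packet al e f A B 0 0]. *)
Definition packet_velocity (f A B : R -> R[i]) (e : R) : cvfield R := vec3
  (packet al e (cD f) (cD A) (cD B) 0 0)
  (fun x => -1 * packet al e f A B 1 0 x)
  (fun=> 0).

(* - U d_x V - V_2 U' e_1 + grad p with p = [packet al e (- 4 P) Q 0 2 0], for
   which Laplace p = - 2 U' d_x^2 Psi identically, not only up to O(e). *)
Definition packet_image (f P A B Q : R -> R[i]) (e : R) : cvfield R := vec3
  (fun x => (- Uc x.1.2) * packet al e (cD f) (cD A) (cD B) 1 0 x
    + Uc' x.1.2 * packet al e f A B 1 0 x
    + packet al e (fun y => - 4 * P y) Q nul 3 0 x)
  (fun x => Uc x.1.2 * packet al e f A B 2 0 x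
    + packet al e (fun y => - 4 * cD P y) (cD Q) nul 2 0 x)
  (packet al e (fun y => - 4 * P y) Q nul 2 1).

Section Profile.
Variables f P A B Q : R -> R[i].
Hypothesis prof : is_profile f P A B Q.

Let decs := let: And4 h _ _ _ := prof in h.
Let df : decays f := let: And5 h _ _ _ _ := decs in h.
Let dP : decays P := let: And5 _ h _ _ _ := decs in h.
Let dA : decays A := let: And5 _ _ h _ _ := decs in h.
Let dB : decays B := let: And5 _ _ _ h _ := decs in h.
Let dQ : decays Q := let: And5 _ _ _ _ h := decs in h.
Let dn : decays nul.
Proof.
move=> k; elim: k => [|k IH]; split => //; try by move=> d d0; exists 0 => t; rewrite Normc.normc0 mul0r.
by exists nul => //; exact: cder_cst.
Qed.

Lemma packet_ccontinuous e a0 a1 a2 m n : decays a0 -> decays a1 -> decays a2 ->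
  ccontinuous (packet al e a0 a1 a2 m n).
Proof. by move=> ? ? ?; apply: ccontinuous_packet; exact: decaying_ccontinuous. Qed.

Lemma packet_small a0 a1 a2 m n : decays a0 -> decays a1 -> decays a2 ->
  small 0 (fun e x => packet al e a0 a1 a2 m n x).
Proof. by move=> ? ? ?; apply: small_packet al2 _ _ _; exact: decaying_dominated. Qed.

Let ia : R[i] := 0 +i* al.

(** The rate is - i al c with the purely imaginary speed c = i beta gamma, hence real. *)
Lemma growth_rateE : (growth_rate)%:C = - (ia * bg).
Proof.
rewrite /growth_rate /ia /bg; apply/eqP; rewrite eq_complex /=.
by apply/andP; split; apply/eqP; ring.
Qed.

Lemma Uc_bound (x : R3) : normc (Uc x.1.2) <= `|beta|.
Proof. by rewrite normc_real normrM ler_piMr// dawson_norm_le1. Qed.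

Lemma Uc'_bound (x : R3) : normc (Uc' x.1.2) <= `|beta / 2| * 3.
Proof. by rewrite normc_real normrM ler_wpM2l// dawson_der_norm. Qed.

Lemma small_ext k (F G : R -> R3 -> R[i]) : (forall e x, F e x = G e x) -> small k F -> small k G.
Proof. by move=> FG [C C0 HC]; exists C => // e x; rewrite -FG; exact: HC. Qed.

Let dd := decaying_dominated.
Let lam : R[i] := (growth_rate)%:C.

(** Replacing an x-derivative by i al costs O(e), and the corrector terms are O(e) already. The
    leading part vanishes by the formula for P and by 4 (i al)^2 + 1 = 0. *)
Lemma error_x : small 1 (fun e x => packet_image f P A B Q e ord0 x
  - lam * packet_velocity f A B e ord0 x).
Proof.
have UM := fun F => @smallM R 1 (fun x => Uc x.1.2) F _ Uc_bound.
have UM' := fun F => @smallM R 1 (fun x => Uc' x.1.2) F _ Uc'_bound.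
have dx a m n (da : decays a) : small 1 (fun e x => a x.1.2 *
    (horizontal al e m.+1 n x - ia * horizontal al e m n x)).
  by apply: small_horizontal_dx; exact: dd.
have h1 a m n (da : decays a) : small 1 (fun e x => a x.1.2 * horizontal1 al e m n x).
  exact: (small_horizontal1 al2 (dd da) m n).
have h2 a m n (da : decays a) : small 1 (fun e x => a x.1.2 * horizontal2 al e m n x).
  exact: (small_horizontal2 al2 (dd da) m n).
have df' := decaying_cD df; have dA' := decaying_cD dA; have dB' := decaying_cD dB.
(* The three terms in P telescope: they trade the third x-derivative for (i al)^3 one factor at a
   time, with (i al)^2 = -1/4. *)
have := smallD (smallD (smallD (smallZ (-1) (UM _ (dx _ 0%N 0%N df'))) (UM' _ (dx _ 0%N 0%N df)))
  (smallZ (-4) (smallD (smallD (dx _ 2%N 0%N dP) (smallZ ia (dx _ 1%N 0%N dP)))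
    (smallZ (- 4^-1) (dx _ 0%N 0%N dP)))))
  (smallD (smallD (smallD (smallZ (-1) (UM _ (h1 _ 1%N 0%N dA'))) (UM' _ (h1 _ 1%N 0%N dA)))
    (smallD (h1 _ 3%N 0%N dQ) (smallZ (ia * bg) (h1 _ 0%N 0%N dA'))))
  (smallD (smallD (smallZ (-1) (UM _ (h2 _ 1%N 0%N dB'))) (UM' _ (h2 _ 1%N 0%N dB)))
    (smallZ (ia * bg) (h2 _ 0%N 0%N dB')))).
apply: small_ext => e x.
have [_ HP _ _] := prof; have E : 4 * ia ^+ 2 + 1 = 0.
  by rewrite ia2 ?al2// mulrN divff ?addNr// pnatr_eq0.
rewrite /lam growth_rateE /packet_image /packet_velocity /vec3 /= /packet.
have : P x.1.2 = _ := HP x.1.2; move: E.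
rewrite -/ia; move: (P x.1.2) (Uc x.1.2) (Uc' x.1.2) (f x.1.2) (cD f x.1.2) (A x.1.2)
  (cD A x.1.2) (B x.1.2) (cD B x.1.2) (Q x.1.2) => p U U' f0 f1 A0 A1 B0 B1 Q0.
move: (horizontal al e 0 0 x) (horizontal al e 1 0 x) (horizontal al e 2 0 x)
  (horizontal al e 3 0 x) => G0 G1 G2 G3.
move: (horizontal1 al e 0 0 x) (horizontal1 al e 1 0 x) (horizontal1 al e 3 0 x)
  (horizontal2 al e 0 0 x) (horizontal2 al e 1 0 x) (horizontal2 al e 3 0 x)
  => H0 H1 H3 K0 K1 K3 E Hp.
apply/eqP; rewrite -subr_eq0; apply/eqP.
transitivity ((4 * ia ^+ 2 + 1) * p * G1 + ia * G0 * ((U - bg) * f1 - U' * f0 - p));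
  last by rewrite E Hp; ring.
by clear Hp E; move: ia bg => a b; field.
Qed.

(** Since P' = (U - c) f / 4, the leading terms in U f cancel exactly. What remains of the leading
    part is c f times (d_x - i al) applied to a wave. *)
Lemma error_y : small 1 (fun e x => packet_image f P A B Q e (lift ord0 ord0) x
  - lam * packet_velocity f A B e (lift ord0 ord0) x).
Proof.
have UM := fun F => @smallM R 1 (fun x => Uc x.1.2) F _ Uc_bound.
have h1 a m n (da : decays a) : small 1 (fun e x => a x.1.2 * horizontal1 al e m n x).
  exact: (small_horizontal1 al2 (dd da) m n).
have h2 a m n (da : decays a) : small 1 (fun e x => a x.1.2 * horizontal2 al e m n x).
  exact: (small_horizontal2 al2 (dd da) m n).
have dQ' := decaying_cD dQ.
have := smallD (smallD (smallZ bg (small_horizontal_dx al (dd df) 1 0))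
    (smallD (UM _ (h1 _ 2%N 0%N dA)) (UM _ (h2 _ 2%N 0%N dB))))
  (smallD (h1 _ 2%N 0%N dQ') (smallZ (- (ia * bg)) (smallD (h1 _ 1%N 0%N dA) (h2 _ 1%N 0%N dB)))).
apply: small_ext => e x.
have [_ _ /(_ x.1.2)[Hp _] _] := prof.
rewrite /lam growth_rateE /packet_image /packet_velocity /vec3 /= /packet Hp -/ia.
move: (Uc x.1.2) (f x.1.2) (A x.1.2) (B x.1.2) (cD Q x.1.2) => U f0 A0 B0 Q0.
move: (horizontal al e 1 0 x) (horizontal al e 2 0 x) => G1 G2.
move: (horizontal1 al e 1 0 x) (horizontal1 al e 2 0 x)
  (horizontal2 al e 1 0 x) (horizontal2 al e 2 0 x) => H1 H2 K1 K2.
by move: ia bg => a b; field.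
Qed.

(** The velocity has no z-component, and the z-derivative of the pressure falls on the slow
    cutoff. *)
Lemma error_z : small 1 (fun e x => packet_image f P A B Q e (lift ord0 (lift ord0 ord0)) x
  - lam * packet_velocity f A B e (lift ord0 (lift ord0 ord0)) x).
Proof.
have h1 a m n (da : decays a) : small 1 (fun e x => a x.1.2 * horizontal1 al e m n x).
  exact: (small_horizontal1 al2 (dd da) m n).
have := smallD (smallZ (-4) (small_horizontal_dz al (dd dP) 2 0)) (h1 _ 2%N 1%N dQ).
apply: small_ext => e x.
rewrite /packet_image /packet_velocity /vec3 /= /packet.
move: (P x.1.2) (Q x.1.2) (horizontal al e 2 1 x) (horizontal1 al e 2 1 x)
  (horizontal2 al e 2 1 x) lam => p q a b c l; ring.
Qed.

Lemma small_zero k : small k (fun (_ : R) (_ : R3) => 0).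
Proof.
exists 0 => // e x _; rewrite Normc.normc0 !mul0r//.
Qed.

Lemma small_L2fun (F : R -> R3 -> R[i]) e : 0 < e <= 1 -> small 0 F ->
  ccontinuous (F e) -> L2fun (F e).
Proof.
move=> e01 [C C0 HC] cF; have /andP[e0 _] := e01.
by apply: (@dominated_L2fun R _ e C e0 cF) => x; have := HC e x e01; rewrite expr0 mulr1.
Qed.

Let P4 y := - 4 * P y.
Let dP4 : decays P4. Proof. exact: decayingZ. Qed.
Let dP4' : decays (fun y => - 4 * cD P y).
Proof. by apply: decayingZ; exact: decaying_cD. Qed.

Let cUc : ccontinuous (fun x : R3 => Uc x.1.2).
Proof.
exact: (@ccontinuous_coord R (Ordinal (isT : (1 < 3)%N)) _
  (cder_ccontinuous (cder_real (is_derive_shear beta)))).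
Qed.

Let cUc' : ccontinuous (fun x : R3 => Uc' x.1.2).
Proof.
by split; [exact: (continuous_x2 (@shear'_continuous R beta))|exact: cst_continuous].
Qed.

Let ccp e a0 a1 a2 m n := @packet_ccontinuous e a0 a1 a2 m n.
Let df' := decaying_cD df.
Let dA' := decaying_cD dA.
Let dB' := decaying_cD dB.
Let dQ' := decaying_cD dQ.

Lemma velocity_ccontinuous e i : ccontinuous (packet_velocity f A B e i).
Proof.
apply: vec3_ind; first exact: ccp.
- by apply: ccontinuousM; [exact: ccontinuous_cst|exact: ccp].
- exact: ccontinuous_cst.
Qed.

Lemma velocity_small i : small 0 (fun e x => packet_velocity f A B e i x).
Proof.
rewrite /packet_velocity /vec3; case: (val i == 0%N); last case: (val i == 1%N).
- exact: packet_small.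
- by apply: smallZ; exact: packet_small.
- exact: small_zero.
Qed.

Let cNUc : ccontinuous (fun x : R3 => - Uc x.1.2).
Proof.
by under eq_fun do rewrite -mulN1r; apply: ccontinuousM => //; exact: ccontinuous_cst.
Qed.

Let ccW1 e : ccontinuous (fun x => (- Uc x.1.2) * packet al e (cD f) (cD A) (cD B) 1 0 x
    + Uc' x.1.2 * packet al e f A B 1 0 x
    + packet al e (fun y => - 4 * P y) Q nul 3 0 x).
Proof.
apply: ccontinuousD; last exact: ccp.
by apply: ccontinuousD; apply: ccontinuousM => //; exact: ccp.
Qed.

Let ccW2 e : ccontinuous (fun x => Uc x.1.2 * packet al e f A B 2 0 x
    + packet al e (fun y => - 4 * cD P y) (cD Q) nul 2 0 x).
Proof. by apply: ccontinuousD; [apply: ccontinuousM => //|]; exact: ccp. Qed.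

Lemma image_ccontinuous e i : ccontinuous (packet_image f P A B Q e i).
Proof. by apply: vec3_ind; [exact: ccW1|exact: ccW2|exact: ccp]. Qed.

Lemma image_small i : small 0 (fun e x => packet_image f P A B Q e i x).
Proof.
have UM := fun F => @smallM R 0 (fun x => Uc x.1.2) F _ Uc_bound.
have UM' := fun F => @smallM R 0 (fun x => Uc' x.1.2) F _ Uc'_bound.
have UN F : small 0 F -> small 0 (fun e x => - Uc x.1.2 * F e x).
  move=> sF; apply: (small_ext _ (smallZ (-1) (UM _ sF))) => e x; ring.
rewrite /packet_image /vec3; case: (val i == 0%N); last case: (val i == 1%N).
- apply: smallD; last exact: packet_small.
  by apply: smallD; [apply: UN|apply: UM']; exact: packet_small.
- by apply: smallD; [apply: UM|]; exact: packet_small.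
- exact: packet_small.
Qed.

Let cpx e a0 a1 a2 (i : 'I_3) m n : val i = 0%N -> decays a0 -> decays a1 -> decays a2 ->
  cpartial i (packet al e a0 a1 a2 m n) (packet al e a0 a1 a2 m.+1 n).
Proof.
move=> i0 d0 d1 d2; have := cpartial_packet al e (decaying_cder d0) (decaying_cder d1)
  (decaying_cder d2) i m n.
by apply: cpartial_ext; apply/funext => x; rewrite i0.
Qed.

Let cpy e a0 a1 a2 (i : 'I_3) m n : val i = 1%N -> decays a0 -> decays a1 -> decays a2 ->
  cpartial i (packet al e a0 a1 a2 m n) (packet al e (cD a0) (cD a1) (cD a2) m n).
Proof.
move=> i1 d0 d1 d2; have := cpartial_packet al e (decaying_cder d0) (decaying_cder d1)
  (decaying_cder d2) i m n.
by apply: cpartial_ext; apply/funext => x; rewrite i1.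
Qed.

Let cpz e a0 a1 a2 (i : 'I_3) m n : val i = 2%N -> decays a0 -> decays a1 -> decays a2 ->
  cpartial i (packet al e a0 a1 a2 m n) (packet al e a0 a1 a2 m n.+1).
Proof.
move=> i2 d0 d1 d2; have := cpartial_packet al e (decaying_cder d0) (decaying_cder d1)
  (decaying_cder d2) i m n.
by apply: cpartial_ext; apply/funext => x; rewrite i2.
Qed.

Lemma velocity_divergence_free e : 0 < e <= 1 -> L2_divfree (packet_velocity f A B e).
Proof.
move=> e01; split=> [i|phi tp].
  exact: (small_L2fun e01 (velocity_small i) (velocity_ccontinuous e i)).
apply: (@divergence_free _ _ _ (packet al e (cD f) (cD A) (cD B) 1 0)
  (fun x => -1 * packet al e (cD f) (cD A) (cD B) 1 0 x) (fun=> 0) phi);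
  last exact: tp.
- exact: ccp.
- by apply: ccontinuousM; [exact: ccontinuous_cst|exact: ccp].
- exact: ccontinuous_cst.
- exact: ccp.
- by apply: ccontinuousM; [exact: ccontinuous_cst|exact: ccp].
- exact: ccontinuous_cst.
- by move=> i i0; exact: cpx.
- move=> i i1; have := cpartialM (cpartial_cst i (-1)) (cpy e 1 0 i1 df dA dB).
  by apply: cpartial_ext; apply/funext => x; rewrite mul0r add0r.
- by move=> i _; exact: cpartial_cst.
- by move=> x; rewrite addr0 mulN1r subrr.
Qed.

Let dcP4 : cD P4 = (fun y => - 4 * cD P y).
Proof. exact: cDZ. Qed.

Let dcP4' : cD (fun y => - 4 * cD P y) = (fun y => - 4 * cD (cD P) y).
Proof. by apply: cDZ; exact: decaying_cD. Qed.

Let cDnul : cD nul = nul.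
Proof. by apply: cDE; exact: cder_cst. Qed.

Let cpU (i : 'I_3) : val i != 1%N -> cpartial i (fun x => Uc x.1.2) (fun=> 0).
Proof.
move=> i1; have := @cpartial_coord R i (Ordinal (isT : (1 < 3)%N)) _ _ (cder_real (is_derive_shear beta)).
by apply: cpartial_ext; apply/funext => x; rewrite -val_eqE /= (negPf i1).
Qed.

Let cpU1 (i : 'I_3) : val i = 1%N -> cpartial i (fun x => Uc x.1.2) (fun x => Uc' x.1.2).
Proof.
move=> i1; have := @cpartial_coord R i (Ordinal (isT : (1 < 3)%N)) _ _ (cder_real (is_derive_shear beta)).
by apply: cpartial_ext; apply/funext => x; rewrite -val_eqE /= i1.
Qed.

Let cpU' (i : 'I_3) : val i = 0%N -> cpartial i (fun x => Uc' x.1.2) (fun=> 0).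
Proof.
move=> i0 x; split; last exact: is_derive_cst.
apply: line_is_derive; set F := (X in is_derive _ _ X _).
have -> : F = (fun=> shear' beta x.1.2); last exact: is_derive_cst.
by apply/funext => h; rewrite /F /= i0 /= [h *: _]mulr0 add0r.
Qed.

Let cpUN (i : 'I_3) : val i = 0%N -> cpartial i (fun x => - Uc x.1.2) (fun=> 0).
Proof.
move=> i0; have i1 : val i != 1%N by rewrite i0.
have H := cpartialM (cpartial_cst i (-1)) (cpU i1).
have E1 : (fun x : R3 => -1 * Uc x.1.2) = (fun x => - Uc x.1.2).
  by apply/funext => x; rewrite mulN1r.
have E2 : (fun x : R3 => 0 * Uc x.1.2 + -1 * 0) = (fun=> 0).
  by apply/funext => x; rewrite mul0r mulr0 addr0.
by rewrite -E1 -E2.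
Qed.

Lemma image_divergence_free e : 0 < e <= 1 -> L2_divfree (packet_image f P A B Q e).
Proof.
move=> e01; split=> [i|phi tp].
  exact: (small_L2fun e01 (image_small i) (image_ccontinuous e i)).
apply: (@divergence_free
  (fun x => (- Uc x.1.2) * packet al e (cD f) (cD A) (cD B) 1 0 x
    + Uc' x.1.2 * packet al e f A B 1 0 x
    + packet al e (fun y => - 4 * P y) Q nul 3 0 x)
  (fun x => Uc x.1.2 * packet al e f A B 2 0 x
    + packet al e (fun y => - 4 * cD P y) (cD Q) nul 2 0 x)
  (packet al e (fun y => - 4 * P y) Q nul 2 1)
  (fun x => (0 * packet al e (cD f) (cD A) (cD B) 1 0 x
    + (- Uc x.1.2) * packet al e (cD f) (cD A) (cD B) 2 0 x)
    + (0 * packet al e f A B 1 0 x + Uc' x.1.2 * packet al e f A B 2 0 x)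
    + packet al e P4 Q nul 4 0 x)
  (fun x => Uc' x.1.2 * packet al e f A B 2 0 x
    + Uc x.1.2 * packet al e (cD f) (cD A) (cD B) 2 0 x
    + packet al e (cD (fun y => - 4 * cD P y)) (cD (cD Q)) (cD nul) 2 0 x)
  (packet al e P4 Q nul 2 2) phi); last exact: tp.
- exact: ccW1.
- exact: ccW2.
- exact: ccp.
- apply: ccontinuousD; last exact: ccp.
  apply: ccontinuousD; apply: ccontinuousD; apply: ccontinuousM;
    [exact: ccontinuous_cst|exact: ccp|exact: cNUc|exact: ccp|
     exact: ccontinuous_cst|exact: ccp|exact: cUc'|exact: ccp].
- apply: ccontinuousD; last first.
    rewrite cDnul; apply: ccp dn; [exact: (decaying_cD dP4')|exact: (decaying_cD dQ')].
  apply: ccontinuousD; apply: ccontinuousM; [exact: cUc'|exact: ccp|exact: cUc|exact: ccp].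
- exact: ccp.
- move=> i i0; exact: (cpartialD (cpartialD (cpartialM (cpUN i0) (cpx e 1 0 i0 df' dA' dB'))
    (cpartialM (cpU' i0) (cpx e 1 0 i0 df dA dB))) (cpx e 3 0 i0 dP4 dQ dn)).
- move=> i i1; exact: (cpartialD (cpartialM (cpU1 i1) (cpy e 2 0 i1 df dA dB))
    (cpy e 2 0 i1 dP4' dQ' dn)).
- by move=> i i2; exact: cpz.
(* The divergence is 2 U' d_x^2 Psi + Laplace p. Write G, H, K for the horizontal factors of the
   three terms of a packet, differentiated twice in x. By P'' = P / 4 + U' f / 2, Laplace p = - 2 U'
   f G + (Q'' - P) H + Q K, which the equations for A and B turn into - 2 U' (f G + A H + B K). *)
- move=> x; rewrite cDnul dcP4' /packet /horizontal2 /P4.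
  have [_ _ /(_ x.1.2)[_ Hp] /(_ x.1.2)[H1 H2]] := prof.
  have {}H1 : cD (cD Q) x.1.2 = P x.1.2 - 2 * Uc' x.1.2 * A x.1.2 by rewrite -H1; ring.
  rewrite Hp H1 H2 /horizontal1.
  move: (P x.1.2) (Uc x.1.2) (Uc' x.1.2) (f x.1.2) (cD f x.1.2) (A x.1.2)
    (cD A x.1.2) (B x.1.2) (cD B x.1.2) => p U U' f0 f1 A0 A1 B0 B1.
  by move: (horizontal al e) => h; field.
Qed.

Lemma packet_linearized e : 0 < e <= 1 ->
  linearized_euler (Ubar beta) (packet_velocity f A B e) (packet_image f P A B Q e).
Proof.
move=> e01; split; first exact: velocity_divergence_free.
split; first exact: image_divergence_free.
pose p := packet al e P4 Q nul 2 0; exists p.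
  by apply: (@small_L2fun (fun e => packet al e P4 Q nul 2 0)) => //; [exact: packet_small|exact: ccp].
pose Vx := vec3 (packet al e (cD f) (cD A) (cD B) 1 0)
  (fun x => 0 * packet al e f A B 1 0 x + -1 * packet al e f A B 2 0 x) (fun=> 0).
pose dp := vec3 (packet al e P4 Q nul 3 0) (packet al e (cD P4) (cD Q) (cD nul) 2 0)
  (packet al e P4 Q nul 2 1).
have cVx i : ccontinuous (Vx i).
  apply: vec3_ind; [exact: ccp| |exact: ccontinuous_cst].
  apply: ccontinuousD; apply: ccontinuousM;
    [exact: ccontinuous_cst|exact: ccp|exact: ccontinuous_cst|exact: ccp].
have cdp i : ccontinuous (dp i).
  by apply: vec3_ind; rewrite ?cDnul ?dcP4; exact: ccp.
have dVx j (i : 'I_3) : val i = 0%N -> cpartial i (packet_velocity f A B e j) (Vx j).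
  move=> i0; rewrite /packet_velocity /Vx /vec3.
  case: (val j == 0%N); first exact: cpx.
  case: (val j == 1%N); last exact: cpartial_cst.
  exact: (cpartialM (cpartial_cst i (-1)) (cpx e 1 0 i0 df dA dB)).
have ddp j : cpartial j p (dp j).
  rewrite /dp /vec3; case: (eqVneq (val j) 0%N) => [j0|j0]; first exact: cpx.
  case: (eqVneq (val j) 1%N) => [j1|j1]; first exact: cpy.
  by apply: cpz => //; move: j0 j1; case: j => [[|[|[|]]] ?].
have cadv j : ccontinuous (fun x => (shear beta x.1.2)%:C * Vx j x +
    (if val j == 0%N then (shear' beta x.1.2)%:C * packet_velocity f A B e (lift ord0 ord0) x else 0)).
  apply: ccontinuousD; first exact: ccontinuousM.
  case: (val j == 0%N); last exact: ccontinuous_cst.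
  by apply: ccontinuousM; [exact: cUc'|exact: velocity_ccontinuous].
move=> j phi tp.
rewrite (@shear_advection R beta (packet_velocity f A B e) (Vx j) j phi (fun i => velocity_ccontinuous e i) (cVx j) (dVx j) tp).
rewrite (dpartial_dfun _ (cdp j) (ddp j) tp); last exact: ccp.
rewrite dfunN// dfunD//; last first.
  have [c1 c2] := cadv j; split; under eq_fun do rewrite raddfN /=.
    by move=> x; apply: cvgN; exact: c1.
  by move=> x; apply: cvgN; exact: c2.
apply: (congr1 (fun F => dfun F phi)); apply/funext => x; rewrite /dp cDnul dcP4 /Vx /packet_image /packet_velocity.
have v1 (a b c : R3 -> R[i]) : vec3 a b c (lift ord0 ord0) = b by [].
rewrite v1 /vec3; case: (val j == 0%N); last case: (val j == 1%N).
- move: (packet _ _ _ _ _ _ _ x) (packet _ _ _ _ _ _ _ x) (packet _ _ _ _ _ _ _ x) => a b c.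
  ring.
- move: (packet _ _ _ _ _ _ _ x) (packet _ _ _ _ _ _ _ x) (packet _ _ _ _ _ _ _ x) => a b c.
  ring.
- by rewrite mulr0 addr0 oppr0 add0r.
Qed.

End Profile.
End UnstablePacket.

(** * Normalised packets as approximate eigenvectors *)

Section Instability.
Variable R : realType.
Local Notation R3 := (R * R * R)%type.
Local Notation leb3 := (@leb3 R).
Local Open Scope complex_scope.
Local Notation normc := Normc.normc.
Variables (beta g : R).
Hypothesis beta0 : beta != 0.

Let al : R := Num.sg beta / 2.
Let lam : R[i] := (growth_rate beta g)%:C.

Section Fixed.
Variables f P A B Q : R -> R[i].
Hypothesis prof : is_profile beta g f P A B Q.

Let decs := let: And4 h _ _ _ := prof in h.
Let df : decaying (- 2^-1) f := let: And5 h _ _ _ _ := decs in h.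
Let dP : decaying (- 2^-1) P := let: And5 _ h _ _ _ := decs in h.
Let dA : decaying (- 2^-1) A := let: And5 _ _ h _ _ := decs in h.
Let dB : decaying (- 2^-1) B := let: And5 _ _ _ h _ := decs in h.
Let dQ : decaying (- 2^-1) Q := let: And5 _ _ _ _ h := decs in h.

Lemma packet_velocityZ c e i x : packet_velocity beta (fun y => c * f y)
    (fun y => c * A y) (fun y => c * B y) e i x = c * packet_velocity beta f A B e i x.
Proof.
rewrite /packet_velocity !cDZ// /vec3 /packet.
case: (val i == 0%N); [|case: (val i == 1%N)]; last by rewrite mulr0.
- move: (horizontal _ _ _ _ _) (horizontal1 _ _ _ _ _) (horizontal2 _ _ _ _ _) => a b d; ring.
- move: (horizontal _ _ _ _ _) (horizontal1 _ _ _ _ _) (horizontal2 _ _ _ _ _) => a b d; ring.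
Qed.

Lemma packet_imageZ c e i x : packet_image beta (fun y => c * f y) (fun y => c * P y)
    (fun y => c * A y) (fun y => c * B y) (fun y => c * Q y) e i x =
  c * packet_image beta f P A B Q e i x.
Proof.
rewrite /packet_image !cDZ// /vec3 /packet.
move: (horizontal al e) (horizontal1 al e) (horizontal2 al e) => a b d.
by case: (val i == 0%N); [ring|case: (val i == 1%N); ring].
Qed.

Definition defect e : cvfield R := fun i x =>
  packet_image beta f P A B Q e i x - lam * packet_velocity beta f A B e i x.

Lemma defect_ccontinuous e i : ccontinuous (defect e i).
Proof.
have H := ccontinuousD (image_ccontinuous prof e i)
  (ccontinuousM (ccontinuous_cst _ (- lam)) (velocity_ccontinuous prof e i)).
move: H; set F := (X in ccontinuous X -> _); suff -> : F = defect e i by [].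
by apply/funext => x; rewrite /F /defect mulNr.
Qed.

(** The error is O(e) pointwise while the envelope has integral of order e^-2, so the two powers
    cancel. *)
Lemma defect_energy : exists C, forall e, 0 < e <= 1 ->
  (\int[leb3]_x (sqnorm (defect e) x)%:E <= C%:E)%E.
Proof.
have [C0 _ H0] := error_x beta0 prof; have [C1 _ H1] := error_y beta0 prof.
have [C2 _ H2] := error_z beta0 prof.
pose C := `|C0| + (`|C1| + `|C2|).
exists (3 * C ^+ 2 * pi ^+ 3) => e e01; have /andP[e0 _] := e01.
have -> : 3 * C ^+ 2 * pi ^+ 3 = 3 * (C * e) ^+ 2 * (pi ^+ 3 / e ^+ 2).
  by field; rewrite gt_eqF.
apply: energy_le => // [i|i x]; first exact: defect_ccontinuous.
have o0 := ltW (om3_gt0 e x).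
have K c : normc (defect e i x) <= c * e ^+ 1 * om3 e x -> `|c| <= C ->
    normc (defect e i x) <= C * e * om3 e x.
  move=> h cC; apply: le_trans h _; rewrite expr1 ler_wpM2r// ler_wpM2r ?(ltW e0)//.
  exact: le_trans (ler_norm _) cC.
have nn (z : R) := normr_ge0 z.
have c0 : `|C0| <= C by rewrite lerDl addr_ge0.
have c1 : `|C1| <= C by rewrite /C addrCA lerDl addr_ge0.
have c2 : `|C2| <= C by rewrite /C addrA lerDr addr_ge0.
move: K; have [->|[->|->]] : i = ord0 \/ i = lift ord0 ord0 \/ i = lift ord0 (lift ord0 ord0).
  by move: i => [[|[|[|//]]] hi]; [left|right; left|right; right]; exact/val_inj.
- by move=> K; exact: (K C0 (H0 e x e01)).
- by move=> K; exact: (K C1 (H1 e x e01)).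
- by move=> K; exact: (K C2 (H2 e x e01)).
Qed.

Lemma velocity_energy_finite e : 0 < e <= 1 ->
  (\int[leb3]_x (sqnorm (packet_velocity beta f A B e) x)%:E < +oo)%E.
Proof.
move=> e01; have /andP[e0 _] := e01.
have [C0 p0 H0] := velocity_small beta0 prof ord0.
have [C1 p1 H1] := velocity_small beta0 prof (lift ord0 ord0).
apply: (le_lt_trans (energy_le (C := C0 + C1) e0 (fun i => velocity_ccontinuous prof e i) _));
  last exact: ltry.
move=> i x; have o0 := ltW (om3_gt0 e x).
have [->|[->|->]] : i = ord0 \/ i = lift ord0 ord0 \/ i = lift ord0 (lift ord0 ord0).
  by move: i => [[|[|[|//]]] hi]; [left|right; left|right; right]; exact/val_inj.
- by apply: le_trans (H0 e x e01) _; rewrite expr0 mulr1 ler_wpM2r// lerDl.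
- by apply: le_trans (H1 e x e01) _; rewrite expr0 mulr1 ler_wpM2r// lerDr.
- have -> : packet_velocity beta f A B e (lift ord0 (lift ord0 ord0)) x = 0 by [].
  by rewrite Normc.normc0 mulr_ge0// addr_ge0.
Qed.

Lemma normcB_le (z w : R[i]) : normc z - normc w <= normc (z + w).
Proof.
rewrite lerBlDr; have := le_normcD (z + w) (- w).
by rewrite addrK normcN.
Qed.

Lemma om_ge_half (t : R) : `|t| <= 1 -> 2^-1 <= om t.
Proof.
move=> t1; rewrite /om lef_pV2 ?posrE ?ltr_pwDl ?sqr_ge0//.
have t2 : t ^+ 2 <= 1 by rewrite -(real_normK (num_real t)) expr_le1.
lra.
Qed.

Lemma normc_carried_wave (a e t : R) : normc (wave a e 0 0 t) = om (e * t).
Proof.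
by rewrite [wave _ _ _ _ _]/= Normc.normcM normc_carrier mul1r normc_real ger0_norm// ltW// om_gt0.
Qed.

(** Up to sign and O(e), the y-component is i al f times the undifferentiated wave. For |x|, |z| <=
    1/e both cutoffs are at least 1/2, and |f| >= |f(y0)| / 2 near [y0], so this main part has
    modulus at least |f(y0)| / 16. *)
Lemma velocity_lower_bound y0 : f y0 != 0 -> exists a e0, [/\ 0 < a, 0 < e0 <= 1 &
  forall e, 0 < e <= e0 ->
    ((a / e ^+ 2)%:E <= \int[leb3]_x (sqnorm (packet_velocity beta f A B e) x)%:E)%E].
Proof.
move=> fy0; pose n0 := normc (f y0).
have n0_gt0 : 0 < n0.
  by rewrite lt_neqAle normc_ge0 andbT eq_sym; apply: contra fy0 => /eqP/Normc.eq0_normc ->.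
have [d d0 Hd] : exists2 d, 0 < d & forall y, `|y - y0| <= d -> n0 / 2 <= normc (f y).
  have [c1 c2] := decaying_ccontinuous df.
  pose h y := complex.Re (f y) * complex.Re (f y) + complex.Im (f y) * complex.Im (f y).
  have hE y : h y = normc (f y) ^+ 2 by rewrite normc_sqr !expr2.
  have ch : continuous h.
    by move=> y; apply: cvgD; apply: cvgM; [exact: c1|exact: c1|exact: c2|exact: c2].
  have hy : (n0 / 2) ^+ 2 < h y0.
    by rewrite hE -/n0 ltr_pXn2r ?nnegrE ?divr_ge0 ?(ltW n0_gt0)// ltr_pdivrMr// ltr_pMr// ltr1n.
  have /nbhs_ballP[r /= r0 Hr] : \forall y \near y0, (n0 / 2) ^+ 2 < h y.
    exact: (cvgr_gt _ (ch y0) _ hy).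
  exists (r / 2); first exact: divr_gt0.
  move=> y yd; have : (n0 / 2) ^+ 2 < h y.
    by apply: Hr; rewrite /ball /= distrC (le_lt_trans yd)// ltr_pdivrMr// ltr_pMr// ltr1n.
  by rewrite hE ltr_pXn2r ?nnegrE ?normc_ge0 ?divr_ge0 ?(ltW n0_gt0)// => /ltW.
pose ia : R[i] := 0 +i* al.
have [C C0 HC] := smallD (small_horizontal_dx al (decaying_dominated df) 0 0)
  (smallD (small_horizontal1 (al2 beta0) (decaying_dominated dA) 1 0)
          (small_horizontal2 (al2 beta0) (decaying_dominated dB) 1 0)).
(* Below this threshold the O(e) remainder is at most n0 / 32, half of the main part. *)
pose e0 := Num.min 1 (n0 / (32 * (C + 1))).
have C1 : 0 < C + 1 by rewrite ltr_wpDl.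
have e0_gt0 : 0 < e0.
  by rewrite lt_min ltr01/= divr_gt0// mulr_gt0.
(* The square of the pointwise lower bound n0 / 32, times the volume 8 d / e^2 of the box with its
   factor e^-2 removed. *)
exists (8 * (n0 / 32) ^+ 2 * d), e0; split; last first.
- move=> e /andP[e_gt0 ee0].
  have [e1 en] : e <= 1 /\ e <= n0 / (32 * (C + 1)).
    by move: ee0; rewrite le_min => /andP[].
  have e01 : 0 < e <= 1 by rewrite e_gt0.
  have -> : 8 * (n0 / 32) ^+ 2 * d / e ^+ 2 =
      (n0 / 32) ^+ 2 * (2 * e^-1 * (2 * d) * (2 * e^-1)).
    by field; rewrite gt_eqF.
  apply: (energy_ge (j := lift ord0 ord0) (y0 := y0)) => //.
  + by rewrite invr_gt0.
  + exact: sqr_ge0.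
  + by move=> i; exact: (velocity_ccontinuous prof).
  move=> x y z xe yd ze.
  have sc t : `|t| <= e^-1 -> `|e * t| <= 1.
    by move=> te; rewrite normrM (gtr0_norm e_gt0) mulrC -ler_pdivlMr// div1r.
  have o1 := om_ge_half (sc _ xe); have o2 := om_ge_half (sc _ ze).
  have fy := Hd y yd.
  have Eq : packet_velocity beta f A B e (lift ord0 ord0) (x, y, z) =
      - (ia * f y * horizontal al e 0 0 (x, y, z) +
      (f y * (horizontal al e 1 0 (x, y, z) - ia * horizontal al e 0 0 (x, y, z))
      + (A y * horizontal1 al e 1 0 (x, y, z) + B y * horizontal2 al e 1 0 (x, y, z)))).
    rewrite /packet_velocity /vec3 /= /packet.
    move: (horizontal al e) (horizontal1 al e) (horizontal2 al e) => a b c /=; ring.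
  rewrite Eq normcN ler_pXn2r ?nnegrE ?normc_ge0 ?divr_ge0 ?(ltW n0_gt0)//.
  apply: le_trans (normcB_le _ _).
  have small_part := HC e (x, y, z) e01.
  have big_part : n0 / 16 <= normc (ia * f y * horizontal al e 0 0 (x, y, z)).
    have Eh : normc (horizontal al e 0 0 (x, y, z)) = om (e * x) * om (e * z).
      rewrite /horizontal (Normc.normcM (wave al e 0 0 _) (wave 0 e 0 0 _)).
      by rewrite !normc_carried_wave.
    rewrite (Normc.normcM (ia * f y)) (Normc.normcM ia) Eh.
    have -> : normc ia = 2^-1.
      by rewrite /= expr0n add0r (al2 beta0) (_ : 4^-1 = (2^-1) ^+ 2) ?sqrtr_sqr ?ger0_norm ?invr_ge0//; field.
    have -> : n0 / 16 = 2^-1 * (n0 / 2) * (2^-1 * 2^-1) by field.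
    have f1 : 2^-1 * (n0 / 2) <= 2^-1 * normc (f y) by rewrite ler_wpM2l ?invr_ge0.
    by apply: ler_pM => //; rewrite ?ler_pM ?mulr_ge0 ?invr_ge0 ?divr_ge0 ?(ltW n0_gt0).
  apply: (@le_trans _ _ (n0 / 16 - n0 / 32)); first by lra.
  apply: lerB big_part _; apply: le_trans small_part _; rewrite expr1.
  apply: (@le_trans _ _ (C * e)); first by rewrite ler_piMr ?om3_le1// mulr_ge0// ltW.
  apply: (@le_trans _ _ ((C + 1) * (n0 / (32 * (C + 1))))).
    by apply: ler_pM => //; [exact: ltW|rewrite lerDl].
  by rewrite le_eqVlt; apply/orP; left; apply/eqP; field; rewrite gt_eqF.
- by rewrite e0_gt0/= /e0 ge_min lexx.
- by rewrite !mulr_gt0// exprn_gt0// divr_gt0.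
Qed.

Lemma L2norm_scale (V W : cvfield R) (c E : R) :
  (forall i x, W i x = c%:C * V i x) -> (forall i, ccontinuous (V i)) ->
  (\int[leb3]_x (sqnorm V x)%:E = E%:E)%E -> L2norm W = ((c ^+ 2 * E)%:E `^ 2^-1)%E.
Proof.
move=> WV cV EE; rewrite L2normE EFinM -EE; congr (_ `^ _)%E.
have ms : measurable_fun setT (fun x => (sqnorm V x)%:E).
  by apply/measurable_EFinP; apply: continuous_measurable3; exact: sqnorm_continuous.
have p0 x : (0 <= (sqnorm V x)%:E)%E by rewrite lee_fin sqnorm_ge0.
rewrite -(@ge0_integralZl_EFin _ _ R leb3 setT measurableT _ (fun x _ => p0 x) ms _ (sqr_ge0 c)).
apply: eq_integral => x _; rewrite -EFinM; congr (_%:E).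
rewrite !sqnormE mulr_sumr; apply: eq_bigr => i _.
by rewrite WV Normc.normcM exprMn normc_real real_normK// num_real.
Qed.

(** Packets with e = [e0] / (n + 1) are divided by their norms. Their energy is at least a / e^2 and
    that of the defect at most C, so the normalised defect tends to 0 like e. *)
Lemma sigma_ap_growth_rate : 0 < g -> (exists y, f y != 0) ->
  sigma_ap (linearized_euler (Ubar beta)) lam.
Proof.
move=> g0 [y0 fy0]; have [a [e0 [a0 /andP[e0_gt0 e01] low]]] := velocity_lower_bound fy0.
have [C HC] := defect_energy.
pose e n : R := e0 / n.+1%:R.
have e_gt0 n : 0 < e n by rewrite divr_gt0.
have ele n : e n <= e0 by rewrite ler_pdivrMr// ler_peMr ?ler1n// ltW.
have e1 n : 0 < e n <= 1 by rewrite e_gt0 (le_trans (ele n)).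
pose v n := packet_velocity beta f A B (e n).
pose I n := (\int[leb3]_x (sqnorm (v n) x)%:E)%E; pose E n := fine (I n).
have I0 n : (0 <= I n)%E by apply: integral_ge0 => x _; rewrite lee_fin sqnorm_ge0.
have IE n : I n = (E n)%:E.
  by rewrite fineK// ge0_fin_numE//; exact: velocity_energy_finite (e1 n).
have aE n : a / e n ^+ 2 <= E n.
  by rewrite -lee_fin -IE; apply: low; rewrite e_gt0 ele.
have E_gt0 n : 0 < E n by apply: lt_le_trans (aE n); rewrite divr_gt0// exprn_gt0.
(* The energy is positive by the lower bound, so this factor gives unit norm. *)
pose c n := (Num.sqrt (E n))^-1.
have cE n : c n ^+ 2 * E n = 1.
  by rewrite /c exprVn sqr_sqrtr ?ltW// mulVf// gt_eqF.
pose d n := defect (e n).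
pose J n := (\int[leb3]_x (sqnorm (d n) x)%:E)%E; pose F n := fine (J n).
have J0 n : (0 <= J n)%E by apply: integral_ge0 => x _; rewrite lee_fin sqnorm_ge0.
have JE n : J n = (F n)%:E.
  by rewrite fineK// ge0_fin_numE//; exact: le_lt_trans (HC _ (e1 n)) (ltry _).
have F0 n : 0 <= F n by rewrite -lee_fin -JE.
have FC n : F n <= C by rewrite -lee_fin -JE; exact: HC.
have C0 : 0 <= C := le_trans (F0 0%N) (FC 0%N).
exists (fun n => packet_velocity beta (fun y => (c n)%:C * f y) (fun y => (c n)%:C * A y)
    (fun y => (c n)%:C * B y) (e n)),
  (fun n => packet_image beta (fun y => (c n)%:C * f y) (fun y => (c n)%:C * P y)
    (fun y => (c n)%:C * A y) (fun y => (c n)%:C * B y) (fun y => (c n)%:C * Q y) (e n)).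
split.
- by move=> n; exact: (packet_linearized beta0 (is_profileZ (c n)%:C prof) (e1 n)).
- move=> n; rewrite (@L2norm_scale (v n) _ (c n) (E n) _ _ (IE n)).
  + by rewrite cE poweR1r.
  + by move=> i x; rewrite packet_velocityZ.
  + by move=> i; exact: velocity_ccontinuous prof _ _.
- have NE n : L2norm (fun i x => packet_image beta (fun y => (c n)%:C * f y) (fun y => (c n)%:C * P y)
      (fun y => (c n)%:C * A y) (fun y => (c n)%:C * B y) (fun y => (c n)%:C * Q y) (e n) i x
    - lam * packet_velocity beta (fun y => (c n)%:C * f y) (fun y => (c n)%:C * A y)
      (fun y => (c n)%:C * B y) (e n) i x) = (Num.sqrt (c n ^+ 2 * F n))%:E.
    rewrite (@L2norm_scale (d n) _ (c n) (F n) _ _ (JE n)).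
    + by rewrite poweR_EFin powR12_sqrt// mulr_ge0// sqr_ge0.
    + move=> i x; rewrite packet_velocityZ packet_imageZ /d /defect mulrBr.
      by rewrite [lam * _]mulrCA.
    + by move=> i; exact: defect_ccontinuous.
  under eq_fun do rewrite NE.
  (* The quotient of the energies is at most C e^2 / a. *)
  pose K := Num.sqrt (C / a).
  apply: (@squeeze_cvge _ _ _ _ (fun=> 0%E) _ (fun n => (K * e n)%:E)).
  + apply: nearW => n; rewrite !lee_fin sqrtr_ge0/= /K.
    rewrite -(ger0_norm (ltW (e_gt0 n))) -sqrtr_sqr -sqrtrM ?divr_ge0 ?(ltW a0)//.
    apply: ler_wsqrtr; rewrite -[leRHS]mulr1 -(cE n).
    rewrite [leRHS](_ : _ = c n ^+ 2 * (C / a * e n ^+ 2 * E n)); last by ring.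
    rewrite ler_wpM2l ?sqr_ge0//; apply: le_trans (FC n) _.
    have : C / a * e n ^+ 2 * (a / e n ^+ 2) <= C / a * e n ^+ 2 * E n.
      by rewrite ler_wpM2l// mulr_ge0 ?sqr_ge0// divr_ge0// ltW.
    apply: le_trans; rewrite le_eqVlt; apply/orP; left; apply/eqP.
    by field; rewrite !gt_eqF.
  + exact: cvg_cst.
  + apply/fine_cvgP; split; first exact: nearW.
    have -> : fine \o (fun n => (K * e n)%:E) = (fun n => (K * e0) * harmonic n).
      by apply/funext => n /=; rewrite /e /harmonic mulrA.
    rewrite -[X in _ --> X](mulr0 (K * e0)); apply: cvgM; first exact: cvg_cst.
    exact: cvg_harmonic.
Qed.

End Fixed.
End Instability.

Theorem theorem1p3 (R : realType) (beta : R) (hbeta : beta != 0) :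
  exists2 lambda : complex R,
    sigma_ap (linearized_euler (Ubar beta)) lambda & 0 < complex.Re lambda.
Proof.
have [g g0 [f [P [A [B [Q [decs HP HP1 HAB nz]]]]]]] := packet_profiles beta.
exists (growth_rate beta g)%:C%C; last exact: growth_rate_gt0.
by apply: (@sigma_ap_growth_rate R beta g hbeta f P A B Q).
Qed.
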